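(* Let $\mathbf{D}=\{z\in\mathbb{C}:|z|<1\}$. Two proper holomorphic maps $f,g:\mathbf{D}\to\mathbf{D}$ have the same critical points in $\mathbf{D}$, counted with multiplicity, if and only if $f=\tau\circ g$ for some conformal automorphism $\tau$ of $\mathbf{D}$.
   Context: The multiplicity of a critical point $c$ of $f$ is the order of vanishing of $f'$ at $c$ (equivalently, the local degree of $f$ at $c$ minus one). A conformal automorphism of $\mathbf{D}$ is a biholomorphic map $\mathbf{D}\to\mathbf{D}$. *)

(* Defs.v *)
From HB Require Import structures.
From mathcomp Require Import all_boot all_order all_algebra complex.
From mathcomp Require Import all_classical all_reals all_analysis.
Set Implicit Arguments.
Unset Strict Implicit.
Unset Printing Implicit Defensive.
Import Order.TTheory GRing.Theory Num.Theory.
Import numFieldNormedType.Exports.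
Local Open Scope classical_set_scope.
Local Open Scope ring_scope.

(* The field R[i] with the topology of its modulus, seen as a normed module
   over itself: [derivable] and ['D_1] below are complex differentiability and
   the complex derivative.  A map defined on a subset is represented by a total
   function, of which only the values on that subset are relevant. *)
Definition Cplx (R : realType) : numFieldType := R[i].

Definition unit_disc (R : realType) : set (Cplx R) := [set z | `|z| < 1].
Arguments unit_disc : clear implicits.

(* To be used with an open set [U]. *)
Definition holomorphic_on (R : realType) (U : set (Cplx R))
    (f : Cplx R -> Cplx R) : Prop :=
  forall z, U z -> derivable f z 1.

(* For a subset of [A] (resp. [B]), compactness in the subspace topology and in
   the plane are the same. *)
Definition proper_map (R : realType) (A B : set (Cplx R))
    (f : Cplx R -> Cplx R) : Prop :=
  forall K : set (Cplx R), K `<=` B -> compact K -> compact (A `&` f @^-1` K).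

Definition proper_holomorphic_self_map (R : realType)
    (f : Cplx R -> Cplx R) : Prop :=
  [/\ set_fun (unit_disc R) (unit_disc R) f,
      holomorphic_on (unit_disc R) f
    & proper_map (unit_disc R) (unit_disc R) f].

Definition biholomorphic (R : realType) (A B : set (Cplx R))
    (f : Cplx R -> Cplx R) : Prop :=
  [/\ set_fun A B f, holomorphic_on A f
    & exists f' : Cplx R -> Cplx R,
      [/\ set_fun B A f', holomorphic_on B f',
          (forall z, A z -> f' (f z) = z)
        & (forall w, B w -> f (f' w) = w)]].

Definition disc_automorphism (R : realType) (tau : Cplx R -> Cplx R) : Prop :=
  biholomorphic (unit_disc R) (unit_disc R) tau.

(* [h] vanishes at [c] to order exactly [m]: near [c], [h] is [(z - c)^m] times
   a holomorphic function that does not vanish at [c].  The relation holds for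
   at most one [m], and for none if [h] is identically zero near [c]. *)
Definition vanishing_order (R : realType) (h : Cplx R -> Cplx R) (c : Cplx R)
    (m : nat) : Prop :=
  exists k : Cplx R -> Cplx R,
    [/\ \forall z \near c, derivable k z 1, k c != 0
      & \forall z \near c, h z = (z - c) ^+ m * k z].

Definition critical_point (R : realType) (f : Cplx R -> Cplx R)
    (c : Cplx R) : Prop :=
  'D_1 f c = 0.

Definition critical_multiplicity (R : realType) (f : Cplx R -> Cplx R)
    (c : Cplx R) (m : nat) : Prop :=
  vanishing_order ('D_1 f) c m.

Definition same_critical_points (R : realType) (U : set (Cplx R))
    (f g : Cplx R -> Cplx R) : Prop :=
  (forall c, U c -> critical_point f c <-> critical_point g c) /\
  (forall c, U c -> critical_point f c -> forall m,
     critical_multiplicity f c m <-> critical_multiplicity g c m).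

(* Main.v *)
(* Let f and g be proper with the same critical points. Then f' = h g' with h
   holomorphic and without zeros in the disc. A proper map is a Blaschke product,
   and an explicit computation shows that |f'| (1 - |z|^2) / (1 - |f|^2) tends to
   1 at the unit circle; hence so does F = |h| (1 - |g|^2) / (1 - |f|^2). If F had
   an interior maximum above 1, then after moving f and g to 0 at that point by
   automorphisms |h| would have a strict local maximum there. So F <= 1 and, by
   symmetry, F = 1: f and g pull the hyperbolic metric back to the same metric.
   Normalizing f 0 = g 0 = 0 and comparing orders of vanishing at 0 then forces h
   to be a unimodular constant, so f = h g.

   The function theory comes from the mean value inequality, which is Goursat's
   theorem for f (exp w) on a rectangle of height 2 pi. It gives the maximum
   principle, also for continuous functions with finitely many points of
   non-differentiability; and applying this to differences of difference
   quotients shows that continuous singularities are removable, without any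
   integral formula. *)

(* The comparison is the Ahlfors-Schwarz argument without its curvature computation: no Laplacian of
   log F is taken, because after the normalization |f| > |g| near the maximum already makes (1 -
   |g|^2) / (1 - |f|^2) larger than 1 there. Equal multiplicities are what makes both h and 1 / h
   holomorphic, so that f and g can be exchanged. The boundary limit 1 comes from two quantities
   attached to a Blaschke product b, namely z b' conj(b) and (1 - |b|^2) / (1 - |z|^2): both are
   built up factor by factor, they differ by O(1 - |z|^2), and the second stays bounded below.

   On the analytic side the only integrals are those of continuous real functions, and they enter
   through primitives. The real mean value theorem then extracts single values from them, which
   yields an inequality at the centre of a disc instead of Cauchy's formula. Precomposition with
   disc automorphisms turns it into the maximum principle, and the remaining facts (holomorphy of
   f', finite order of zeros, the factorization of proper maps) are obtained from bounds given by
   that principle. *)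
Require Import Defs.
From mathcomp Require Import all_boot all_order all_algebra complex.
From mathcomp Require Import all_classical all_reals all_analysis.
From mathcomp Require Import ring lra.
Set Implicit Arguments. Unset Strict Implicit. Unset Printing Implicit Defensive.
Import Order.TTheory GRing.Theory Num.Theory.
Import numFieldNormedType.Exports.
Local Open Scope classical_set_scope.
Local Open Scope ring_scope.

(** * The modulus and complex derivatives in epsilon-delta form *)

Section Modulus.
Variable R : realType.
Local Notation C := (Cplx R).
Implicit Types (z w a d c : C) (x y : R) (f g : C -> C) (n : nat).

(* [`|z|] is an element of C, whose order is partial; [cabs z] is the same
   modulus as an element of R. *)
Definition cabs z : R := ComplexField.Normc.normc z.
Definition rc x : C := (x%:C)%C.

Lemma cabsE z : `|z| = rc (cabs z).
Proof. by []. Qed.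

Lemma rc_inj : injective rc. Proof. exact: complexI. Qed.
Lemma rcD x y : rc (x + y) = rc x + rc y. Proof. exact: rmorphD. Qed.
Lemma rcM x y : rc (x * y) = rc x * rc y. Proof. exact: rmorphM. Qed.
Lemma rcN x : rc (- x) = - rc x. Proof. exact: rmorphN. Qed.
Lemma rc0 : rc 0 = 0. Proof. by []. Qed.
Lemma rc1 : rc 1 = 1. Proof. by []. Qed.
Lemma rcV x : rc x^-1 = (rc x)^-1. Proof. exact: fmorphV. Qed.
Lemma rcX x n : rc (x ^+ n) = rc x ^+ n. Proof. exact: rmorphXn. Qed.
Lemma rc_le x y : (rc x <= rc y) = (x <= y). Proof. exact: lecR. Qed.
Lemma rc_lt x y : (rc x < rc y) = (x < y). Proof. exact: ltcR. Qed.
Lemma rc_eq0 x : (rc x == 0) = (x == 0).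
Proof. by rewrite -rc0 (inj_eq rc_inj). Qed.

Lemma cabs_ge0 z : 0 <= cabs z.
Proof. by rewrite -rc_le -cabsE normr_ge0. Qed.
Lemma cabs0 : cabs 0 = 0. Proof. exact: ComplexField.Normc.normc0. Qed.
Lemma cabs1 : cabs 1 = 1. Proof. exact: ComplexField.Normc.normc1. Qed.
Lemma cabs_eq0 z : (cabs z == 0) = (z == 0).
Proof. by rewrite -rc_eq0 -cabsE normr_eq0. Qed.
Lemma cabs_gt0 z : (0 < cabs z) = (z != 0).
Proof. by rewrite -rc_lt -cabsE normr_gt0. Qed.
Lemma cabsM z w : cabs (z * w) = cabs z * cabs w.
Proof. exact: ComplexField.Normc.normcM. Qed.
Lemma cabsV z : cabs z^-1 = (cabs z)^-1.
Proof. exact: ComplexField.Normc.normcV. Qed.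
Lemma cabs_div z w : cabs (z / w) = cabs z / cabs w.
Proof. by rewrite cabsM cabsV. Qed.
Lemma cabsN z : cabs (- z) = cabs z.
Proof. by apply: rc_inj; rewrite -!cabsE normrN. Qed.
Lemma cabsX z n : cabs (z ^+ n) = cabs z ^+ n.
Proof. by apply: rc_inj; rewrite rcX -!cabsE normrX. Qed.
Lemma cabsD z w : cabs (z + w) <= cabs z + cabs w.
Proof. by rewrite -rc_le rcD -!cabsE ler_normD. Qed.
Lemma cabsB z w : cabs (z - w) <= cabs z + cabs w.
Proof. by rewrite -(cabsN w) cabsD. Qed.
Lemma cabsC z w : cabs (z - w) = cabs (w - z).
Proof. by rewrite -cabsN opprB. Qed.
Lemma cabs_tri u z w : cabs (z - w) <= cabs (z - u) + cabs (u - w).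
Proof. by rewrite -[z - w](subrKA u) cabsD. Qed.
Lemma cabs_sub z w : cabs z - cabs w <= cabs (z - w).
Proof. by have := cabsD (z - w) w; rewrite subrK; lra. Qed.
Lemma cabs_rc x : cabs (rc x) = `|x|.
Proof.
by rewrite /cabs /rc /= expr0n addr0 sqrtr_sqr.
Qed.

Definition cRe z : R := complex.Re z.
Definition cIm z : R := complex.Im z.
Lemma cReD z w : cRe (z + w) = cRe z + cRe w. Proof. by case: z w => ? ? []. Qed.
Lemma cReN z : cRe (- z) = - cRe z. Proof. by case: z. Qed.
Lemma cReB z w : cRe (z - w) = cRe z - cRe w. Proof. by rewrite cReD cReN. Qed.
Lemma cImD z w : cIm (z + w) = cIm z + cIm w. Proof. by case: z w => ? ? []. Qed.
Lemma cImN z : cIm (- z) = - cIm z. Proof. by case: z. Qed.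
Lemma cImB z w : cIm (z - w) = cIm z - cIm w. Proof. by rewrite cImD cImN. Qed.
Lemma cReM z w : cRe (z * w) = cRe z * cRe w - cIm z * cIm w.
Proof. by case: z w => ? ? []. Qed.
Lemma cImM z w : cIm (z * w) = cRe z * cIm w + cIm z * cRe w.
Proof. by case: z w => a b [c d]; rewrite /cIm /cRe /=; ring. Qed.
Lemma cRe_rc x : cRe (rc x) = x. Proof. by []. Qed.
Lemma cIm_rc x : cIm (rc x) = 0. Proof. by []. Qed.

Lemma cabs_sqr z : cabs z ^+ 2 = cRe z ^+ 2 + cIm z ^+ 2.
Proof.
case: z => a b; rewrite /cabs /= sqr_sqrtr //.
by rewrite addr_ge0 ?sqr_ge0.
Qed.

Lemma cRe_le z : `|cRe z| <= cabs z.
Proof.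
rewrite -(ler_pXn2r (n := 2)) ?nnegrE ?cabs_ge0 // cabs_sqr.
by rewrite real_normK ?num_real // lerDl sqr_ge0.
Qed.
Lemma cIm_le z : `|cIm z| <= cabs z.
Proof.
rewrite -(ler_pXn2r (n := 2)) ?nnegrE ?cabs_ge0 // cabs_sqr.
by rewrite real_normK ?num_real // lerDr sqr_ge0.
Qed.
Lemma cabs_ReIm z : cabs z <= `|cRe z| + `|cIm z|.
Proof.
rewrite -(ler_pXn2r (n := 2)) ?nnegrE ?cabs_ge0 ?addr_ge0 // cabs_sqr.
rewrite -[X in X + _]real_normK ?num_real // -[X in _ + X]real_normK ?num_real //.
by rewrite sqrrD addrAC lerDl mulrn_wge0 // mulr_ge0.
Qed.

Definition cconj z : C := (z^*)%C.
Lemma cconjD z w : cconj (z + w) = cconj z + cconj w. Proof. exact: rmorphD. Qed.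
Lemma cconjM z w : cconj (z * w) = cconj z * cconj w. Proof. exact: rmorphM. Qed.
Lemma cconjN z : cconj (- z) = - cconj z. Proof. exact: rmorphN. Qed.
Lemma cconjV z : cconj z^-1 = (cconj z)^-1. Proof. exact: fmorphV. Qed.
Lemma cconj1 : cconj 1 = 1. Proof. exact: rmorph1. Qed.
Lemma cconjK z : cconj (cconj z) = z. Proof. exact: conjcK. Qed.
Lemma cabs_conj z : cabs (cconj z) = cabs z.
Proof. by case: z => a b; rewrite /cabs /= sqrrN. Qed.
Lemma mul_cconj z : z * cconj z = rc (cabs z ^+ 2).
Proof. by rewrite rcX -cabsE; exact/esym/sqr_normc. Qed.

Lemma nearCP c (P : C -> Prop) :
  (\forall z \near c, P z) <-> exists2 e : R, 0 < e & forall z, cabs (z - c) < e -> P z.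
Proof.
split.
  move=> /nbhs_ballP[e /= e0 H].
  (* A positive element of C is real, so the radius descends to R. *)
  have ere : e = rc (cRe e) by apply/esym/RRe_real/gtr0_real.
  exists (cRe e); first by rewrite -rc_lt -ere.
  move=> z zc; apply: H.
  by rewrite /ball /= distrC cabsE ere rc_lt.
move=> [e e0 H]; apply/nbhs_ballP; exists (rc e) => /=; first by rewrite rc_lt.
move=> z; rewrite /ball /= distrC cabsE rc_lt => zc; exact: H.
Qed.

(** Clearing the denominator of the difference quotient removes the puncture at [a]: the estimate is
    trivial for [z = a]. *)
Definition cderiv f a d : Prop :=
  forall e : R, 0 < e -> exists2 t : R, 0 < t &
    forall z, cabs (z - a) < t -> cabs (f z - f a - d * (z - a)) <= e * cabs (z - a).

Definition ccont f a : Prop :=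
  forall e : R, 0 < e -> exists2 t : R, 0 < t &
    forall z, cabs (z - a) < t -> cabs (f z - f a) < e.

Lemma cderivP f a d : is_derive a 1 f d <-> cderiv f a d.
Proof.
have key : (h^-1 *: ((f \o shift a) (h *: (1 : C)) - f a) @[h --> 0^'] --> d) <->
    cderiv f a d.
  rewrite cvgrPdist_le; split.
    move=> H e e0.
    have /H : (0 : C) < rc e by rewrite rc_lt.
    rewrite /dnbhs /within => /nearCP [t t0 Ht]; exists t => // z zt.
    have [->|za] := eqVneq z a.
      by rewrite !subrr mulr0 subrr cabs0 mulr0.
    have za0 : z - a != 0 by rewrite subr_eq0.
    have := Ht (z - a); rewrite subr0 => /(_ zt za0) /=.
    rewrite [(_ - _) *: _]mulr1 subrK cabsE rc_le => {}Ht.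
    have -> : f z - f a - d * (z - a) = - ((d - (z - a)^-1 * (f z - f a)) * (z - a)).
      by field.
    rewrite cabsN cabsM; apply: ler_wpM2r => //; exact: cabs_ge0.
  move=> H e e0.
  have ere : e = rc (cRe e) by apply/esym/RRe_real/gtr0_real.
  have e0' : 0 < cRe e by rewrite -rc_lt -ere.
  rewrite ere.
  have [t t0 Ht] := H _ e0'.
  rewrite /dnbhs /within; apply/nearCP; exists t => // z; rewrite subr0 => zt z0 /=.
  rewrite [_ *: 1]mulr1 cabsE rc_le.
  have := Ht (z + a); rewrite addrK => /(_ zt) {}Ht.
  have cz : 0 < cabs z by rewrite cabs_gt0.
  rewrite -(ler_pM2r cz) -cabsM -cabsN.
  by rewrite (_ : - _ = f (z + a) - f a - d * z) // /GRing.scale /=; field.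
split.
  by move=> [fd fE]; apply/key; rewrite -fE; exact: fd.
move=> /key H; split; first by apply/cvg_ex; exists d; exact: H.
exact/cvg_lim.
Qed.

Lemma derivable_cderiv f a : derivable f a 1 <-> exists d, cderiv f a d.
Proof.
split; first by move=> /derivableP/cderivP H; exists ('D_1 f a).
by move=> [d /cderivP []].
Qed.

Lemma cderiv_val f a d : cderiv f a d -> 'D_1 f a = d.
Proof. by move=> /cderivP H; rewrite derive_val. Qed.

Lemma cderiv_unique f a d d' : cderiv f a d -> cderiv f a d' -> d = d'.
Proof. by move=> /cderiv_val <- /cderiv_val. Qed.

Lemma cderiv_near f g a d (e : R) : 0 < e ->
  (forall z, cabs (z - a) < e -> f z = g z) -> cderiv f a d -> cderiv g a d.
Proof.
move=> e0 fg H e1 /H[t t0 Ht].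
exists (Num.min t e); first by rewrite lt_min t0 e0.
move=> z; rewrite lt_min => /andP[zt ze].
rewrite -!fg //; first exact: Ht.
by rewrite subrr cabs0.
Qed.

Lemma cderiv_ext f g a d : f =1 g -> cderiv f a d -> cderiv g a d.
Proof. by move=> /funext ->. Qed.

Lemma cderiv_eq f a d d' : cderiv f a d -> d = d' -> cderiv f a d'.
Proof. by move=> H <-. Qed.

Lemma cderiv_cst c a : cderiv (fun=> c) a 0.
Proof.
by move=> e e0; exists 1 => // z _; rewrite mul0r !subrr cabs0 mulr_ge0 ?cabs_ge0 ?ltW.
Qed.
Lemma cderiv_id a : cderiv id a 1.
Proof.
by move=> e e0; exists 1 => // z _; rewrite mul1r !subrr cabs0 mulr_ge0 ?cabs_ge0 ?ltW.
Qed.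
Lemma cderivD f g a d d' : cderiv f a d -> cderiv g a d' ->
  cderiv (fun z => f z + g z) a (d + d').
Proof. by move=> /cderivP ? /cderivP ?; apply/cderivP; exact: is_deriveD. Qed.
Lemma cderivN f a d : cderiv f a d -> cderiv (fun z => - f z) a (- d).
Proof. by move=> /cderivP ?; apply/cderivP; exact: is_deriveN. Qed.
Lemma cderivB f g a d d' : cderiv f a d -> cderiv g a d' ->
  cderiv (fun z => f z - g z) a (d - d').
Proof. by move=> H /cderivN; exact: cderivD. Qed.
Lemma cderivM f g a d d' : cderiv f a d -> cderiv g a d' ->
  cderiv (fun z => f z * g z) a (d * g a + f a * d').
Proof.
move=> /cderivP Hf /cderivP Hg; apply/cderivP.
apply: (is_derive_eq (is_deriveM Hf Hg)).
by rewrite /GRing.scale /=; ring.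
Qed.
Lemma cderivZ c f a d : cderiv f a d -> cderiv (fun z => c * f z) a (c * d).
Proof.
move=> H; apply: (cderiv_eq (cderivM (cderiv_cst c a) H)); ring.
Qed.
Lemma cderivV f a d : f a != 0 -> cderiv f a d ->
  cderiv (fun z => (f z)^-1) a (- d / f a ^+ 2).
Proof.
move=> fa0 /cderivP [fd fE]; apply/cderivP.
split; first exact: derivableV.
by rewrite deriveV // fE /GRing.scale /=; field.
Qed.
Lemma cderiv_div f g a d d' : g a != 0 -> cderiv f a d -> cderiv g a d' ->
  cderiv (fun z => f z / g z) a ((d * g a - f a * d') / g a ^+ 2).
Proof.
move=> ga0 Hf Hg.
apply: (cderiv_eq (cderivM Hf (cderivV ga0 Hg))).
by field.
Qed.
Lemma cderivX f a d n : cderiv f a d ->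
  cderiv (fun z => f z ^+ n) a (n%:R * f a ^+ n.-1 * d).
Proof.
move=> H; elim: n => [|n IH].
  by apply: (cderiv_eq (cderiv_cst 1 a)); rewrite !mul0r.
have := cderivM H IH.
move=> /(cderiv_ext (g := fun z => f z ^+ n.+1)) K.
apply: (cderiv_eq (K _)) => [z|]; first by rewrite exprS.
by case: n {IH K} => [|n] /=; rewrite ?expr0 ?exprS -?natr1; ring.
Qed.

Lemma cderiv_cont f a d : cderiv f a d -> ccont f a.
Proof.
move=> H e e0; have [t t0 Ht] := H 1 ltr01.
have p0 : 0 < 1 + cabs d by have := cabs_ge0 d; lra.
exists (Num.min t (e / (1 + cabs d))); first by rewrite lt_min t0 divr_gt0.
move=> z; rewrite lt_min ltr_pdivlMr // => /andP[/Ht zt ze].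
have := cabsD (f z - f a - d * (z - a)) (d * (z - a)).
by rewrite subrK cabsM; lra.
Qed.

Lemma cderiv_comp f g a d d' : cderiv f a d -> cderiv g (f a) d' ->
  cderiv (fun z => g (f z)) a (d' * d).
Proof.
move=> Hf Hg e e0.
(* The error is that of [g] at [f z] plus [d'] times that of [f], and each gets half of [e]. Near
   [a], |f z - f a| <= (1 + |d|) |z - a|; the 1 added to |d'| keeps the second denominator
   positive. *)
have p0 : 0 < 2 * (1 + cabs d) by have := cabs_ge0 d; lra.
have q0 : 0 < 2 * (1 + cabs d') by have := cabs_ge0 d'; lra.
have [tg tg0 Htg] := Hg _ (divr_gt0 e0 p0).
have [tc tc0 Htc] := cderiv_cont Hf tg0.
have [t1 t10 Ht1] := Hf 1 ltr01.
have [t2 t20 Ht2] := Hf _ (divr_gt0 e0 q0).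
exists (Num.min tc (Num.min t1 t2)); first by rewrite !lt_min tc0 t10 t20.
move=> z; rewrite !lt_min => /and3P[/Htc/Htg + /Ht1 + /Ht2].
have := cabsD (g (f z) - g (f a) - d' * (f z - f a)) (d' * (f z - f a - d * (z - a))).
rewrite (_ : _ + _ = g (f z) - g (f a) - d' * d * (z - a)); last by ring.
rewrite cabsM.
have := cabsD (f z - f a - d * (z - a)) (d * (z - a)); rewrite subrK cabsM.
have := cabs_ge0 (f z - f a - d * (z - a)).
have := cabs_ge0 (z - a); have := cabs_ge0 d; have := cabs_ge0 d'.
have := cabs_ge0 (f z - f a).
set A := cabs (f z - f a); set B := cabs (f z - f a - _).
set G := cabs (g _ - _ - _); set H := cabs (g _ - _ - _); set Z := cabs (z - a).
set D := cabs d; set D' := cabs d'.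
move=> A0 D'0 D0 Z0 B0 AB HG GA B1 B2.
apply: (le_trans HG).
have E1 : A <= (1 + D) * Z by lra.
have E2 : e / (2 * (1 + D)) * A <= e / 2 * Z.
  have -> : e / 2 * Z = e / (2 * (1 + D)) * ((1 + D) * Z).
    by field; apply/eqP => ?; lra.
  by apply: ler_wpM2l => //; rewrite divr_ge0 ?ltW.
have E3 : D' * B <= e / 2 * Z.
  apply: (@le_trans _ _ (D' * (e / (2 * (1 + D')) * Z))); first exact: ler_wpM2l.
  rewrite mulrA; apply: ler_wpM2r => //.
  rewrite mulrCA; apply: (@le_trans _ _ (e * (1 / 2))); last by lra.
  apply: ler_wpM2l; first exact: ltW.
  by rewrite ler_pdivrMr //; lra.
lra.
Qed.

Lemma ccontD f g a : ccont f a -> ccont g a -> ccont (fun z => f z + g z) a.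
Proof.
move=> Hf Hg e e0; have e2 : 0 < e / 2 by lra.
have [t1 t10 H1] := Hf _ e2; have [t2 t20 H2] := Hg _ e2.
exists (Num.min t1 t2); first by rewrite lt_min t10 t20.
move=> z; rewrite lt_min => /andP[/H1 + /H2].
have := cabsD (f z - f a) (g z - g a).
rewrite (_ : _ + _ = f z + g z - (f a + g a)); last by ring.
by lra.
Qed.

Lemma ccont_cst c a : ccont (fun=> c) a.
Proof. exact: cderiv_cont (cderiv_cst c a). Qed.
Lemma ccont_id a : ccont id a.
Proof. exact: cderiv_cont (cderiv_id a). Qed.

Lemma ccont_comp f g a : ccont f a -> ccont g (f a) -> ccont (fun z => g (f z)) a.
Proof.
move=> Hf Hg e /Hg[t /Hf[s s0 Hs] Ht]; exists s => // z /Hs; exact: Ht.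
Qed.

Lemma ccontM f g a : ccont f a -> ccont g a -> ccont (fun z => f z * g z) a.
Proof.
move=> Hf Hg e e0.
have p0 : 0 < 2 * (1 + cabs (g a)) by have := cabs_ge0 (g a); lra.
have q0 : 0 < 2 * (1 + cabs (f a)) by have := cabs_ge0 (f a); lra.
have [t1 t10 H1] := Hf _ (divr_gt0 e0 p0).
have [t2 t20 H2] := Hg _ (divr_gt0 e0 q0).
have [t3 t30 H3] := Hg _ ltr01.
exists (Num.min t1 (Num.min t2 t3)); first by rewrite !lt_min t10 t20 t30.
move=> z; rewrite !lt_min => /and3P[/H1 + /H2 + /H3].
have := cabsD ((f z - f a) * g z) (f a * (g z - g a)).
rewrite (_ : _ + _ = f z * g z - f a * g a); last by ring.
rewrite !cabsM.
have := cabsD (g z - g a) (g a); rewrite subrK.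
have := cabs_ge0 (f z - f a); have := cabs_ge0 (g z - g a).
have := cabs_ge0 (f a); have := cabs_ge0 (g a); have := cabs_ge0 (g z).
set F := cabs (f a); set G := cabs (g a); set A := cabs (f z - _); set B := cabs (g z - _).
set Gz := cabs (g z); set T := cabs _.
move=> gz0 g0 f0 b0 a0 h1 h2.
rewrite !ltr_pdivlMr // => h3 h4 h5.
have : A * Gz <= A * (1 + G) by apply: ler_wpM2l => //; lra.
have : F * B <= B * (1 + F) by lra.
by lra.
Qed.

Lemma ccontN f a : ccont f a -> ccont (fun z => - f z) a.
Proof.
by move=> H e /H[t t0 Ht]; exists t => // z /Ht; rewrite -opprD cabsN.
Qed.
Lemma ccontB f g a : ccont f a -> ccont g a -> ccont (fun z => f z - g z) a.
Proof. by move=> H /ccontN; exact: ccontD. Qed.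
Lemma ccontX f a n : ccont f a -> ccont (fun z => f z ^+ n) a.
Proof.
move=> H; elim: n => [|n IH]; first exact: ccont_cst.
have -> : (fun z => f z ^+ n.+1) = (fun z => f z * f z ^+ n).
  by apply/funext => z; rewrite exprS.
exact: ccontM.
Qed.
Lemma ccontV f a : f a != 0 -> ccont f a -> ccont (fun z => (f z)^-1) a.
Proof.
move=> fa0 H; apply: ccont_comp H _.
exact: cderiv_cont (cderivV fa0 (cderiv_id _)).
Qed.
Lemma ccont_near f g a (e : R) : 0 < e ->
  (forall z, cabs (z - a) < e -> f z = g z) -> ccont f a -> ccont g a.
Proof.
move=> e0 fg H e1 /H[t t0 Ht].
exists (Num.min t e); first by rewrite lt_min t0 e0.
move=> z; rewrite lt_min => /andP[zt ze].
rewrite -!fg //; first exact: Ht.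
by rewrite subrr cabs0.
Qed.

Lemma ccont_neq0 f a : ccont f a -> f a != 0 ->
  exists2 t : R, 0 < t & forall z, cabs (z - a) < t -> f z != 0.
Proof.
move=> H; rewrite -cabs_gt0 => /H[t t0 Ht]; exists t => // z /Ht.
by apply: contraTneq => ->; rewrite sub0r cabsN -leNgt.
Qed.

End Modulus.
(** * Goursat's theorem for closed forms on rectangles *)

Section Goursat.
Variable R : realType.
Implicit Types (a b c d x y e : R).

(** The derivative is obtained only inside the interval, so a primitive on a closed interval is
    taken from a strictly larger one. *)
Lemma primitive_exists (g : R -> R) a b : a < b ->
  (forall x, a <= x <= b -> {for x, continuous g}) ->
  exists G : R -> R, forall x, a < x < b -> is_derive x 1 G (g x).
Proof.
move=> ab cg.
have gi : (@lebesgue_measure R).-integrable `[a, b] (EFin \o g).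
  apply: continuous_compact_integrable; first exact: segment_compact.
  apply: continuous_in_subspaceT => x; rewrite inE /= in_itv /=.
  exact: cg.
exists (fun x => (\int[@lebesgue_measure R]_(t in [set` `[a, x]]) g t)%R) => x /andP[ax xb].
have gx : {for x, continuous g} by apply: cg; rewrite !ltW.
have [dG EG] := continuous_FTC1_closed xb gi ax gx.
apply: DeriveDef; first exact: dG.
by rewrite -derive1E; exact: EG.
Qed.

Lemma derive_mvt (F g : R -> R) a b : a <= b ->
  (forall x, a <= x <= b -> is_derive x 1 F (g x)) ->
  exists2 x, a <= x <= b & F b - F a = g x * (b - a).
Proof.
move=> ab dF.
have [||x xab E] := @MVT_segment R F g a b ab.
- by move=> x; rewrite in_itv /= => /andP[ax xb]; apply: dF; rewrite !ltW.
- apply: derivable_within_continuous => x; rewrite in_itv /= => xab.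
  by have [] := dF x xab.
by exists x => //; rewrite in_itv /= in xab.
Qed.

Lemma derive_increment (F g : R -> R) a b (k e : R) : a <= b ->
  (forall x, a <= x <= b -> is_derive x 1 F (g x)) ->
  (forall x, a <= x <= b -> `|g x - k| <= e) ->
  `|F b - F a - k * (b - a)| <= e * (b - a).
Proof.
move=> ab dF gk; have [x xab ->] := derive_mvt ab dF.
rewrite -mulrBl normrM [X in _ * X]ger0_norm ?subr_ge0 // ler_wpM2r ?subr_ge0 //.
exact: gk.
Qed.

Lemma nested_intervals (a b : nat -> R) :
  (forall n, a n <= a n.+1) -> (forall n, b n.+1 <= b n) ->
  (forall n, a n <= b n) -> exists x, forall n, a n <= x <= b n.
Proof.
move=> ia ib ab.
have ha : {homo a : m n / (m <= n)%N >-> m <= n} by apply/nondecreasing_seqP.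
have hb : {homo b : m n / (m <= n)%N >-> n <= m} by apply/nonincreasing_seqP.
have amb m n : a m <= b n.
  have [mn|/ltnW nm] := leqP m n.
    exact: le_trans (ha _ _ mn) (ab n).
  exact: le_trans (ab m) (hb _ _ nm).
have hs : has_sup (range a).
  by split; [exists (a 0%N), 0%N | exists (b 0%N) => _ [m _ <-]].
exists (sup (range a)) => n; apply/andP; split.
  by apply: sup_upper_bound => //; exists n.
by apply: ge_sup => [|_ [m _ <-]//]; exists (a 0%N), 0%N.
Qed.

Lemma exp2_large x : exists n : nat, x < 2 ^+ n.
Proof.
have [n xn] : exists n : nat, x < n%:R.
  exists (Num.bound `|x|).
  exact: le_lt_trans (ler_norm x) (archi_boundP (normr_ge0 x)).
exists n; apply: (lt_trans xn).
by rewrite -natrX ltr_nat ltn_expl.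
Qed.

Variables P Q FP FQ : R -> R -> R.

(* The integral of P dx + Q dy along the boundary of [a, b] x [c, d], written
   with primitives FP of P in x and FQ of Q in y. *)
Definition boundary_form a b c d : R :=
  FP b c - FP a c - (FP b d - FP a d) + (FQ b d - FQ b c) - (FQ a d - FQ a c).

Variables a b c d : R.
Hypotheses (ab : a <= b) (cd : c <= d).
Hypothesis dP : forall x y, a <= x <= b -> c <= y <= d ->
  is_derive x 1 (FP^~ y) (P x y).
Hypothesis dQ : forall x y, a <= x <= b -> c <= y <= d ->
  is_derive y 1 (FQ x) (Q x y).
(** Differentiability of P and Q at each point, where [k] is the common value of dP/dy and dQ/dx:
    the form is closed, with no continuity of partial derivatives. *)
Hypothesis closed_form : forall x0 y0, a <= x0 <= b -> c <= y0 <= d ->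
  exists p k q, forall e, 0 < e -> exists2 t, 0 < t &
    forall x y, a <= x <= b -> c <= y <= d -> `|x - x0| < t -> `|y - y0| < t ->
    `|P x y - P x0 y0 - p * (x - x0) - k * (y - y0)| <= e * (`|x - x0| + `|y - y0|) /\
    `|Q x y - Q x0 y0 - k * (x - x0) - q * (y - y0)| <= e * (`|x - x0| + `|y - y0|).

(** The affine parts of P and Q contribute [k] times the area with opposite signs; only the errors,
    integrated along the sides, remain. *)
Lemma boundary_form_small x0 y0 e : 0 < e -> a <= x0 <= b -> c <= y0 <= d ->
  exists2 t, 0 < t & forall a' b' c' d',
    a <= a' -> a' <= x0 <= b' -> b' <= b -> c <= c' -> c' <= y0 <= d' -> d' <= d ->
    b' - a' < t -> d' - c' < t ->
    `|boundary_form a' b' c' d'| <= e * ((b' - a') + (d' - c')) ^+ 2.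
Proof.
move=> e0 x0ab y0cd.
have [p [k [q /(_ (e / 2))]]] := closed_form x0ab y0cd.
rewrite divr_gt0 // => /(_ isT)[t t0 Ht]; exists t => // a' b' c' d'.
move=> aa' /andP[ax xb] b'b cc' /andP[cy yd] d'd wt ht.
set w := b' - a'; set h := d' - c'.
have bnd x y : a' <= x <= b' -> c' <= y <= d' ->
   `|P x y - P x0 y0 - p * (x - x0) - k * (y - y0)| <= e / 2 * (w + h) /\
   `|Q x y - Q x0 y0 - k * (x - x0) - q * (y - y0)| <= e / 2 * (w + h).
  move=> /andP[ax' xb'] /andP[cy' yd'].
  have n1 : `|x - x0| <= w by rewrite /w ler_norml; apply/andP; split; lra.
  have n2 : `|y - y0| <= h by rewrite /h ler_norml; apply/andP; split; lra.
  have [||||H1 H2] := Ht x y; first by apply/andP; split; lra.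
  - by apply/andP; split; lra.
  - exact: le_lt_trans n1 wt.
  - exact: le_lt_trans n2 ht.
  have e2 : e / 2 * (`|x - x0| + `|y - y0|) <= e / 2 * (w + h).
    by apply: ler_wpM2l; [lra | exact: lerD].
  by split; [exact: le_trans H1 e2 | exact: le_trans H2 e2].
have w0 : a' <= b' by lra.
have h0 : c' <= d' by lra.
have c'in : c' <= c' <= d' by rewrite lexx.
have d'in : c' <= d' <= d' by rewrite lexx andbT.
have a'in : a' <= a' <= b' by rewrite lexx.
have b'in : a' <= b' <= b' by rewrite lexx andbT.
have sub2 (r1 r2 s : R) : `|r1| <= e / 2 * s -> `|r2| <= e / 2 * s -> `|r1 - r2| <= e * s.
  by move=> h1 h2; apply: le_trans (ler_normB _ _) _; lra.
have c'cd : c <= c' <= d by rewrite cc' (le_trans h0 d'd).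
have d'cd : c <= d' <= d by rewrite d'd (le_trans cc' h0).
have a'ab : a <= a' <= b by rewrite aa' (le_trans w0 b'b).
have b'ab : a <= b' <= b by rewrite b'b (le_trans aa' w0).
have dE1 x : a' <= x <= b' -> is_derive x 1 (fun x => FP x c' - FP x d') (P x c' - P x d').
  move=> /andP[xa' xb']; have xab : a <= x <= b by rewrite (le_trans aa' xa') (le_trans xb' b'b).
  exact: (is_deriveB (dP xab c'cd) (dP xab d'cd)).
have bE1 x : a' <= x <= b' -> `|P x c' - P x d' - k * (c' - d')| <= e * (w + h).
  move=> xab; have [H1 _] := bnd _ _ xab c'in; have [H2 _] := bnd _ _ xab d'in.
  have := sub2 _ _ _ H1 H2.
  by congr (`| _ | <= _); ring.
have dE2 y : c' <= y <= d' -> is_derive y 1 (fun y => FQ b' y - FQ a' y) (Q b' y - Q a' y).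
  move=> /andP[yc' yd']; have ycd : c <= y <= d by rewrite (le_trans cc' yc') (le_trans yd' d'd).
  exact: (is_deriveB (dQ b'ab ycd) (dQ a'ab ycd)).
have bE2 y : c' <= y <= d' -> `|Q b' y - Q a' y - k * (b' - a')| <= e * (w + h).
  move=> ycd; have [_ H1] := bnd _ _ b'in ycd; have [_ H2] := bnd _ _ a'in ycd.
  have := sub2 _ _ _ H1 H2.
  by congr (`| _ | <= _); ring.
have H1 := derive_increment w0 dE1 bE1; have H2 := derive_increment h0 dE2 bE2.
move: H2 H1; rewrite -/w -/h => H2 H1.
have := le_trans (ler_normD _ _) (lerD H1 H2).
have -> : e * (w + h) * w + e * (w + h) * h = e * (w + h) ^+ 2 by ring.
by congr (`| _ | <= _); rewrite /boundary_form /w /h; ring.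
Qed.

Lemma boundary_form_split a' b' c' d' x y :
  boundary_form a' b' c' d' = boundary_form a' x c' y + boundary_form x b' c' y
    + (boundary_form a' x y d' + boundary_form x b' y d').
Proof. by rewrite /boundary_form; ring. Qed.

Lemma goursat : boundary_form a b c d = 0.
Proof.
apply/eqP; apply/negPn/negP => Phi0.
have N0 : 0 < `|boundary_form a b c d| by rewrite normr_gt0.
set L := (b - a) + (d - c).
have L0 : 0 <= L by rewrite /L addr_ge0 // subr_ge0.
(* With this [e] the whole rectangle is bad. The 1 added to [L] keeps the denominator positive for a
   degenerate rectangle, and the factor 2 makes the inequality strict. *)
pose e := `|boundary_form a b c d| / (2 * (1 + L) ^+ 2).
have L2 : 0 < 2 * (1 + L) ^+ 2 by rewrite mulr_gt0 // exprn_gt0 //; lra.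
have e0 : 0 < e by rewrite divr_gt0.
pose T := (R * R * R * R)%type.
pose bad (t : T) := let: (a', b', c', d') := t in
  [/\ a <= a', a' <= b', b' <= b & [/\ c <= c', c' <= d', d' <= d &
   e * ((b' - a') + (d' - c')) ^+ 2 < `|boundary_form a' b' c' d'|]].
pose nxt (t t' : T) := let: (a', b', c', d') := t in let: (a1, b1, c1, d1) := t' in
  [/\ a' <= a1, b1 <= b', b1 - a1 = (b' - a') / 2 &
   [/\ c' <= c1, d1 <= d' & d1 - c1 = (d' - c') / 2]].
have step t : exists t', bad t -> bad t' /\ nxt t t'.
  have [|nb] := pselect (bad t); last by exists t.
  move: t => [[[a' b'] c'] d'] /= [aa' a'b' b'b [cc' c'd' d'd big]].
  pose x := (a' + b') / 2; pose y := (c' + d') / 2.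
  pose s := b' - a' + (d' - c').
  (* Each quarter has width plus height [s / 2]. Since 4 (s / 2)^2 = s^2, the bound on all four
     quarters would give the bound on the rectangle, so one quarter is bad. *)
  have [B1|G1] := ltP (e * (s / 2) ^+ 2) `|boundary_form a' x c' y|.
    exists (a', x, c', y) => _; split.
      split; try (rewrite /x; lra); split; try (rewrite /y; lra).
      by apply: le_lt_trans B1; rewrite (_ : s / 2 = x - a' + (y - c')) // /s /x /y; field.
    by split; rewrite /x /y; try lra; split; lra.
  have [B2|G2] := ltP (e * (s / 2) ^+ 2) `|boundary_form x b' c' y|.
    exists (x, b', c', y) => _; split.
      split; try (rewrite /x; lra); split; try (rewrite /y; lra).
      by apply: le_lt_trans B2; rewrite (_ : s / 2 = b' - x + (y - c')) // /s /x /y; field.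
    by split; rewrite /x /y; try lra; split; lra.
  have [B3|G3] := ltP (e * (s / 2) ^+ 2) `|boundary_form a' x y d'|.
    exists (a', x, y, d') => _; split.
      split; try (rewrite /x; lra); split; try (rewrite /y; lra).
      by apply: le_lt_trans B3; rewrite (_ : s / 2 = x - a' + (d' - y)) // /s /x /y; field.
    by split; rewrite /x /y; try lra; split; lra.
  have [B4|G4] := ltP (e * (s / 2) ^+ 2) `|boundary_form x b' y d'|.
    exists (x, b', y, d') => _; split.
      split; try (rewrite /x; lra); split; try (rewrite /y; lra).
      by apply: le_lt_trans B4; rewrite (_ : s / 2 = b' - x + (d' - y)) // /s /x /y; field.
    by split; rewrite /x /y; try lra; split; lra.
  exfalso; move: big; rewrite (boundary_form_split a' b' c' d' x y) ltNge => /negP; apply.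
  apply: (le_trans (ler_normD _ _)).
  apply: (le_trans (lerD (ler_normD _ _) (ler_normD _ _))).
  have -> : (b' - a' + (d' - c')) ^+ 2 = 4 * (s / 2) ^+ 2 by rewrite /s; field.
  move: G1 G2 G3 G4; set u := (s / 2) ^+ 2 ; lra.
have [F HF] := choice step.
pose s n := iter n F (a, b, c, d).
have bad0 : bad (a, b, c, d).
  split => //; split => //; rewrite -/L /e.
  rewrite mulrAC ltr_pdivrMr // ltr_pM2l //.
  by apply: le_lt_trans (_ : (1 + L) ^+ 2 < _); [rewrite ler_sqr ?nnegrE; lra | rewrite ltr_pMl; [lra | rewrite exprn_gt0; lra]].
have bads n : bad (s n).
  by elim: n => // n IH; rewrite /s iterS; have [] := HF _ IH.
have nxts n : nxt (s n) (s n.+1) by have [] := HF _ (bads n).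
pose A n := (s n).1.1.1; pose B n := (s n).1.1.2; pose D n := (s n).1.2; pose E n := (s n).2.
have sE n : s n = (A n, B n, D n, E n) by rewrite /A /B /D /E; case: (s n) => [[[]]].
have badn n : bad (A n, B n, D n, E n) by rewrite -sE.
have nxtn n : nxt (A n, B n, D n, E n) (A n.+1, B n.+1, D n.+1, E n.+1) by rewrite -!sE.
have [x0 Hx0] : exists x, forall n, A n <= x <= B n.
  by apply: nested_intervals => n; have := nxtn n; have := badn n; move=> [? ? ? _] [].
have [y0 Hy0] : exists x, forall n, D n <= x <= E n.
  apply: nested_intervals => n; have := nxtn n; have := badn n;
    by move=> [_ _ _ [? ? ? _]] [_ _ _ []].
have wid n : B n - A n = (b - a) / 2 ^+ n /\ E n - D n = (d - c) / 2 ^+ n.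
  elim: n => [|n [IH1 IH2]]; first by rewrite expr0 !divr1.
  have [_ _ W [_ _ H]] := nxtn n.
  rewrite W H IH1 IH2 exprS; split; field; exact: expf_neq0.
have [t t0 Ht] := boundary_form_small e0 (Hx0 0%N) (Hy0 0%N).
have [n Hn] := exp2_large (L / t).
have p2 : 0 < (2 : R) ^+ n by rewrite exprn_gt0.
have small v : 0 <= v -> v <= L -> v / 2 ^+ n < t.
  move=> v0 vL; rewrite ltr_pdivrMr // mulrC -ltr_pdivrMr //.
  by apply: le_lt_trans Hn; rewrite ler_pM2r // invr_gt0.
have [W H] := wid n.
have [h1 h2 h3 [h4 h5 h6 big]] := badn n.
have := Ht _ _ _ _ h1 (Hx0 n) h3 h4 (Hy0 n) h6.
rewrite leNgt big W H; move=> K.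
have : false by apply: K; apply: small; rewrite /L; lra.
by [].
Qed.

End Goursat.
(** * The mean value inequality *)

Section MeanValue.
Variable R : realType.
Local Notation C := (Cplx R).
Implicit Types (z w : C) (a b x y t e r : R) (f F : C -> C).

Lemma real_contP (g : R -> R) x :
  (forall e, 0 < e -> exists2 t, 0 < t & forall y, `|y - x| < t -> `|g y - g x| < e) ->
  {for x, continuous g}.
Proof.
move=> H; have E := @cvgrPdist_lt R R R (nbhs x) (nbhs_filter x) g (g x).
rewrite /prop_for /continuous_at E {E} => e /H[t t0 Ht].
apply/nbhs_ballP; exists t => // y; rewrite /ball /= distrC => /Ht.
by rewrite distrC.
Qed.

Lemma real_derivP (g : R -> R) x (d : R) : is_derive x 1 g d ->
  forall e, 0 < e -> exists2 t, 0 < t &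
    forall h, `|h| < t -> `|g (h + x) - g x - d * h| <= e * `|h|.
Proof.
move=> [dg <-] e e0.
move: dg; rewrite /derivable /derive; set q := (fun h : R => _).
move=> /cvgrPdist_le /(_ e e0).
rewrite /dnbhs /within => /nbhs_ballP[t /= t0 Ht]; exists t => // h ht.
have [->|h0] := eqVneq h 0; first by rewrite add0r mulr0 !subrr normr0 mulr0.
have := Ht h; rewrite /ball /= sub0r normrN => /(_ ht h0).
have -> : q h = h^-1 * (g (h + x) - g x) by rewrite /q /= /GRing.scale /= mulr1.
set l := lim _ => K.
have -> : g (h + x) - g x - l * h = - ((l - h^-1 * (g (h + x) - g x)) * h) by field.
by rewrite normrN normrM ler_wpM2r.
Qed.

Definition cart x y : C := (x +i* y)%C.

Lemma cart_sub x y x' y' : cart x y - cart x' y' = cart (x - x') (y - y').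
Proof. by []. Qed.
Lemma cabs_cart x y : cabs (cart x y) <= `|x| + `|y|.
Proof. exact: cabs_ReIm. Qed.

Definition cexp w : C := rc (expR (cRe w)) * cart (cos (cIm w)) (sin (cIm w)).

Lemma cexpD z w : cexp (z + w) = cexp z * cexp w.
Proof.
rewrite /cexp cReD cImD expRD rcM cosD sinD.
set A := rc (expR _); set B := rc (expR _).
have -> : cart (cos (cIm z) * cos (cIm w) - sin (cIm z) * sin (cIm w))
  (sin (cIm z) * cos (cIm w) + cos (cIm z) * sin (cIm w)) =
  cart (cos (cIm z)) (sin (cIm z)) * cart (cos (cIm w)) (sin (cIm w)).
  by rewrite addrC; congr Complex; rewrite addrC // [sin _ * _ + _]addrC.
by ring.
Qed.

Lemma cabs_cexp w : cabs (cexp w) = expR (cRe w).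
Proof.
rewrite /cexp cabsM cabs_rc ger0_norm ?expR_ge0 //.
have -> : cabs (cart (cos (cIm w)) (sin (cIm w))) = 1.
  apply/eqP; rewrite -(@eqrXn2 _ 2) ?cabs_ge0 // cabs_sqr /cRe /cIm /=.
  by rewrite cos2Dsin2 expr1n.
by rewrite mulr1.
Qed.

Lemma cRe_cexp w : cRe (cexp w) = expR (cRe w) * cos (cIm w).
Proof. by rewrite /cexp cReM cRe_rc cIm_rc mul0r subr0. Qed.
Lemma cIm_cexp w : cIm (cexp w) = expR (cRe w) * sin (cIm w).
Proof. by rewrite /cexp cImM cRe_rc cIm_rc mul0r addr0. Qed.

Lemma cexp_small e : 0 < e -> exists2 t, 0 < t & forall h,
  cabs h < t -> cabs (cexp h - 1 - h) <= e * cabs h.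
Proof.
(* The real part of the error is at most 3 e1 |h| and the imaginary part at most 5 e1 |h|, hence the
   8. *)
move=> e0; pose e1 := Num.min 1 (e / 8).
have e10 : 0 < e1 by rewrite /e1 lt_min ltr01 divr_gt0.
have e11 : e1 <= 1 by rewrite /e1 ge_min lexx.
have e18 : 8 * e1 <= e.
  have : e1 <= e / 8 by rewrite /e1 ge_min lexx orbT.
  by lra.
have [t1 t10 H1] := real_derivP (is_derive_expR (0 : R)) e10.
have [t2 t20 H2] := real_derivP (is_derive_cos (0 : R)) e10.
have [t3 t30 H3] := real_derivP (is_derive_sin (0 : R)) e10.
exists (Num.min (Num.min t1 t2) (Num.min t3 e1)); first by rewrite 3!lt_min t10 t20 t30 e10.
move=> h; rewrite 3!lt_min => /andP[/andP[h1 h2] /andP[h3 h4]].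
have reh := cRe_le h; have imh := cIm_le h.
have := H1 (cRe h) (le_lt_trans reh h1).
have := H2 (cIm h) (le_lt_trans imh h2).
have := H3 (cIm h) (le_lt_trans imh h3).
rewrite !addr0 expR0 cos0 sin0 !subr0 oppr0 mul0r !subr0 !mul1r.
set a := cRe h; set b := cIm h => Hs Hc He.
have a_e : `|a| <= e1 by apply: le_trans reh _; exact: ltW.
have a1 : `|a| <= 1 by apply: le_trans a_e _.
have R1 : cRe (cexp h - 1 - h) = (expR a - 1 - a) * cos b + (1 + a) * (cos b - 1).
  by rewrite !cReB cRe_cexp (cRe_rc 1) -/a -/b; ring.
have I1 : cIm (cexp h - 1 - h) = expR a * (sin b - b) + (expR a - 1) * b.
  by rewrite !cImB cIm_cexp (cIm_rc 1) -/a -/b; ring.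
have cb : `|cos b| <= 1 by rewrite ler_norml cos_geN1 cos_le1.
have ea : `|expR a - 1| <= 2 * `|a|.
  have := ler_normD (expR a - 1 - a) a; rewrite subrK.
  have : e1 * `|a| <= `|a| by rewrite ler_piMl.
  by lra.
have ea' : `|expR a| <= 3.
  have := ler_normD (expR a - 1) 1; rewrite subrK normr1; lra.
have B1 : `|cRe (cexp h - 1 - h)| <= e1 * cabs h + 2 * (e1 * cabs h).
  rewrite R1; apply: (le_trans (ler_normD _ _)); rewrite !normrM; apply: lerD.
    rewrite -[leRHS]mulr1; apply: ler_pM => //.
    by apply: le_trans He _; rewrite ler_wpM2l // ltW.
  apply: ler_pM => //.
    by apply: le_trans (ler_normD _ _) _; rewrite normr1; lra.
  by apply: le_trans Hc _; rewrite ler_wpM2l // ltW.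
have B2 : `|cIm (cexp h - 1 - h)| <= 3 * (e1 * cabs h) + 2 * (e1 * cabs h).
  rewrite I1; apply: (le_trans (ler_normD _ _)); rewrite !normrM; apply: lerD.
    by apply: ler_pM => //; apply: le_trans Hs _; rewrite ler_wpM2l // ltW.
  rewrite mulrA; apply: ler_pM => //.
  by apply: le_trans ea _; rewrite ler_pM2l.
apply: le_trans (cabs_ReIm _) _.
have := lerD B1 B2; have : 8 * e1 * cabs h <= e * cabs h.
  by apply: ler_wpM2r => //; exact: cabs_ge0.
by lra.
Qed.

Lemma cderiv_cexp w : cderiv cexp w (cexp w).
Proof.
move=> e e0.
have c0 : 0 < cabs (cexp w) by rewrite cabs_cexp expR_gt0.
have [t t0 Ht] := cexp_small (divr_gt0 e0 c0).
exists t => // z zt.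
have -> : cexp z - cexp w - cexp w * (z - w) = cexp w * (cexp (z - w) - 1 - (z - w)).
  by rewrite (_ : cexp z = cexp (z - w) * cexp w); [ring | rewrite -cexpD subrK].
rewrite cabsM; have := Ht _ zt => K.
have := ler_wpM2l (ltW c0) K.
by rewrite mulrA mulrCA divff ?mulr1 // gt_eqF.
Qed.

Lemma cont_hline F y x : ccont F (cart x y) ->
  {for x, continuous (fun x => cIm (F (cart x y)))}.
Proof.
move=> cF; apply: real_contP => e /cF[t t0 Ht]; exists t => // x' xt.
rewrite -cImB; apply: le_lt_trans (cIm_le _) _; apply: Ht.
by rewrite cart_sub subrr; apply: le_lt_trans (cabs_cart _ _) _; rewrite normr0 addr0.
Qed.

Lemma cont_vline F x y : ccont F (cart x y) ->
  {for y, continuous (fun y => cRe (F (cart x y)))}.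
Proof.
move=> cF; apply: real_contP => e /cF[t t0 Ht]; exists t => // x' xt.
rewrite -cReB; apply: le_lt_trans (cRe_le _) _; apply: Ht.
by rewrite cart_sub subrr; apply: le_lt_trans (cabs_cart _ _) _; rewrite normr0 add0r.
Qed.

(* Cauchy's theorem on the rectangle [a, b] x [0, T], whose horizontal sides
   cancel by periodicity; the mean value theorem turns the two remaining
   integrals into values of Re F. *)
Lemma periodic_vertical_means F a b T : a <= b -> b < 0 -> 0 < T ->
  (forall w, cRe w < 0 -> exists d, cderiv F w d) ->
  (forall x, F (cart x T) = F (cart x 0)) ->
  exists ya yb, cRe (F (cart a ya)) = cRe (F (cart b yb)).
Proof.
move=> ab b0 T0 hF per.
have cF x y : x < 0 -> ccont F (cart x y).
  by move=> x0; have [d /cderiv_cont] := hF (cart x y) x0.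
pose u x y := cRe (F (cart x y)); pose v x y := cIm (F (cart x y)).
(* Choice gives one operator [I] from functions to primitives, so the equal functions on the sides y
   = 0 and y = T receive the same primitive and these sides cancel exactly. *)
have prim (p q : R) : p < q -> exists I : (R -> R) -> (R -> R), forall g,
    (forall x, p <= x <= q -> {for x, continuous g}) ->
    forall x, p < x < q -> is_derive x 1 (I g) (g x).
  move=> pq; have [g|I HI] := @choice (R -> R) (R -> R) (fun g G =>
    (forall x, p <= x <= q -> {for x, continuous g}) ->
    forall x, p < x < q -> is_derive x 1 G (g x)).
    have [cg|ncg] := pselect (forall x, p <= x <= q -> {for x, continuous g}).
      by have [G HG] := primitive_exists pq cg; exists G.
    by exists g.
  by exists I.
(* The open intervals contain [a, b] and [0, T]; as b < 0, the point [b / 2] is to the right of b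
   and still in the half-plane where F is holomorphic. *)
have [|I1 H1] := prim (a - 1) (b / 2); first by lra.
have [|I2 H2] := prim (- 1) (T + 1); first by lra.
pose FP x y := I1 (fun x => v x y) x; pose FQ x y := I2 (u x) y.
have dP x y : a <= x <= b -> 0 <= y <= T -> is_derive x 1 (FP^~ y) (v x y).
  move=> /andP[ax xb] _; apply: (H1 (fun x => v x y)) => [x' /andP[_ x'b]|].
    by apply: cont_hline; apply: cF; lra.
  by apply/andP; split; lra.
have dQ x y : a <= x <= b -> 0 <= y <= T -> is_derive y 1 (FQ x) (u x y).
  move=> /andP[ax xb] /andP[y0 yT]; apply: (H2 (u x)) => [y' _|].
    by apply: cont_vline; apply: cF; lra.
  by apply/andP; split; lra.
have T0' := ltW T0.
have := goursat ab T0' dP dQ; rewrite /boundary_form.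
have -> : FP b T = FP b 0 by rewrite /FP /v; under eq_fun do rewrite per.
have -> : FP a T = FP a 0 by rewrite /FP /v; under eq_fun do rewrite per.
rewrite subrr add0r => G.
have aa : a <= a <= b by rewrite lexx.
have bb : a <= b <= b by rewrite lexx andbT.
have [ya _ Ea] := derive_mvt T0' (dQ a ^~ aa).
have [yb _ Eb] := derive_mvt T0' (dQ b ^~ bb).
exists ya, yb; rewrite -/(u a ya) -/(u b yb).
apply: (mulIf (_ : T - 0 != 0)); first by rewrite subr0 gt_eqF.
rewrite -Ea -Eb; apply/eqP; rewrite eq_sym -subr_eq0; apply/eqP; apply: G.
move=> x0 y0 /andP[_ x0b] _.
have [|d Hd] := hF (cart x0 y0); first by rewrite /cRe /=; lra.
(* The form v dx + u dy is the imaginary part of F(w) dw, and it is closed by the Cauchy-Riemann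
   equations: dv/dy = du/dx = Re d. *)
exists (cIm d), (cRe d), (- cIm d) => e e0; have [t t0 Ht] := Hd e e0.
exists (t / 2); first by rewrite divr_gt0.
move=> x y _ _ xt yt.
have small : cabs (cart x y - cart x0 y0) < t.
  by rewrite cart_sub; apply: le_lt_trans (cabs_cart _ _) _; lra.
have K := Ht _ small.
have K' : cabs (F (cart x y) - F (cart x0 y0) - d * (cart x y - cart x0 y0)) <=
   e * (`|x - x0| + `|y - y0|).
  apply: le_trans K _; apply: ler_wpM2l; [exact: ltW|]; rewrite cart_sub; exact: cabs_cart.
split.
  apply: le_trans K'; apply: le_trans (cIm_le _).
  by rewrite !cImB cImM /v cart_sub /cRe /cIm /=; rewrite le_eqVlt; apply/orP; left; apply/eqP; congr (`| _ |); ring.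
apply: le_trans K'; apply: le_trans (cRe_le _).
by rewrite !cReB cReM /u cart_sub /cRe /cIm /=; rewrite le_eqVlt; apply/orP; left; apply/eqP; congr (`| _ |); ring.
Qed.

(** Under exp, the lines Re w = ln s and Re w = ln r cover the circles of radius s and r, and f (exp
    w) has period 2 pi in Im w. Some value of Re f on the small circle thus equals one on the large
    circle, and it is within [e] of Re f(0) for small s. *)
Lemma mean_value_re f r (M : R) : 0 < r < 1 ->
  (forall z, cabs z < 1 -> exists d, cderiv f z d) ->
  (forall z, cabs z = r -> cRe (f z) <= M) -> cRe (f 0) <= M.
Proof.
move=> /andP[r0 r1] hf fM; apply/ler_addgt0Pr => e e0.
have [d /cderiv_cont /(_ e e0) [t t0 Ht]] : exists d, cderiv f 0 d by apply: hf; rewrite cabs0.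
pose s := Num.min r (t / 2).
have s0 : 0 < s by rewrite /s lt_min r0 divr_gt0.
have sr : s <= r by rewrite /s ge_min lexx.
have st : s < t.
  have : s <= t / 2 by rewrite /s ge_min lexx orbT.
  by lra.
pose F w := f (cexp w).
have hF w : cRe w < 0 -> exists d, cderiv F w d.
  move=> w0; have [|d' Hd'] := hf (cexp w); first by rewrite cabs_cexp -expR0 ltr_expR.
  by exists (d' * cexp w); apply: cderiv_comp Hd'; exact: cderiv_cexp.
have per x : F (cart x (pi *+ 2)) = F (cart x 0).
  by rewrite /F /cexp /= cos2pi sin2pi cos0 sin0.
have T0 : 0 < (pi : R) *+ 2 by rewrite pmulrn_lgt0 // pi_gt0.
have lnsr : ln s <= ln r by rewrite ler_ln ?posrE.
have lnr : ln r < 0 by rewrite ln_lt0 // r0 r1.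
have [ya [yb E]] := periodic_vertical_means lnsr lnr T0 hF per.
have Fr : cRe (F (cart (ln r) yb)) <= M.
  by apply: fM; rewrite cabs_cexp /cRe /= lnK ?posrE.
have := Ht (cexp (cart (ln s) ya)); rewrite subr0 cabs_cexp /cRe /= lnK ?posrE // => /(_ st).
rewrite -/(F _) cabsC => K.
have := cRe_le (f 0 - F (cart (ln s) ya)); rewrite cReB E => /(le_trans (ler_norm _)).
by lra.
Qed.

End MeanValue.
(** * The maximum principle *)

Section Compactness.
Variable R : realType.
Local Notation C := (Cplx R).
Implicit Types (z w c : C) (s r e t : R) (u : C -> R).

Definition rcont u z := forall e, 0 < e -> exists2 t, 0 < t &
  forall w, cabs (w - z) < t -> `|u w - u z| < e.

Lemma rcontP u z : rcont u z -> {for z, continuous u}.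
Proof.
move=> H; have E := @cvgrPdist_lt R R C (nbhs z) (nbhs_filter z) u (u z).
rewrite /prop_for /continuous_at E {E} => e /H[t t0 Ht].
by apply/nearCP; exists t => // w /Ht; rewrite distrC.
Qed.

Lemma rcont_cabs (f : C -> C) z : ccont f z -> rcont (fun z => cabs (f z)) z.
Proof.
move=> H e /H[t t0 Ht]; exists t => // w /Ht; apply: le_lt_trans.
rewrite ler_norml cabs_sub andbT.
by have := cabs_sub (f z) (f w); rewrite cabsC; lra.
Qed.

Lemma compact_cdisc c s : compact [set z : C | cabs (z - c) <= s].
Proof.
pose K := ((fun p : R * R => cart p.1 p.2) @`
  (`[cRe c - s, cRe c + s] `*` `[cIm c - s, cIm c + s])).
apply: (@subclosed_compact _ _ K).
- rewrite -openC openE => z /= /negP; rewrite -ltNge => zs.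
  apply/nearCP; exists (cabs (z - c) - s); first by rewrite subr_gt0.
  move=> w wz; apply/negP; rewrite -ltNge.
  by have := cabs_tri w z c; rewrite (cabsC z w); lra.
- apply: continuous_compact; last by apply: compact_setX; exact: segment_compact.
  apply: continuous_subspaceT => p.
  have E := @cvgrPdist_lt C C (R * R)%type (nbhs p) (nbhs_filter p)
     (fun p => cart p.1 p.2) (cart p.1 p.2).
  rewrite /continuous_at E {E} => e e0.
  have ere : e = rc (cRe e) by apply/esym/RRe_real/gtr0_real.
  have e0' : 0 < cRe e by rewrite -rc_lt -ere.
  apply/nbhs_ballP; exists (cRe e / 2); first by rewrite /= divr_gt0.
  move=> q [/= q1 q2]; rewrite cabsE ere rc_lt cart_sub.
  apply: le_lt_trans (cabs_cart _ _) _.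
  by rewrite /ball /= in q1 q2; lra.
- move=> z /= zs; exists (cRe z, cIm z); last by case: z {zs}.
  have := le_trans (cRe_le _) zs; have := le_trans (cIm_le _) zs.
  rewrite cReB cImB !ler_distl => h1 h2.
  by split; rewrite /= in_itv.
Qed.

Lemma cdisc_max u c s : 0 <= s -> (forall z, cabs (z - c) <= s -> rcont u z) ->
  exists2 z0, cabs (z0 - c) <= s & forall z, cabs (z - c) <= s -> u z <= u z0.
Proof.
move=> s0 H.
have [||z0 /set_mem z0s Hz] := compact_EVT_max _ (@compact_cdisc c s) (_ : {within _, continuous u}).
- by exists c; rewrite /= subrr cabs0.
- by apply: continuous_in_subspaceT => z /set_mem zs; apply: rcontP; exact: H.
by exists z0 => // z zs; apply: Hz; exact: mem_set.
Qed.

End Compactness.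

(** * Moebius automorphisms of the disc *)

Section Moebius.
Variable R : realType.
Local Notation C := (Cplx R).
Implicit Types (a z w : C).

Definition mob a z : C := (z - a) / (1 - cconj a * z).

Lemma mob_den a z : cabs a < 1 -> cabs z <= 1 -> 1 - cconj a * z != 0.
Proof.
move=> a1 z1; rewrite subr_eq0 eq_sym; apply/eqP => E.
have : cabs (cconj a * z) = 1 by rewrite E cabs1.
rewrite cabsM cabs_conj => K.
have : cabs a * cabs z <= cabs a by rewrite ler_piMr // cabs_ge0.
by lra.
Qed.

Lemma cconjB z w : cconj (z - w) = cconj z - cconj w.
Proof. by rewrite cconjD cconjN. Qed.

Lemma cabs_sqrE z : rc (cabs z ^+ 2) = z * cconj z.
Proof. by rewrite mul_cconj. Qed.

(** The Schwarz-Pick identity. Invariance of the disc, the behaviour of [mob a] at the circle and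
    the bounds on |mob a z| are all read off from it. *)
Lemma mob_cabs_sqr a z : 1 - cconj a * z != 0 ->
  1 - cabs (mob a z) ^+ 2 =
  (1 - cabs a ^+ 2) * (1 - cabs z ^+ 2) / cabs (1 - cconj a * z) ^+ 2.
Proof.
move=> d0; apply: rc_inj.
rewrite rcM rcV rcM 3!(rcD 1) !rcN !cabs_sqrE /mob.
rewrite cconjM cconjV !cconjB cconjM cconjK cconj1 rc1.
have : cconj (1 - cconj a * z) != 0.
  by rewrite -cabs_eq0 cabs_conj cabs_eq0.
rewrite cconjB cconjM cconjK cconj1 => d0'.
by field; rewrite d0 d0'.
Qed.

Lemma cabs_den_ge a z : cabs z <= 1 -> 1 - cabs a <= cabs (1 - cconj a * z).
Proof.
move=> z1; have := cabs_sub 1 (cconj a * z); rewrite cabs1 cabsM cabs_conj.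
have : cabs a * cabs z <= cabs a by rewrite ler_piMr // cabs_ge0.
by lra.
Qed.

Lemma cabs_den_le a z : cabs a < 1 -> cabs z <= 1 -> cabs (1 - cconj a * z) <= 2.
Proof.
move=> a1 z1; have := cabsB 1 (cconj a * z); rewrite cabs1 cabsM cabs_conj.
have : cabs a * cabs z <= cabs a by rewrite ler_piMr // cabs_ge0.
by lra.
Qed.

Lemma cabs_lt1_sqr z : (cabs z < 1) = (0 < 1 - cabs z ^+ 2).
Proof. by rewrite subr_gt0 expr_lt1 ?cabs_ge0. Qed.

Lemma mob_lt1 a z : cabs a < 1 -> cabs z < 1 -> cabs (mob a z) < 1.
Proof.
move=> a1 z1; have d0 := mob_den a1 (ltW z1).
rewrite cabs_lt1_sqr mob_cabs_sqr //.
apply: divr_gt0; last by rewrite exprn_gt0 // cabs_gt0.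
by apply: mulr_gt0; rewrite -cabs_lt1_sqr.
Qed.

Lemma mobK a z : cabs a < 1 -> cabs z < 1 -> mob (- a) (mob a z) = z.
Proof.
move=> a1 z1; have d0 := mob_den a1 (ltW z1).
have a0 : 1 - cconj a * a != 0 by apply: mob_den => //; exact: ltW.
have e0 : 1 - cconj (- a) * mob a z != 0.
  apply: mob_den; first by rewrite cabsN.
  by apply: ltW; exact: mob_lt1.
move: e0; rewrite /mob cconjN.
have -> : 1 - - cconj a * ((z - a) / (1 - cconj a * z)) = (1 - cconj a * a) / (1 - cconj a * z).
  by field.
move=> e0; rewrite -[LHS]/(((z - a) / (1 - cconj a * z) - - a) / _).
by field; rewrite d0.
Qed.

Lemma mobNK a z : cabs a < 1 -> cabs z < 1 -> mob a (mob (- a) z) = z.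
Proof. by move=> a1 z1; rewrite -{1}[a]opprK mobK // cabsN. Qed.

Lemma mob_self a : mob a a = 0.
Proof. by rewrite /mob subrr mul0r. Qed.
Lemma mobN0 a : mob (- a) 0 = a.
Proof. by rewrite /mob mulr0 subr0 divr1 sub0r opprK. Qed.

Lemma cderiv_den a z : cderiv (fun z => 1 - cconj a * z) z (- cconj a).
Proof.
apply: (cderiv_eq (cderivB (cderiv_cst 1 z) (cderivZ (cconj a) (cderiv_id z)))).
by ring.
Qed.

Lemma cderiv_mob a z : 1 - cconj a * z != 0 ->
  cderiv (mob a) z (rc (1 - cabs a ^+ 2) / (1 - cconj a * z) ^+ 2).
Proof.
move=> d0.
have H : cderiv (mob a) z _ :=
  @cderiv_div _ (fun z => z - a) (fun z => 1 - cconj a * z) _ _ _ d0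
    (cderivB (cderiv_id z) (cderiv_cst a z)) (cderiv_den a z).
apply: (cderiv_eq H).
by rewrite rcD rcN cabs_sqrE rc1; field.
Qed.

End Moebius.

(** * From the mean value inequality to the maximum principle *)

Section MaxPrinciple.
Variable R : realType.
Local Notation C := (Cplx R).
Implicit Types (a z w c : C) (s r e t M : R) (f g k : C -> C).

Definition hol c r f := forall z, cabs (z - c) < r -> exists d, cderiv f z d.

(** Multiplication by a unimodular constant makes [f 0] real and positive, which reduces moduli to
    real parts. *)
Lemma mean_value f r M : 0 < r < 1 -> hol 0 1 f ->
  (forall z, cabs z = r -> cabs (f z) <= M) -> cabs (f 0) <= M.
Proof.
move=> r01 hf fM; have [f0|f0] := eqVneq (f 0) 0.
  rewrite f0 cabs0; apply: le_trans (cabs_ge0 (f (rc r))) _; apply: fM.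
  by rewrite cabs_rc ger0_norm //; case/andP: r01 => /ltW.
have c0 : rc (cabs (f 0)) != 0 by rewrite rc_eq0 cabs_eq0.
pose q := cconj (f 0) / rc (cabs (f 0)).
have q1 : cabs q = 1.
  by rewrite cabs_div cabs_conj cabs_rc ger0_norm ?cabs_ge0 // divff // cabs_eq0.
have -> : cabs (f 0) = cRe (q * f 0).
  rewrite -[LHS]cRe_rc; congr cRe.
  by rewrite /q mulrAC [_ * f 0]mulrC mul_cconj rcX; field.
apply: (mean_value_re (f := fun z => q * f z) r01) => z zr.
  have [|d Hd] := hf z; first by rewrite subr0.
  by exists (q * d); exact: cderivZ.
apply: le_trans (ler_norm _) _; apply: le_trans (cRe_le _) _.
by rewrite cabsM q1 mul1r; exact: fM.
Qed.

Lemma max_principle_disc f s M : 0 <= s < 1 -> hol 0 1 f ->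
  (forall z, s < cabs z < 1 -> cabs (f z) <= M) ->
  forall z, cabs z < 1 -> cabs (f z) <= M.
Proof.
move=> /andP[s0 s1] hf fM c c1.
have cN1 : cabs (- c) < 1 by rewrite cabsN.
have c0 := cabs_ge0 c.
(* The automorphism [mob (- c)] sends 0 to c, and the circle of radius 1 - q / 8 must land in the
   annulus s < |z| < 1. By [mob_cabs_sqr], 1 - |mob (- c) z|^2 is at most (1 - s^2) / 2 there: the
   numerator is at most 2 (1 - |c|) q / 4 and the denominator at least (1 - |c|)^2. *)
pose q := (1 - s ^+ 2) * (1 - cabs c).
have s2 : s ^+ 2 < 1 by rewrite expr_lt1.
have s20 : 0 <= s ^+ 2 by rewrite sqr_ge0.
have q0 : 0 < q by rewrite mulr_gt0 ?subr_gt0.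
have q1 : q <= 1.
  rewrite -[leRHS]mulr1; apply: ler_pM; try lra.
pose r := 1 - q / 8.
have r01 : 0 < r < 1 by rewrite /r; apply/andP; split; lra.
have -> : c = mob (- c) 0 by rewrite mobN0.
apply: (mean_value (f := fun z => f (mob (- c) z)) r01).
  move=> z; rewrite subr0 => z1.
  have [|d Hd] := hf (mob (- c) z); first by rewrite subr0 mob_lt1.
  exists (d * (rc (1 - cabs (- c) ^+ 2) / (1 - cconj (- c) * z) ^+ 2)).
  by apply: cderiv_comp Hd; apply: cderiv_mob; apply: mob_den => //; exact: ltW.
move=> z zr; have z1 : cabs z < 1 by rewrite zr; case/andP: r01.
apply: fM; rewrite mob_lt1 // andbT.
have d0 := mob_den cN1 (ltW z1).
rewrite -(ltr_pXn2r (n := 2)) ?nnegrE ?cabs_ge0 //.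
have := mob_cabs_sqr d0; rewrite cabsN zr.
have dge := cabs_den_ge (- c) (ltW z1); rewrite cabsN in dge.
set m := cabs (mob _ _); set d := cabs (1 - _) => E.
have dpos : 0 < d by apply: lt_le_trans dge; lra.
suff : 1 - m ^+ 2 < 1 - s ^+ 2 by lra.
rewrite E ltr_pdivrMr ?exprn_gt0 //.
have r2 : 1 - r ^+ 2 <= q / 4.
  by have := sqr_ge0 (q / 8); rewrite /r; lra.
have d2 : (1 - cabs c) ^+ 2 <= d ^+ 2 
  by rewrite ler_pXn2r ?nnegrE ?(ltW dpos) // subr_ge0 ltW.
have sp : 0 < 1 - s ^+ 2 by lra.
have cp : 0 < 1 - cabs c by lra.
have A1 : (1 - cabs c ^+ 2) * (1 - r ^+ 2) <= (2 * (1 - cabs c)) * (q / 4).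
  apply: ler_pM => //.
  - by rewrite subr_ge0 expr_le1 // ltW.
  - by rewrite subr_ge0 expr_le1 //; case/andP: r01 => *; lra.
  - by have := sqr_ge0 (1 - cabs c); lra.
apply: le_lt_trans A1 _.
apply: (@lt_le_trans _ _ ((1 - s ^+ 2) * (1 - cabs c) ^+ 2)); last by rewrite ler_pM2l.
have : 0 < (1 - s ^+ 2) * (1 - cabs c) ^+ 2 by rewrite mulr_gt0 ?exprn_gt0.
by rewrite /q; lra.
Qed.

Lemma max_principle c r s f M : 0 <= s < r -> hol c r f ->
  (forall z, s < cabs (z - c) < r -> cabs (f z) <= M) ->
  forall z, cabs (z - c) < r -> cabs (f z) <= M.
Proof.
move=> /andP[s0 sr] hf fM z zr.
have r0 : 0 < r by lra.
have rr0 : rc r != 0 by rewrite rc_eq0 gt_eqF.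
have cr : cabs (rc r) = r by rewrite cabs_rc ger0_norm // ltW.
pose g w := f (rc r * w + c).
have -> : f z = g ((z - c) / rc r) by rewrite /g mulrC divfK // subrK.
apply: (@max_principle_disc g (s / r)).
- by rewrite divr_ge0 ?(ltW r0) //= ltr_pdivrMr // mul1r.
- move=> w; rewrite subr0 => w1.
  have [|d Hd] := hf (rc r * w + c).
    by rewrite addrK cabsM cr -ltr_pdivlMl // mulVf // gt_eqF.
  exists (d * (rc r * 1 + 0)); apply: (@cderiv_comp _ (fun w => rc r * w + c)) Hd.
  by apply: cderivD; [apply: cderivZ; exact: cderiv_id | exact: cderiv_cst].
- move=> w /andP[sw w1]; apply: fM; rewrite addrK cabsM cr.
  by rewrite mulrC -ltr_pdivrMr // sw gtr_pMl.
by rewrite cabs_div cr ltr_pdivrMr // mul1r.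
Qed.

(** A linear factor upgrades continuity to differentiability at its zero; this is how a polynomial
    repairs a function at exceptional points. *)
Lemma cderiv_mul_cont q a : ccont q a -> cderiv (fun z => (z - a) * q z) a (q a).
Proof.
move=> cq e e0; have [t t0 Ht] := cq e e0; exists t => // z /Ht zt.
rewrite subrr mul0r subr0 (_ : _ - _ = (q z - q a) * (z - a)); last by ring.
by rewrite cabsM ler_wpM2r ?cabs_ge0 // ltW.
Qed.

(** Pigeonhole on the points z + t / (k + 2), one more than E has entries; the shift by 2 keeps them
    at distance less than t. *)
Lemma avoid_seq (E : seq C) z t : 0 < t -> exists2 w, cabs (w - z) < t & w \notin E.
Proof.
move=> t0; pose h (k : nat) := z + rc (t / k.+2%:R).
have hinj : injective h.
  move=> i j /addrI /rc_inj /(mulfI (lt0r_neq0 t0)) /invr_inj /eqP.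
  by rewrite eqr_nat => /eqP [].
have [w /mapP[k _ ->] wE] : exists2 w, w \in map h (iota 0 (size E).+1) & w \notin E.
  apply/hasP/negPn/negP; rewrite -all_predC => /allP H.
  have : uniq (map h (iota 0 (size E).+1)) by rewrite (map_inj_uniq hinj) iota_uniq.
  move=> U; have : (size (map h (iota 0 (size E).+1)) <= size E)%N.
    by apply: (uniq_leq_size U) => x /H /=; rewrite negbK.
  by rewrite size_map size_iota ltnn.
exists (h k) => //; rewrite /h addrAC subrr add0r cabs_rc ger0_norm; last by rewrite divr_ge0 // ltW.
by rewrite ltr_pdivrMr // ltr_pMr // ltr1n.
Qed.

Lemma bernoulli_le (x : R) n : 0 <= x -> 1 + n%:R * x <= (1 + x) ^+ n.
Proof.
move=> x0; elim: n => [|n IH]; first by rewrite mul0r addr0 expr0.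
rewrite exprS -natr1.
have : (1 + x) * (1 + n%:R * x) <= (1 + x) * (1 + x) ^+ n by apply: ler_wpM2l => //; lra.
have : 0 <= n%:R * (x * x) by rewrite mulr_ge0 // mulr_ge0.
by lra.
Qed.

(** Taking n-th roots without roots: if x > M, Bernoulli's inequality makes (x / M)^n grow at least
    linearly, beyond K / A. *)
Lemma pow_bounded_le (A K x M : R) : 0 < A -> 0 < M -> 0 <= x ->
  (forall n, A * x ^+ n <= K * M ^+ n) -> x <= M.
Proof.
move=> A0 M0 x0 H; rewrite leNgt; apply/negP => Mx.
pose y := x / M - 1.
have y0 : 0 < y by rewrite subr_gt0 ltr_pdivlMr // mul1r.
have {}H n : A * (1 + n%:R * y) <= K.
  have := H n; rewrite -ler_pdivrMr ?exprn_gt0 // -mulrA -expr_div_n.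
  apply: le_trans; apply: ler_wpM2l; first exact: ltW.
  apply: le_trans (bernoulli_le n (ltW y0)) _.
  by rewrite /y addrC subrK.
have Ay : 0 < A * y by rewrite mulr_gt0.
have := archi_boundP (normr_ge0 (K / (A * y))); set n := Num.bound _.
move=> /(le_lt_trans (ler_norm _)); rewrite ltr_pdivrMr // => K1.
by have := H n; lra.
Qed.

(* With p the product of the (z - e) for e in E, the functions p f^n are
   holomorphic everywhere; take n-th roots in the resulting bounds on p f^n. *)
Lemma max_principle_exc (E : seq C) c r s f M : 0 <= s < r ->
  (forall z, cabs (z - c) < r -> ccont f z) ->
  (forall z, cabs (z - c) < r -> z \notin E -> exists d, cderiv f z d) ->
  (forall z, s < cabs (z - c) < r -> cabs (f z) <= M) ->
  forall z, cabs (z - c) < r -> cabs (f z) <= M.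
Proof.
move=> sr cf df fM.
have [s0 sr'] := andP sr.
have M0 : 0 <= M.
  apply: le_trans (cabs_ge0 (f (c + rc ((s + r) / 2)))) _; apply: fM.
  by rewrite addrAC subrr add0r cabs_rc ger0_norm; last lra; apply/andP; split; lra.
pose p (S : seq C) z : C := \prod_(a <- S) (z - a).
have dp S z : exists d, cderiv (p S) z d.
  elim: S => [|a S [d IH]].
    exists 0; apply: cderiv_ext (cderiv_cst 1 z) => w; by rewrite /p big_nil.
  eexists; apply: (cderiv_ext (f := fun w => (w - a) * p S w)).
    by move=> w; rewrite /p big_cons.
  by apply: cderivM IH; apply: cderivB (cderiv_id _) (cderiv_cst a _).
have pK z : cabs (z - c) < r -> cabs (p E z) <= \prod_(a <- E) (r + cabs (c - a)).
  move=> zr; rewrite /p; elim: E {df} => [|a S IH]; first by rewrite !big_nil cabs1.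
  rewrite !big_cons cabsM; apply: ler_pM; rewrite ?cabs_ge0 //.
  by apply: le_trans (cabs_tri c _ _) _; rewrite lerD2r ltW.
move: pK; set K := \prod_(a <- E) _ => pK.
(* [pow_bounded_le] wants a positive bound, while [M] may be 0; hence [M + e]. *)
have main z (e : R) : 0 < e -> cabs (z - c) < r -> z \notin E -> cabs (f z) <= M + e.
  move=> e0 zr zE.
  have pz : p E z != 0.
    rewrite /p prodf_seq_neq0; apply/allP => a aE /=; rewrite subr_eq0.
    by apply: contraNneq zE => ->.
  apply: (@pow_bounded_le (cabs (p E z)) K); rewrite ?cabs_gt0 ?cabs_ge0 //; first by lra.
  move=> n; rewrite -cabsX -cabsM.
  apply: (@max_principle c r s (fun z => p E z * f z ^+ n)) => // w.
    move=> wr; have cfn : ccont (fun z => f z ^+ n) w by apply: ccontX; exact: cf.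
    (* At a point w of E one factor z - w is split off by [rem]; continuity of the remaining product
       suffices. *)
    have [wE|wE] := boolP (w \in E).
      pose q z := p (rem w E) z * f z ^+ n.
      exists (q w); apply: (cderiv_ext (f := fun z => (z - w) * q z)).
        by move=> x; rewrite /q mulrA /p [in RHS](big_rem w wE).
      apply: cderiv_mul_cont; apply: ccontM => //.
      by have [d /cderiv_cont] := dp (rem w E) w.
    have [d Hd] := df w wr wE; have [d' Hd'] := dp E w.
    by eexists; apply: cderivM Hd' (cderivX n Hd).
  move=> ws; rewrite cabsM cabsX; apply: ler_pM.
  - exact: cabs_ge0.
  - by rewrite exprn_ge0 // cabs_ge0.
  - by apply: pK; case/andP: ws.
  - by apply: lerXn2r; rewrite ?nnegrE ?cabs_ge0 ?(le_trans (fM _ ws)) //; lra.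
move=> z zr; apply/ler_addgt0Pr => e e0.
have e2 : 0 < e / 2 by rewrite divr_gt0.
have [t t0 Ht] := cf z zr _ e2.
have [|w wz wE] := @avoid_seq E z (Num.min t (r - cabs (z - c))).
  by rewrite lt_min t0 subr_gt0.
move: wz; rewrite lt_min => /andP[/Ht wt wz].
have wr : cabs (w - c) < r by have := cabs_tri z w c; lra.
have := main _ _ e2 wr wE; have := cabs_sub (f z) (f w); rewrite (cabsC (f z)).
by lra.
Qed.

End MaxPrinciple.
(** * Removable singularities and derivatives *)

Section Removable.
Variable R : realType.
Local Notation C := (Cplx R).
Implicit Types (a z w c : C) (s r e t M : R) (f g k : C -> C) (n : nat).

Lemma cderiv_slope f w z d : z != w -> cderiv f z d ->
  exists d', cderiv (fun z => (f z - f w) / (z - w)) z d'.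
Proof.
move=> zw Hd; have zw0 : z - w != 0 by rewrite subr_eq0.
eexists; exact: (@cderiv_div _ (fun z => f z - f w) (fun z => z - w) _ _ _ zw0
  (cderivB Hd (cderiv_cst _ z)) (cderivB (cderiv_id z) (cderiv_cst _ z))).
Qed.

(** The limit is the supremum of the numbers that bound [q] from below near [a], that is, the lower
    limit. *)
Lemma real_cauchy_limit (q : C -> R) a :
  (forall e, 0 < e -> exists2 t, 0 < t & forall w w',
     0 < cabs (w - a) < t -> 0 < cabs (w' - a) < t -> `|q w - q w'| <= e) ->
  exists l, forall e, 0 < e -> exists2 t, 0 < t & forall w,
     0 < cabs (w - a) < t -> `|q w - l| <= e.
Proof.
move=> H.
pose A := [set x : R | exists2 t, 0 < t & forall w, 0 < cabs (w - a) < t -> x <= q w].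
have pt t : 0 < t -> exists w, 0 < cabs (w - a) < t.
  move=> t0; exists (a + rc (t / 2)).
  by rewrite addrAC subrr add0r cabs_rc ger0_norm; [apply/andP; split; lra | lra].
have lowA e t w : 0 < t -> (forall w w', 0 < cabs (w - a) < t -> 0 < cabs (w' - a) < t ->
    `|q w - q w'| <= e) -> 0 < cabs (w - a) < t -> A (q w - e).
  move=> t0 Ht wt; exists t => // w' w't.
  by have := Ht _ _ wt w't; rewrite ler_distlC => /andP[]; lra.
have uppA e t w : (forall w w', 0 < cabs (w - a) < t -> 0 < cabs (w' - a) < t ->
    `|q w - q w'| <= e) -> 0 < cabs (w - a) < t -> ubound A (q w + e).
  move=> Ht wt x [t' t'0 Hx].
  have t0 : 0 < t by case/andP: wt => *; lra.
  have [|w' ] := pt (Num.min t t'); first by rewrite lt_min t0.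
  rewrite lt_min => /and3P[w'0 w't w't'].
  have := Hx w'; rewrite w'0 w't' => /(_ isT).
  by have := Ht _ w' wt; rewrite w'0 w't => /(_ isT); rewrite ler_distl => /andP[]; lra.
have hs : has_sup A.
  have [t t0 Ht] := H 1 ltr01; have [w wt] := pt t t0.
  by split; [exists (q w - 1); exact: lowA t0 Ht wt | exists (q w + 1); exact: uppA Ht wt].
exists (sup A) => e e0; have [t t0 Ht] := H e e0; exists t => // w wt.
have h1 : q w - e <= sup A by apply: sup_upper_bound => //; exact: lowA t0 Ht wt.
have h2 : sup A <= q w + e by apply: ge_sup; [case: hs | exact: uppA Ht wt].
by rewrite ler_norml; apply/andP; split; lra.
Qed.

Lemma cauchy_limit (q : C -> C) a :
  (forall e, 0 < e -> exists2 t, 0 < t & forall w w',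
     0 < cabs (w - a) < t -> 0 < cabs (w' - a) < t -> cabs (q w - q w') <= e) ->
  exists l, forall e, 0 < e -> exists2 t, 0 < t & forall w,
     0 < cabs (w - a) < t -> cabs (q w - l) <= e.
Proof.
move=> H.
have [|x Hx] := @real_cauchy_limit (fun w => cRe (q w)) a.
  move=> e /H[t t0 Ht]; exists t => // w w' wt w't.
  by rewrite -cReB; apply: le_trans (cRe_le _) _; exact: Ht.
have [|y Hy] := @real_cauchy_limit (fun w => cIm (q w)) a.
  move=> e /H[t t0 Ht]; exists t => // w w' wt w't.
  by rewrite -cImB; apply: le_trans (cIm_le _) _; exact: Ht.
exists (cart x y) => e e0; have e2 : 0 < e / 2 by rewrite divr_gt0.
have [t1 t10 H1] := Hx _ e2; have [t2 t20 H2] := Hy _ e2.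
exists (Num.min t1 t2); first by rewrite lt_min t10 t20.
move=> w /andP[w0]; rewrite lt_min => /andP[w1 w2].
apply: le_trans (cabs_ReIm _) _; rewrite cReB cImB.
have := H1 w; rewrite w0 w1 => /(_ isT) K1.
have := H2 w; rewrite w0 w2 => /(_ isT) K2.
by rewrite [leRHS](_ : e = e / 2 + e / 2); [exact: lerD | field].
Qed.

(* For w, w' near a, the difference of the difference quotients of f based at w
   and at w' is small on an annulus around a, hence by the maximum principle
   also at a itself: the quotients (f w - f a) / (w - a) are Cauchy. *)
Lemma removable f a s : 0 < s -> ccont f a ->
  (forall z, cabs (z - a) < s -> z != a -> exists d, cderiv f z d) ->
  exists d, cderiv f a d.
Proof.
move=> s0 cfa df'.
have [r [r0 df fb]] : exists r, [/\ 0 < r,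
    (forall z, cabs (z - a) < r -> z != a -> exists d, cderiv f z d) &
    (forall z, cabs (z - a) < r -> cabs (f z - f a) < 1)].
  have [t t0 Ht] := cfa _ ltr01.
  exists (Num.min s t); split; first by rewrite lt_min s0 t0.
    by move=> z; rewrite lt_min => /andP[zr _]; exact: df'.
  by move=> z; rewrite lt_min => /andP[_]; exact: Ht.
have cf z : cabs (z - a) < r -> ccont f z.
  by have [->//|za zr] := eqVneq z a; have [d /cderiv_cont] := df z zr za.
(* For [w != a] the derivative as value at [w] makes [D w] continuous on the whole disc, and
   differentiable except perhaps at [w] and [a]: these are the exceptional points of the maximum
   principle. *)
pose D w z := if z == w then 'D_1 f w else (f z - f w) / (z - w).
have DE w z : z != w -> D w z = (f z - f w) / (z - w) by rewrite /D => /negPf ->.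
have quo w z d : z != w -> cderiv f z d -> exists d', cderiv (D w) z d'.
  move=> zw Hd; have zw1 : 0 < cabs (z - w) by rewrite cabs_gt0 subr_eq0.
  have [d' Hd'] := cderiv_slope zw Hd; exists d'; apply: (cderiv_near (f := fun z => (f z - f w) / (z - w)) zw1).
    move=> x xz; rewrite DE //; apply: contraTneq xz => ->.
    by rewrite -leNgt cabsC.
  exact: Hd'.
have dD w z : cabs (z - a) < r -> z != w -> z != a -> exists d, cderiv (D w) z d.
  by move=> zr zw za; have [d Hd] := df z zr za; exact: quo Hd.
have cD w z : cabs (w - a) < r -> w != a -> cabs (z - a) < r -> ccont (D w) z.
  move=> wr wa zr; have [->|zw] := eqVneq z w.
    have [d Hd] := df w wr wa; have dE := cderiv_val Hd.
    move=> e e0; have e2 : 0 < e / 2 by rewrite divr_gt0.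
    have [t t0 Ht] := Hd _ e2; exists t => // x xt.
    have [->|xw] := eqVneq x w; first by rewrite subrr cabs0.
    have xw0 : 0 < cabs (x - w) by rewrite cabs_gt0 subr_eq0.
    have xw1 : x - w != 0 by rewrite subr_eq0.
    rewrite DE // /D eqxx dE -(ltr_pM2r xw0) -cabsM.
    have -> : ((f x - f w) / (x - w) - d) * (x - w) = f x - f w - d * (x - w) by field.
    by apply: le_lt_trans (Ht _ xt) _; rewrite ltr_pM2r //; lra.
  have zw0 : 0 < cabs (z - w) by rewrite cabs_gt0 subr_eq0.
  apply: (ccont_near (f := fun z => (f z - f w) / (z - w)) zw0).
    move=> x xz; rewrite DE //; apply: contraTneq xz => ->.
    by rewrite -leNgt cabsC.
  apply: ccontM; first by apply: ccontB (ccont_cst _ _); exact: cf.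
  by apply: ccontV; [rewrite subr_eq0 | apply: ccontB (ccont_id _) (ccont_cst _ _)].
have [e|l Hl] := @cauchy_limit (fun w => D w a) a.
  (* On the annulus r / 2 < |z - a| < r, the difference [D w z - D a z] has a numerator of modulus
     at most eta (1 + r) and a denominator of modulus at least r^2 / 8, so this [eta] leaves
     [e / 2]. *)
  move=> e0; pose eta := e * r ^+ 2 / (16 * (r + 1)).
  have r1 : 0 < r + 1 by lra.
  have eta0 : 0 < eta by rewrite /eta divr_gt0 ?mulr_gt0 ?exprn_gt0.
  have [t t0 Ht] := cfa eta eta0.
  exists (Num.min t (Num.min eta (r / 4))); first by rewrite !lt_min t0 eta0 divr_gt0.
  have est w z : 0 < cabs (w - a) < Num.min t (Num.min eta (r / 4)) ->
      r / 2 < cabs (z - a) < r -> cabs (D w z - D a z) <= e / 2.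
    move=> /andP[w0]; rewrite !lt_min => /and3P[wt weta wr] /andP[z1 z2].
    have zw : r / 4 < cabs (z - w) by have := cabs_tri w z a; lra.
    have zw0 : z - w != 0 by rewrite -cabs_gt0; lra.
    have za0 : z - a != 0 by rewrite -cabs_gt0; lra.
    have zw' : z != w by rewrite -subr_eq0.
    have za' : z != a by rewrite -subr_eq0.
    rewrite (DE _ _ zw') (DE _ _ za').
    have -> : (f z - f w) / (z - w) - (f z - f a) / (z - a) =
        ((f z - f a) * (w - a) - (f w - f a) * (z - a)) / ((z - a) * (z - w)).
      by field; rewrite zw0 za0.
    rewrite cabs_div ler_pdivrMr; last by rewrite cabs_gt0 mulf_neq0.
    apply: le_trans (cabsB _ _) _; rewrite !cabsM.
    have b1 : cabs (f z - f a) * cabs (w - a) <= 1 * eta.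
      by apply: ler_pM; rewrite ?cabs_ge0 // ltW // fb.
    have b2 : cabs (f w - f a) * cabs (z - a) <= eta * r.
      by apply: ler_pM; rewrite ?cabs_ge0 // ltW // Ht.
    have b3 : (r / 2) * (r / 4) <= cabs (z - a) * cabs (z - w).
      by apply: ler_pM; lra.
    have b4 : e / 2 * ((r / 2) * (r / 4)) <= e / 2 * (cabs (z - a) * cabs (z - w)).
      by apply: ler_wpM2l => //; lra.
    have b5 : eta * (r + 1) = e / 2 * ((r / 2) * (r / 4)).
      by rewrite /eta; field; rewrite gt_eqF.
    by lra.
  move=> w w' wt w't.
  have sml x : 0 < cabs (x - a) < Num.min t (Num.min eta (r / 4)) -> cabs (x - a) < r /\ x != a.
    move=> /andP[x0]; rewrite !lt_min => /and3P[_ _ xr]; split; first by lra.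
    by rewrite -subr_eq0 -cabs_gt0.
  have [wr wa] := sml _ wt; have [w'r w'a] := sml _ w't.
  apply: (@max_principle_exc R [:: a; w; w'] a r (r / 2) (fun z => D w z - D w' z)).
  - by apply/andP; split; lra.
  - by move=> z zr; apply: ccontB; exact: cD.
  - move=> z zr; rewrite !inE !negb_or => /and3P[za zw zw'].
    have [d Hd] := dD w z zr zw za; have [d' Hd'] := dD w' z zr zw' za.
    by exists (d - d'); exact: cderivB.
  - move=> z zr; have := cabs_tri (D a z) (D w z) (D w' z).
    rewrite (cabsC (D a z)).
    by have := est _ _ wt zr; have := est _ _ w't zr; lra.
  - by rewrite subrr cabs0.
exists l => e e0; have [t t0 Ht] := Hl e e0; exists t => // z zt.
have [->|za] := eqVneq z a; first by rewrite !subrr mulr0 subrr cabs0 mulr0.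
have za0 : z - a != 0 by rewrite subr_eq0.
have := Ht z; rewrite zt cabs_gt0 za0 => /(_ isT).
have az : a - z != 0 by rewrite subr_eq0 eq_sym.
rewrite DE; last by rewrite eq_sym.
move=> K; have -> : f z - f a - l * (z - a) = ((f a - f z) / (a - z) - l) * (z - a) by field.
by rewrite cabsM ler_wpM2r // cabs_ge0.
Qed.

(** The slope function, completed by the derivative, is continuous at [a], so its singularity is
    removable. The factorization extends to all [z], also outside the disc, since [k] is total. *)
Lemma hol_divide c r f a : cabs (a - c) < r -> hol c r f ->
  exists2 k, hol c r k & k a = 'D_1 f a /\ forall z, f z = f a + (z - a) * k z.
Proof.
move=> ar hf.
pose k z := if z == a then 'D_1 f a else (f z - f a) / (z - a).
have kE z : z != a -> k z = (f z - f a) / (z - a) by rewrite /k => /negPf ->.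
have [d Hd] := hf a ar.
have offa z : cabs (z - c) < r -> z != a -> exists d, cderiv k z d.
  move=> zr za; have [d' Hd'] := hf z zr.
  have za1 : 0 < cabs (z - a) by rewrite cabs_gt0 subr_eq0.
  have [d2 Hd2] := cderiv_slope za Hd'; exists d2; apply: (cderiv_near (f := fun z => (f z - f a) / (z - a)) za1).
    move=> x xz; rewrite kE //; apply: contraTneq xz => ->.
    by rewrite -leNgt cabsC.
  exact: Hd2.
exists k; last first.
  split=> [|z]; first by rewrite /k eqxx.
  have [->|za] := eqVneq z a; first by rewrite subrr mul0r addr0.
  by rewrite kE // mulrC divfK ?subr_eq0 // addrC subrK.
move=> z zr; have [->|za] := eqVneq z a; last exact: offa.
apply: (@removable _ _ (r - cabs (a - c))); first by rewrite subr_gt0.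
  move=> e e0; have e2 : 0 < e / 2 by rewrite divr_gt0.
  have [t t0 Ht] := Hd _ e2; exists t => // x xt.
  have [->|xa] := eqVneq x a; first by rewrite subrr cabs0.
  have xa0 : 0 < cabs (x - a) by rewrite cabs_gt0 subr_eq0.
  have xa1 : x - a != 0 by rewrite subr_eq0.
  rewrite kE // /k eqxx (cderiv_val Hd) -(ltr_pM2r xa0) -cabsM.
  have -> : ((f x - f a) / (x - a) - d) * (x - a) = f x - f a - d * (x - a) by field.
  by apply: le_lt_trans (Ht _ xt) _; rewrite ltr_pM2r //; lra.
by move=> x xa; apply: offa; have := cabs_tri a x c; lra.
Qed.

Lemma hol_sub c r c' r' f : cabs (c' - c) + r' <= r -> hol c r f -> hol c' r' f.
Proof. by move=> h hf z zc; apply: hf; have := cabs_tri c' z c; lra. Qed.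

(** The derivative is the value at [a] of the slope function, which is at most 2 M / (r / 2) on the
    outer half of the disc; the maximum principle replaces the integral formula. *)
Lemma cauchy_estimate a r f M : 0 < r -> hol a r f ->
  (forall z, cabs (z - a) < r -> cabs (f z) <= M) -> cabs ('D_1 f a) <= 4 * M / r.
Proof.
move=> r0 hf fM.
have aa : cabs (a - a) < r by rewrite subrr cabs0.
have [k hk [<- kE]] := hol_divide aa hf.
apply: (@max_principle R a r (r / 2) k) => //.
  by apply/andP; split; lra.
move=> z /andP[z1 z2].
have := fM z z2; rewrite kE => K.
have Ka := fM a aa.
have := cabs_sub ((z - a) * k z) (- f a); rewrite opprK [_ * _ + _]addrC cabsN cabsM => K2.
have M0 : 0 <= M by apply: le_trans Ka; exact: cabs_ge0.
rewrite ler_pdivlMr //.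
have : cabs (k z) * (r / 2) <= cabs (k z) * cabs (z - a).
  by apply: ler_wpM2l; [exact: cabs_ge0 | exact: ltW].
by lra.
Qed.

(** Two divisions give f = f a + (z - a) (k a + (z - a) k2), hence f' = k a + (z - a) q with q = 2
    k2 + (z - a) k2'. By the Cauchy estimate k2' is bounded near [a], so q is continuous there and
    f' is differentiable at [a]. *)
Lemma hol_derive c r f : hol c r f -> hol c r ('D_1 f).
Proof.
move=> hf a ar.
have [k hk [_ kE]] := hol_divide ar hf.
have [k2 hk2 [_ k2E]] := hol_divide ar hk.
have [d2 /cderiv_cont ck2] := hk2 a ar.
have [t t0 Ht] := ck2 _ ltr01.
pose s := Num.min t (r - cabs (a - c)).
have s0 : 0 < s by rewrite /s lt_min t0 subr_gt0.
have st : s <= t by rewrite /s ge_min lexx.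
have sr : s <= r - cabs (a - c) by rewrite /s ge_min lexx orbT.
pose B := 1 + cabs (k2 a).
have k2B z : cabs (z - a) < s -> cabs (k2 z) <= B.
  move=> zs; have := Ht z (lt_le_trans zs st).
  by have := cabs_sub (k2 z) (k2 a); rewrite /B; lra.
have dk2 z : cabs (z - a) < s / 2 -> cabs ('D_1 k2 z) <= 4 * B / (s / 2).
  move=> zs; apply: cauchy_estimate; first by rewrite divr_gt0.
    by apply: hol_sub hk2; have := cabs_tri a z c; lra.
  by move=> x xz; apply: k2B; have := cabs_tri z x a; lra.
pose q z := 2 * k2 z + (z - a) * 'D_1 k2 z.
have cq : ccont q a.
  apply: ccontD; first by apply: ccontM ck2; exact: ccont_cst.
  move=> e e0; set K := 4 * B / (s / 2).
  have K0 : 0 < 1 + K.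
    have : 0 <= K by rewrite /K divr_ge0 ?mulr_ge0 ?addr_ge0 ?cabs_ge0 ?ltW //; lra.
    by lra.
  exists (Num.min (s / 2) (e / (1 + K))); first by rewrite lt_min !divr_gt0.
  move=> z; rewrite lt_min => /andP[zs ze].
  move: (dk2 z zs); rewrite -/K; set D := 'D_1 k2 z; set D' := 'D_1 k2 a => DK.
  rewrite (subrr a) (mul0r D') subr0 cabsM.
  apply: (@le_lt_trans _ _ (cabs (z - a) * (1 + K))).
    by apply: ler_wpM2l; rewrite ?cabs_ge0 //; lra.
  by rewrite -ltr_pdivlMr.
exists (0 + q a); apply: (cderiv_near (f := fun z => k a + (z - a) * q z) s0).
  move=> z zs; have zr : cabs (z - c) < r by have := cabs_tri a z c; lra.
  have [d' Hd'] := hk2 z zr.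
  have dz := cderivB (cderiv_id z) (cderiv_cst a z).
  have dk := cderivD (cderiv_cst (k a) z) (cderivM dz Hd').
  have df := cderivD (cderiv_cst (f a) z) (cderivM dz dk).
  have -> : f = (fun z => f a + (z - a) * (k a + (z - a) * k2 z)).
    by apply/funext => x; rewrite -k2E -kE.
  rewrite (cderiv_val df) /q (cderiv_val Hd').
  by ring.
by apply: cderivD; [exact: cderiv_cst | exact: cderiv_mul_cont].
Qed.

End Removable.
(** * Orders of zeros *)

Section Zeros.
Variable R : realType.
Local Notation C := (Cplx R).
Implicit Types (a z w c : C) (s r e t M : R) (f g k l : C -> C) (n : nat).

Lemma hol_cont c r f z : hol c r f -> cabs (z - c) < r -> ccont f z.
Proof. by move=> hf /hf[d /cderiv_cont]. Qed.
Lemma hol_cst c r (x : C) : hol c r (fun=> x).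
Proof. by move=> z _; exists 0; exact: cderiv_cst. Qed.
Lemma hol_id c r : hol c r id.
Proof. by move=> z _; exists 1; exact: cderiv_id. Qed.
Lemma holB c r f g : hol c r f -> hol c r g -> hol c r (fun z => f z - g z).
Proof. by move=> hf hg z zr; have [d Hd] := hf z zr; have [d' Hd'] := hg z zr; exists (d - d'); exact: cderivB. Qed.
Lemma holM c r f g : hol c r f -> hol c r g -> hol c r (fun z => f z * g z).
Proof. by move=> hf hg z zr; have [d Hd] := hf z zr; have [d' Hd'] := hg z zr; eexists; exact: cderivM Hd Hd'. Qed.
Lemma holX c r f n : hol c r f -> hol c r (fun z => f z ^+ n).
Proof. by move=> hf z zr; have [d Hd] := hf z zr; eexists; exact: cderivX Hd. Qed.
Lemma holV c r f : (forall z, cabs (z - c) < r -> f z != 0) -> hol c r f ->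
  hol c r (fun z => (f z)^-1).
Proof. by move=> f0 hf z zr; have [d Hd] := hf z zr; eexists; exact: cderivV (f0 z zr) Hd. Qed.

Lemma hol_eq c r f g : (forall z, cabs (z - c) < r -> f z = g z) ->
  hol c r f -> hol c r g.
Proof.
move=> fg hf z zr; have [d Hd] := hf z zr; exists d.
apply: (cderiv_near (e := r - cabs (z - c))) Hd; first by rewrite subr_gt0.
by move=> w wz; apply: fg; have := cabs_tri z w c; lra.
Qed.

Lemma derive_eq_on c r f g z : (forall z, cabs (z - c) < r -> f z = g z) ->
  hol c r f -> cabs (z - c) < r -> 'D_1 g z = 'D_1 f z.
Proof.
move=> fg hf zr; have [d Hd] := hf z zr.
rewrite (cderiv_val Hd); apply: cderiv_val.
apply: (cderiv_near (e := r - cabs (z - c))) Hd; first by rewrite subr_gt0.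
by move=> w wz; apply: fg; have := cabs_tri z w c; lra.
Qed.

Lemma hol_deriv c r f z : hol c r f -> cabs (z - c) < r -> cderiv f z ('D_1 f z).
Proof. by move=> hf /hf[d Hd]; rewrite (cderiv_val Hd). Qed.

Lemma hol_bounded c r s f : 0 <= s < r -> hol c r f ->
  exists M, forall z, cabs (z - c) <= s -> cabs (f z) <= M.
Proof.
move=> /andP[s0 sr] hf.
have [|z0 _ Hz0] := @cdisc_max R (fun z => cabs (f z)) c s s0.
  by move=> z zs; apply: rcont_cabs; apply: hol_cont hf _; lra.
by exists (cabs (f z0)).
Qed.

Lemma hol_mob a f : cabs a < 1 -> hol 0 1 f -> hol 0 1 (fun z => f (mob a z)).
Proof.
move=> a1 hf z; rewrite subr0 => z1.
have [|d Hd] := hf (mob a z); first by rewrite subr0 mob_lt1.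
by eexists; apply: cderiv_comp Hd; apply: cderiv_mob; apply: mob_den => //; exact: ltW.
Qed.

(** If division by z never stops, the maximum principle for f / z^n on a circle of radius about s
    gives |f p| s^n <= M |p|^n for all n. As |p| < s, this forces f p = 0; no power series is
    involved. *)
Lemma zero_order_origin f : hol 0 1 f ->
  (forall z, cabs z < 1 -> f z = 0) \/
  exists n l, [/\ hol 0 1 l, l 0 != 0 & forall z, cabs z < 1 -> f z = z ^+ n * l z].
Proof.
move=> hf; have [|H] := pselect (exists n l, [/\ hol 0 1 l, l 0 != 0 &
  forall z, cabs z < 1 -> f z = z ^+ n * l z]); first by right.
left; have {}H n : exists2 l, hol 0 1 l & forall z, cabs z < 1 -> f z = z ^+ n * l z.
  elim: n => [|n [l hl E]]; first by exists f => // z _; rewrite expr0 mul1r.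
  have l0 : l 0 = 0.
    by apply/eqP/negPn/negP => l0; apply: H; exists n, l.
  have [|k hk [_ kE]] := @hol_divide R 0 1 l 0 _ hl; first by rewrite subrr cabs0.
  exists k => // z z1.
  by rewrite E // kE l0 add0r subr0 mulrA exprSr.
move=> p p1.
have p0 := cabs_ge0 p.
(* [s] and [r] divide the interval from |p| to 1 into thirds. *)
pose s := (1 + 2 * cabs p) / 3; pose r := (2 + cabs p) / 3.
have [|M HM] := @hol_bounded 0 1 r f _ hf; first by rewrite /r; apply/andP; split; lra.
have M0 : 0 <= M.
  by apply: le_trans (cabs_ge0 (f 0)) _; apply: HM; rewrite subrr cabs0 /r; lra.
have s0 : 0 < s by rewrite /s; lra.
have ps : cabs p < s by rewrite /s; lra.
have sr : s < r by rewrite /s /r; lra.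
have r1 : r < 1 by rewrite /r; lra.
have est n : cabs (f p) * s ^+ n <= M * cabs p ^+ n.
  have [l hl E] := H n.
  have lp : cabs (l p) <= M / s ^+ n.
    apply: (@max_principle R 0 r s l); rewrite ?subr0.
    - by apply/andP; split; lra.
    - by apply: hol_sub hl; rewrite subrr cabs0; lra.
    - move=> z; rewrite subr0 => /andP[sz zr].
      rewrite ler_pdivlMr ?exprn_gt0 //.
      have := HM z; rewrite subr0 => /(_ (ltW zr)); rewrite E ?(lt_trans zr) //.
      rewrite cabsM cabsX; apply: le_trans; rewrite mulrC.
      by apply: ler_wpM2r; [exact: cabs_ge0 | apply: lerXn2r; rewrite ?nnegrE ?cabs_ge0 ?ltW].
    - by lra.
  rewrite E // cabsM cabsX -mulrA mulrC ler_wpM2r ?exprn_ge0 //.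
  by rewrite -ler_pdivlMr ?exprn_gt0.
apply/eqP; rewrite -cabs_eq0; apply/negPn/negP => fp0.
have fp : 0 < cabs (f p) by rewrite lt_def fp0 cabs_ge0.
have [p00|p00] := eqVneq (cabs p) 0.
  have := est 1%N; rewrite p00 !expr1 mulr0 => K.
  have : 0 < cabs (f p) * s by rewrite mulr_gt0.
  by lra.
have := @pow_bounded_le R (cabs (f p)) M s (cabs p) fp _ (ltW s0) est.
by rewrite lt_def p00 p0 => /(_ isT); lra.
Qed.

(* The alternative is global: the disc is connected. *)
Lemma zero_order f a : hol 0 1 f -> cabs a < 1 ->
  (forall z, cabs z < 1 -> f z = 0) \/
  exists n l, [/\ hol 0 1 l, l a != 0 & forall z, cabs z < 1 -> f z = (z - a) ^+ n * l z].
Proof.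
move=> hf a1; have aN1 : cabs (- a) < 1 by rewrite cabsN.
have [E|[n [l [hl l0 E]]]] := zero_order_origin (hol_mob aN1 hf).
  by left => z z1; rewrite -(mobK a1 z1); apply: E; exact: mob_lt1.
right; exists n, (fun z => l (mob a z) * (1 - cconj a * z)^-1 ^+ n); split.
- apply: holM; first exact: hol_mob.
  apply: holX; apply: holV => [z|z _]; last by eexists; exact: cderiv_den.
  by rewrite subr0 => z1; apply: mob_den => //; exact: ltW.
- rewrite mob_self mulf_neq0 // expf_neq0 // invr_neq0 //.
  by apply: mob_den => //; exact: ltW.
- move=> z z1; have := E _ (mob_lt1 a1 z1); rewrite mobK // => ->.
  by rewrite {1}/mob expr_div_n exprVn; ring.
Qed.

(** A quantitative substitute for the open mapping theorem: z - a points along an n-th root that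
    makes conj(c) (z - a)^n l(a) positive, so that c + (z - a)^n l z has modulus larger than |c|. *)
Lemma power_direction c l a n : (0 < n)%N -> ccont l a -> l a != 0 -> c != 0 ->
  exists2 t, 0 < t & forall r, 0 < r < t -> exists2 z, cabs (z - a) = r &
    cabs c * r ^+ n * cabs (l a) / 2 <= cRe (cconj c * ((z - a) ^+ n * l z)).
Proof.
move=> n0 cl la c0.
have pla : 0 < cabs (l a) by rewrite cabs_gt0.
have pc : 0 < cabs c by rewrite cabs_gt0.
have [t t0 Ht] := cl _ (divr_gt0 pla (ltr0n _ 2)).
pose v : C := cconj c * l a.
have v0 : 0 < cabs v by rewrite cabsM cabs_conj mulr_gt0.
have rv0 : rc (cabs v) != 0 by rewrite rc_eq0 gt_eqF.
pose o : C := n.-root (cconj v / rc (cabs v) : R[i]).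
have on : o ^+ n = cconj v / rc (cabs v) by exact: rootCK.
have o1 : cabs o = 1.
  apply/eqP; rewrite -(@pexpr_eq1 _ _ n) ?cabs_ge0 // -cabsX on cabs_div cabs_conj.
  by rewrite cabs_rc ger0_norm ?cabs_ge0 // divff // gt_eqF.
exists t => // r /andP[r0 rt]; exists (a + rc r * o).
  by rewrite addrAC subrr add0r cabsM o1 mulr1 cabs_rc ger0_norm // ltW.
set z := a + _; have zE : z - a = rc r * o by rewrite /z addrAC subrr add0r.
have zt : cabs (z - a) < t by rewrite zE cabsM o1 mulr1 cabs_rc ger0_norm // ltW.
have -> : cconj c * ((z - a) ^+ n * l z) =
   rc (r ^+ n * cabs v) + rc (r ^+ n) * (o ^+ n * cconj c * (l z - l a)).
  rewrite zE exprMn -rcX rcM.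
  have -> : rc (cabs v) = o ^+ n * v.
    by rewrite on mulrAC [_ * v]mulrC mul_cconj rcX; field.
  by rewrite /v; ring.
rewrite cReD cRe_rc.
set X := rc _ * _.
have bX : cabs X <= r ^+ n * (cabs c * (cabs (l a) / 2)).
  rewrite /X !cabsM cabs_rc ger0_norm ?exprn_ge0 ?(ltW r0) //.
  rewrite cabsX o1 expr1n mul1r cabs_conj.
  apply: ler_wpM2l; first by rewrite exprn_ge0 // ltW.
  by apply: ler_wpM2l; [exact: ltW | apply: ltW; exact: Ht].
have := cRe_le X; rewrite ler_norml => /andP[K _].
rewrite (_ : cabs v = cabs c * cabs (l a)); last by rewrite cabsM cabs_conj.
by lra.
Qed.

(** Otherwise f = f 0 + z^n l with n > 0 and l 0 != 0, and [power_direction] yields a point where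
    |f| > 1. *)
Lemma constant_modulus f : hol 0 1 f -> (forall z, cabs z < 1 -> cabs (f z) = 1) ->
  forall z, cabs z < 1 -> f z = f 0.
Proof.
move=> hf f1.
have z01 : cabs (0 : C) < 1 by rewrite cabs0.
have [E|[n [l [hl l0 E]]]] := zero_order_origin (holB hf (@hol_cst 0 1 (f 0))).
  by move=> z /E/eqP; rewrite subr_eq0 => /eqP.
case: n E => [|n] E.
  have := E 0 z01; rewrite subrr expr0 mul1r => l00.
  by rewrite -l00 eqxx in l0.
have f00 : f 0 != 0 by rewrite -cabs_eq0 f1 // oner_eq0.
have [|t t0 Ht] := @power_direction (f 0) l 0 n.+1 isT _ l0 f00.
  by apply: hol_cont hl _; rewrite subrr.
pose r := Num.min (1 / 2) (t / 2).
have r0 : 0 < r by rewrite /r lt_min !divr_gt0.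
have rt : r <= t / 2 by rewrite /r ge_min lexx orbT.
have r1 : r <= 1 / 2 by rewrite /r ge_min lexx.
have [|z zr] := Ht r; first by rewrite r0; lra.
rewrite subr0 in zr.
have z1 : cabs z < 1 by lra.
rewrite subr0 -E // f1 // mul1r mulrBr cReB.
have -> : cconj (f 0) * f 0 = rc 1 by rewrite mulrC mul_cconj f1 // expr1n.
rewrite cRe_rc => K.
have := le_trans (ler_norm _) (cRe_le (cconj (f 0) * f z)).
rewrite cabsM cabs_conj !f1 // mul1r => K2.
have : 0 < r ^+ n.+1 * cabs (l 0) by rewrite mulr_gt0 ?exprn_gt0 ?cabs_gt0.
by lra.
Qed.

(** If f - f 0 = z^(n+1) l with l 0 != 0, then f' = z^n ((n+1) l + z l'), whose second factor does
    not vanish near 0. *)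
Lemma constant_derivative f : hol 0 1 f -> (forall z, cabs z < 1 -> 'D_1 f z = 0) ->
  forall z, cabs z < 1 -> f z = f 0.
Proof.
move=> hf f'0.
have z01 : cabs (0 : C) < 1 by rewrite cabs0.
have hg := holB hf (@hol_cst 0 1 (f 0)).
have [E|[n [l [hl l0 E]]]] := zero_order_origin hg.
  by move=> z /E/eqP; rewrite subr_eq0 => /eqP.
case: n E => [|n] E.
  have := E 0 z01; rewrite subrr expr0 mul1r => l00.
  by rewrite -l00 eqxx in l0.
have cl' : ccont ('D_1 l) 0 by apply: hol_cont (hol_derive hl) _; rewrite subrr.
have cl : ccont l 0 by apply: hol_cont hl _; rewrite subrr.
have cq : ccont (fun z => n.+1%:R * l z + z * 'D_1 l z) 0.
  by apply: ccontD; apply: ccontM => //; [exact: ccont_cst | exact: ccont_id].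
have q0 : n.+1%:R * l 0 + 0 * 'D_1 l 0 != 0.
  by rewrite (mul0r ('D_1 l 0)) addr0 mulf_neq0 // pnatr_eq0.
have [t t0 Ht] := ccont_neq0 cq q0.
pose r := Num.min (1 / 2) (t / 2).
have r0 : 0 < r by rewrite /r lt_min !divr_gt0.
have rt : r <= t / 2 by rewrite /r ge_min lexx orbT.
have r1 : r <= 1 / 2 by rewrite /r ge_min lexx.
have rr : cabs (rc r) = r by rewrite cabs_rc ger0_norm // ltW.
have zz1 : cabs (rc r) < 1 by rewrite rr; lra.
have := Ht (rc r); rewrite subr0 rr => K.
have rt' : r < t by lra.
have /eqP nz := K rt'; exfalso; apply: nz.
have hl1 := hol_deriv hl (_ : cabs (rc r - 0) < 1).
rewrite subr0 in hl1; have {}hl1 := hl1 zz1.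
have hf1 := hol_deriv hf (_ : cabs (rc r - 0) < 1).
rewrite subr0 f'0 // in hf1; have {}hf1 := hf1 zz1.
have D1 := cderivB hf1 (cderiv_cst (f 0) (rc r)).
have D2 := cderivM (cderivX n.+1 (cderiv_id (rc r))) hl1.
have e0 : 0 < 1 - r by lra.
have {}D1 := cderiv_near (g := fun z => z ^+ n.+1 * l z) e0 _ D1.
have := cderiv_unique (D1 _) D2.
rewrite subrr /= => H.
have rn : rc r ^+ n != 0 by rewrite expf_neq0 // rc_eq0 gt_eqF.
apply: (mulfI rn); rewrite mulr0 [RHS]H.
  by rewrite exprS; ring.
move=> z zr; apply: E; have := cabs_tri (rc r) z 0; rewrite !subr0 rr; lra.
Qed.

End Zeros.
(** * Proper maps are Blaschke products *)

Section Blaschke.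
Variable R : realType.
Local Notation C := (Cplx R).
Implicit Types (a z w c : C) (s r e t M : R) (f g k l : C -> C) (n : nat) (S : seq C).

(** Convergence of |f| to 1, uniformly along the circle. As only moduli enter, it makes sense for
    functions that are not holomorphic, such as [hyp f] below. *)
Definition bdry1 f := forall e, 0 < e -> exists2 r, 0 <= r < 1 &
  forall z, r < cabs z < 1 -> `|cabs (f z) - 1| < e.

Lemma unit_discE z : unit_disc R z <-> cabs z < 1.
Proof. by rewrite /unit_disc /= cabsE -rc1 rc_lt. Qed.

Lemma holomorphic_onE f : holomorphic_on (unit_disc R) f <-> hol 0 1 f.
Proof.
split=> hf z.
  by rewrite subr0 => /unit_discE/hf/derivable_cderiv.
by move=> /unit_discE z1; apply/derivable_cderiv; apply: hf; rewrite subr0.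
Qed.

(** The preimage of the disc |w| <= s is compact, so |z| attains a maximum r < 1 on it; beyond r,
    |f| exceeds s. *)
Lemma proper_bdry1 f : proper_holomorphic_self_map f -> bdry1 f.
Proof.
move=> [fD /holomorphic_onE hf fp] e e0.
pose s := Num.max 0 (1 - e / 2).
have s0 : 0 <= s by rewrite /s le_max lexx.
have s1 : s < 1 by rewrite /s gt_max ltr01; lra.
have se : 1 - e / 2 <= s by rewrite /s le_max lexx orbT.
have cK : compact [set z : C | cabs z <= s].
  have := @compact_cdisc R 0 s; congr compact.
  by apply/funext => z /=; rewrite subr0.
have KD : [set z : C | cabs z <= s] `<=` unit_disc R.
  by move=> z /= zs; apply/unit_discE; lra.
have cP := fp _ KD cK.
set P := unit_disc R `&` _ in cP.
suff [r r01 Hr] : exists2 r, 0 <= r < 1 & forall z, P z -> cabs z <= r.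
  exists r => // z /andP[rz z1].
  have fz1 : cabs (f z) < 1 by apply/unit_discE/fD/unit_discE.
  have : s < cabs (f z).
    rewrite ltNge; apply/negP => fzs.
    have : P z by split => //; exact/unit_discE.
    by move=> /Hr; lra.
  by rewrite ltr_norml => ?; apply/andP; split; lra.
have [P0|/set0P P0] := eqVneq P set0.
  by exists 0 => [|z]; rewrite ?lexx ?ltr01 // P0.
have [|z0 /set_mem z0P Hz] := compact_EVT_max P0 cP (_ : {within P, continuous (@cabs R)}).
  apply: continuous_in_subspaceT => z _; apply: rcontP.
  by apply: (@rcont_cabs R id); exact: ccont_id.
exists (cabs z0) => [|z zP]; last by apply: Hz; exact: mem_set.
by rewrite cabs_ge0 /=; apply/unit_discE; case: z0P.
Qed.

Lemma bdry1_mob a : cabs a < 1 -> bdry1 (mob a).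
Proof.
move=> a1 e e0.
have a0 : 0 < (1 - cabs a) ^+ 2 by rewrite exprn_gt0 // subr_gt0.
pose r := Num.max 0 (1 - e * (1 - cabs a) ^+ 2 / 2).
have p0 : 0 < e * (1 - cabs a) ^+ 2 by rewrite mulr_gt0.
exists r; first by rewrite /r le_max lexx /= gt_max ltr01; lra.
move=> z /andP[rz z1].
have re : 1 - e * (1 - cabs a) ^+ 2 / 2 <= r by rewrite /r le_max lexx orbT.
have m1 := mob_lt1 a1 z1.
have d0 := mob_den a1 (ltW z1).
suff : 1 - cabs (mob a z) < e by rewrite ltr_norml => ?; apply/andP; split; lra.
apply: (@le_lt_trans _ _ (1 - cabs (mob a z) ^+ 2)).
  by rewrite lerD2l lerN2 expr2 ler_piMr ?cabs_ge0 // ltW.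
rewrite mob_cabs_sqr // ltr_pdivrMr; last by rewrite exprn_gt0 // cabs_gt0.
have dge := cabs_den_ge a (ltW z1).
apply: (@lt_le_trans _ _ (e * (1 - cabs a) ^+ 2)); last first.
  apply: ler_wpM2l; first exact: ltW.
  by rewrite ler_pXn2r ?nnegrE ?cabs_ge0 // subr_ge0 ltW.
have z0 := cabs_ge0 z.
have b1 : 1 - cabs z ^+ 2 < e * (1 - cabs a) ^+ 2.
  by have := sqr_ge0 (1 - cabs z); lra.
apply: le_lt_trans b1; rewrite ler_piMl ?lerBlDr ?lerDl ?sqr_ge0 //.
by rewrite subr_ge0 expr_le1 // ltW.
Qed.

Lemma bdry1_div f g k : bdry1 f -> bdry1 g ->
  (forall z, cabs z < 1 -> f z = g z * k z) -> bdry1 k.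
Proof.
move=> bf bg E e e0.
pose h := Num.min (1 / 2) (e / 5).
have h0 : 0 < h by rewrite /h lt_min !divr_gt0.
have h1 : h <= 1 / 2 by rewrite /h ge_min lexx.
have h2 : h <= e / 5 by rewrite /h ge_min lexx orbT.
have [r1 /andP[r10 r11] H1] := bf _ h0; have [r2 /andP[r20 r21] H2] := bg _ h0.
exists (Num.max r1 r2); first by rewrite le_max r10 gt_max r11.
move=> z /andP[]; rewrite gt_max => /andP[z1 z2] z3.
have := H1 z; rewrite z1 z3 => /(_ isT); have := H2 z; rewrite z2 z3 => /(_ isT).
rewrite E // cabsM; set x := cabs (g z); set y := cabs (k z).
rewrite !ltr_norml => /andP[K1 K2] /andP[K3 K4].
have x0 : 0 < x by lra.
have A1 : x * y < x * (1 + e).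
  have : x * e >= 1 / 2 * e by rewrite ler_wpM2r //; lra.
  by lra.
have A2 : x * (1 - e) < x * y.
  have : x * e >= 1 / 2 * e by rewrite ler_wpM2r //; lra.
  by lra.
by rewrite !ltr_pM2l // in A1 A2; apply/andP; split; lra.
Qed.

Lemma bdry1_le1 f : hol 0 1 f -> bdry1 f -> forall z, cabs z < 1 -> cabs (f z) <= 1.
Proof.
move=> hf bf z z1; apply/ler_addgt0Pr => e e0.
have [r r01 Hr] := bf e e0.
apply: (max_principle_disc r01 hf _ z1) => w /Hr.
by rewrite ltr_norml => /andP[]; lra.
Qed.

(** Both f and 1 / f are bounded by 1, so f has constant modulus. *)
Lemma bdry1_nonzero_constant f : hol 0 1 f -> bdry1 f ->
  (forall z, cabs z < 1 -> f z != 0) ->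
  cabs (f 0) = 1 /\ forall z, cabs z < 1 -> f z = f 0.
Proof.
move=> hf bf f0.
have hV : hol 0 1 (fun z => (f z)^-1) by apply: holV => // z; rewrite subr0; exact: f0.
have f1 z : cabs z < 1 -> cabs (f z) = 1.
  move=> z1; apply/eqP; rewrite eq_le bdry1_le1 //=.
  have : cabs (f z)^-1 <= 1.
    apply: (bdry1_le1 hV _ z1); apply: (@bdry1_div (fun=> 1) f) => //.
      by move=> e e0; exists 0; [rewrite lexx ltr01 | move=> w _; rewrite cabs1 subrr normr0].
    by move=> w w1; rewrite divff // f0.
  by rewrite cabsV invf_le1 // cabs_gt0 f0.
split; first by apply: f1; rewrite cabs0.
exact: constant_modulus hf f1.
Qed.

Definition blaschke S z : C := \prod_(a <- S) mob a z.

Lemma blaschke_nil z : blaschke [::] z = 1.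
Proof. by rewrite /blaschke big_nil. Qed.
Lemma blaschke_cons a S z : blaschke (a :: S) z = mob a z * blaschke S z.
Proof. by rewrite /blaschke big_cons. Qed.

(** Zeros are divided out one at a time, by [mob a] instead of z - a so that the boundary modulus
    stays 1. The process either meets a zero-free quotient, which is a unimodular constant, or
    survives n steps. *)
Lemma peel f n : hol 0 1 f -> bdry1 f ->
  (exists S u, [/\ {in S, forall a, cabs a < 1}, cabs u = 1 &
     forall z, cabs z < 1 -> f z = u * blaschke S z]) \/
  exists S g, [/\ size S = n, {in S, forall a, cabs a < 1}, hol 0 1 g, bdry1 g &
     forall z, cabs z < 1 -> f z = blaschke S z * g z].
Proof.
move=> hf bf; elim: n => [|n [IH|[S [g [sS S1 hg bg E]]]]]; last 2 first.
- by left.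
- have [g0|g0] := pselect (forall z, cabs z < 1 -> g z != 0).
    have [u1 Eg] := bdry1_nonzero_constant hg bg g0.
    by left; exists S, (g 0); split => // z z1; rewrite E // Eg // mulrC.
  have [a a1 ga] : exists2 a, cabs a < 1 & g a = 0.
    apply: contrapT => H; apply: g0 => z z1.
    by apply/negP => /eqP gz; apply: H; exists z.
  have [|k hk [_ kE]] := @hol_divide R 0 1 g a _ hg; first by rewrite subr0.
  pose q z := k z * (1 - cconj a * z).
  have Eg z : cabs z < 1 -> g z = mob a z * q z.
    move=> z1; have d0 := mob_den a1 (ltW z1).
    by rewrite kE ga add0r /mob /q; field.
  right; exists (a :: S), q; split => /=; first by rewrite sS.
  + by move=> b; rewrite inE => /orP[/eqP ->//|]; exact: S1.
  + by apply: holM => // z _; eexists; exact: cderiv_den.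
  + exact: bdry1_div bg (bdry1_mob a1) Eg.
  + by move=> z z1; rewrite E // Eg // blaschke_cons; ring.
- right; exists [::], f; split => // z z1.
  by rewrite blaschke_nil mul1r.
Qed.

Lemma blaschke_root S a : a \in S -> blaschke S a = 0.
Proof.
move=> aS; rewrite /blaschke (big_rem a aS) /= mob_self; exact: mul0r.
Qed.

(* All the zeros lie in a fixed disc |a| <= r, on which |mob a p| <= q < 1 for a
   point p with f p != 0; so n zeros give |f p| <= q^n, which bounds n. *)
Theorem blaschke_product f : hol 0 1 f -> bdry1 f ->
  exists S u, [/\ {in S, forall a, cabs a < 1}, cabs u = 1 &
     forall z, cabs z < 1 -> f z = u * blaschke S z].
Proof.
move=> hf bf; apply: contrapT => NH.
have H n : exists S g, [/\ size S = n, {in S, forall a, cabs a < 1}, hol 0 1 g, bdry1 g &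
     forall z, cabs z < 1 -> f z = blaschke S z * g z].
  by have [|//] := peel n hf bf.
have half : 0 < 1 / 2 :> R by rewrite divr_gt0.
have [r /andP[r0 r1] Hr] := bf _ half.
have nz z : r < cabs z < 1 -> f z != 0.
  by move=> /Hr; rewrite -cabs_gt0 ltr_norml => /andP[]; lra.
pose p : C := rc ((1 + r) / 2).
have pE : cabs p = (1 + r) / 2 by rewrite cabs_rc ger0_norm //; lra.
have p1 : cabs p < 1 by lra.
have fp : 0 < cabs (f p) by rewrite cabs_gt0 nz // pE; apply/andP; split; lra.
(* A lower bound for 1 - |mob a p|^2 when |a| <= r; the 4 bounds |1 - conj(a) p|^2. *)
pose kap := (1 - r ^+ 2) * (1 - cabs p ^+ 2) / 4.
have r2 : 0 < 1 - r ^+ 2 by rewrite subr_gt0 expr_lt1.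
have r3 : 0 <= r ^+ 2 by exact: sqr_ge0.
have p2 : 0 < 1 - cabs p ^+ 2 by rewrite -cabs_lt1_sqr.
have p3 : 0 <= cabs p ^+ 2 by exact: sqr_ge0.
have kap0 : 0 < kap by rewrite divr_gt0 ?mulr_gt0.
have kap1 : kap <= 1 / 4.
  have : (1 - r ^+ 2) * (1 - cabs p ^+ 2) <= 1 * 1 by apply: ler_pM; lra.
  by rewrite /kap; lra.
have mobp a : cabs a <= r -> cabs (mob a p) ^+ 2 <= 1 - kap.
  move=> ar; have a1 : cabs a < 1 by lra.
  have d0 := mob_den a1 (ltW p1).
  suff : kap <= 1 - cabs (mob a p) ^+ 2 by lra.
  rewrite mob_cabs_sqr // ler_pdivlMr ?exprn_gt0 ?cabs_gt0 //.
  have d2 : cabs (1 - cconj a * p) ^+ 2 <= 4.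
    have := cabs_den_le a1 (ltW p1); have := cabs_ge0 (1 - cconj a * p).
    set d := cabs _ => d00 d01.
    have : d ^+ 2 <= 2 ^+ 2 by rewrite ler_pXn2r ?nnegrE.
    by lra.
  have a2 : cabs a ^+ 2 <= r ^+ 2 by rewrite ler_pXn2r ?nnegrE ?cabs_ge0.
  apply: (@le_trans _ _ (kap * 4)); first by apply: ler_wpM2l; rewrite ?(ltW kap0).
  rewrite /kap divfK ?pnatr_eq0 //; apply: ler_wpM2r; first exact: ltW.
  by lra.
have est n : cabs (f p) ^+ 2 * 1 ^+ n <= 1 * (1 - kap) ^+ n.
  have [S [g [sS S1 hg bg E]]] := H n.
  have Sr a : a \in S -> cabs a <= r.
    move=> aS; rewrite leNgt; apply/negP => ra.
    have : f a != 0 by apply: nz; rewrite ra S1.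
    by rewrite E ?S1 // blaschke_root // mul0r eqxx.
  rewrite expr1n mulr1 mul1r E // cabsM exprMn -sS.
  have g1 : cabs (g p) ^+ 2 <= 1 by rewrite expr_le1 ?cabs_ge0 // bdry1_le1.
  apply: (@le_trans _ _ (cabs (blaschke S p) ^+ 2)); first by rewrite ler_piMr // sqr_ge0.
  elim: S Sr {sS S1 E} => [|a S IH] Sr; first by rewrite blaschke_nil cabs1 expr1n expr0.
  rewrite blaschke_cons cabsM exprMn /= [(1 - kap) ^+ _]exprS; apply: ler_pM; rewrite ?sqr_ge0 //.
    by apply: mobp; apply: Sr; rewrite mem_head.
  by apply: IH => b bS; apply: Sr; rewrite inE bS orbT.
have := @pow_bounded_le R (cabs (f p) ^+ 2) 1 1 (1 - kap) _ _ ler01 est.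
by rewrite exprn_gt0 // => /(_ isT); lra.
Qed.

(* bterm a z = (1 - |mob a z|^2) / (1 - |z|^2), and bsum S z is the same quotient
   for the product blaschke S; on the unit circle it is |blaschke S'|. *)
Definition bterm a z : R := (1 - cabs a ^+ 2) / cabs (1 - cconj a * z) ^+ 2.
Fixpoint bsum S z : R :=
  if S is a :: S' then bterm a z + cabs (mob a z) ^+ 2 * bsum S' z else 0.

Lemma bsumE S z : {in S, forall a, cabs a < 1} -> cabs z < 1 ->
  1 - cabs (blaschke S z) ^+ 2 = (1 - cabs z ^+ 2) * bsum S z.
Proof.
move=> S1 z1; elim: S S1 => [|a S IH] S1; first by rewrite blaschke_nil cabs1 expr1n subrr mulr0.
have a1 : cabs a < 1 by apply: S1; rewrite mem_head.
have S1' : {in S, forall b, cabs b < 1} by move=> b bS; apply: S1; rewrite inE bS orbT.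
have E := mob_cabs_sqr (mob_den a1 (ltW z1)).
have {}E : 1 - cabs (mob a z) ^+ 2 = (1 - cabs z ^+ 2) * bterm a z.
  by rewrite E /bterm; ring.
rewrite blaschke_cons cabsM exprMn /= mulrDr.
rewrite (mulrCA (1 - cabs z ^+ 2) (cabs (mob a z) ^+ 2) (bsum S z)) -(IH S1') -E.
by ring.
Qed.

Lemma bterm_ge0 a z : cabs a < 1 -> 0 <= bterm a z.
Proof.
by move=> a1; rewrite divr_ge0 ?sqr_ge0 // ltW // -cabs_lt1_sqr.
Qed.

Lemma bsum_ge0 S z : {in S, forall a, cabs a < 1} -> 0 <= bsum S z.
Proof.
elim: S => [|a S IH] S1 //=.
rewrite addr_ge0 ?bterm_ge0 ?S1 ?mem_head // mulr_ge0 ?sqr_ge0 //.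
by apply: IH => b bS; apply: S1; rewrite inE bS orbT.
Qed.

(** The term of the first factor suffices, as |1 - conj(a) z| <= 2. This bound, uniform in z, allows
    division by [bsum] up to the circle. *)
Lemma bsum_ge a S z : {in a :: S, forall b, cabs b < 1} -> cabs z < 1 ->
  (1 - cabs a ^+ 2) / 4 <= bsum (a :: S) z.
Proof.
move=> S1 z1 /=; have a1 : cabs a < 1 by apply: S1; rewrite mem_head.
have : 0 <= cabs (mob a z) ^+ 2 * bsum S z.
  by rewrite mulr_ge0 ?sqr_ge0 // bsum_ge0 // => b bS; apply: S1; rewrite inE bS orbT.
have p : 0 < 1 - cabs a ^+ 2 by rewrite -cabs_lt1_sqr.
have dg : 0 < cabs (1 - cconj a * z) by rewrite cabs_gt0 mob_den // ltW.
suff : (1 - cabs a ^+ 2) / 4 <= bterm a z by lra.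
rewrite /bterm ler_pM2l // lef_pV2 ?posrE ?exprn_gt0 //.
have d2 := cabs_den_le a1 (ltW z1).
have : cabs (1 - cconj a * z) ^+ 2 <= 2 ^+ 2 by rewrite ler_pXn2r ?nnegrE // ltW.
by lra.
Qed.

Lemma blaschke_le1 S z : {in S, forall a, cabs a < 1} -> cabs z < 1 ->
  cabs (blaschke S z) <= 1.
Proof.
move=> S1 z1; have := bsumE S1 z1; have := bsum_ge0 z S1 => b0 E.
rewrite -(@expr_le1 _ 2) ?cabs_ge0 //.
have : 0 <= (1 - cabs z ^+ 2) * bsum S z by rewrite mulr_ge0 // ltW // -cabs_lt1_sqr.
by lra.
Qed.

Lemma hol_blaschke S : {in S, forall a, cabs a < 1} -> hol 0 1 (blaschke S).
Proof.
elim: S => [|a S IH] S1.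
  by apply: (hol_eq (f := fun=> 1)) (@hol_cst R 0 1 1) => z _; rewrite blaschke_nil.
apply: (hol_eq (f := fun z => mob a z * blaschke S z)); first by move=> z _; rewrite blaschke_cons.
apply: holM; last by apply: IH => b bS; apply: S1; rewrite inE bS orbT.
by apply: (@hol_mob R a id) (@hol_id R 0 1); apply: S1; rewrite mem_head.
Qed.

(** On the unit circle conj(b) = 1 / b, and z b' / b is the sum of the Poisson kernels [bterm a z].
    Inside the disc the product rule gives the same recursion as for [bsum], with errors that carry
    a factor 1 - |z|^2. *)
Lemma blaschke_boundary_derivative S : {in S, forall a, cabs a < 1} ->
  exists K, forall z, cabs z < 1 ->
    cabs (z * 'D_1 (blaschke S) z * cconj (blaschke S z) - rc (bsum S z))
      <= K * (1 - cabs z ^+ 2).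
Proof.
elim: S => [|a S IH] S1.
  exists 0 => z _.
  have -> : 'D_1 (blaschke [::]) z = 0.
    apply: cderiv_val; apply: cderiv_ext (cderiv_cst 1 z) => w.
    by rewrite blaschke_nil.
  by rewrite mulr0 mul0r subr0 cabs0 mul0r.
have a1 : cabs a < 1 by apply: S1; rewrite mem_head.
have S1' : {in S, forall b, cabs b < 1} by move=> b bS; apply: S1; rewrite inE bS orbT.
have [K HK] := IH S1'.
pose B := (1 - cabs a ^+ 2) / (1 - cabs a) ^+ 2.
have pa : 0 < 1 - cabs a by rewrite subr_gt0.
have pa2 : 0 < 1 - cabs a ^+ 2 by rewrite -cabs_lt1_sqr.
have pM z : cabs z < 1 -> bterm a z <= B.
  move=> z1; have dge := cabs_den_ge a (ltW z1).
  rewrite /bterm /B ler_pM2l // lef_pV2 ?posrE ?exprn_gt0 //; last by lra.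
  by rewrite ler_pXn2r ?nnegrE ?(ltW pa) ?cabs_ge0.
have [M HM] : exists M, forall z, cabs z < 1 -> bsum S z <= M.
  elim: (S) S1' => [|b S' IH'] S1'; first by exists 0.
  have [|M HM] := IH' _; first by move=> x xS; apply: S1'; rewrite inE xS orbT.
  have b1 : cabs b < 1 by apply: S1'; rewrite mem_head.
  have pb : 0 < 1 - cabs b by rewrite subr_gt0.
  have pb2 : 0 < 1 - cabs b ^+ 2 by rewrite -cabs_lt1_sqr.
  exists ((1 - cabs b ^+ 2) / (1 - cabs b) ^+ 2 + M) => z z1 /=; apply: lerD.
    have dge := cabs_den_ge b (ltW z1).
    rewrite /bterm ler_pM2l // lef_pV2 ?posrE ?exprn_gt0 //; last by lra.
    by rewrite ler_pXn2r ?nnegrE ?(ltW pb) ?cabs_ge0.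
  apply: le_trans (HM z z1); rewrite ler_piMl //.
    by apply: bsum_ge0 => x xS; apply: S1'; rewrite inE xS orbT.
  by rewrite expr_le1 ?cabs_ge0 // ltW // mob_lt1.
have B0 : 0 <= B by rewrite divr_ge0 ?ltW // exprn_gt0.
(* One summand per error: the induction hypothesis, the logarithmic derivative of [mob a], and 1 -
   |b|^2. *)
exists (K + B / (1 - cabs a) + B * M) => z z1.
have d0 := mob_den a1 (ltW z1).
have d0' : cconj (1 - cconj a * z) != 0 by rewrite -cabs_eq0 cabs_conj cabs_eq0.
have hb := hol_deriv (hol_blaschke S1') (_ : cabs (z - 0) < 1).
rewrite subr0 in hb; have {}hb := hb z1.
have D : 'D_1 (blaschke (a :: S)) z =
    rc (1 - cabs a ^+ 2) / (1 - cconj a * z) ^+ 2 * blaschke S z + mob a z * 'D_1 (blaschke S) z.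
  apply: cderiv_val; apply: cderiv_ext (cderivM (cderiv_mob d0) hb) => w.
  by rewrite blaschke_cons.
rewrite D /=.
move: (HK z z1); set D' := 'D_1 (blaschke S) z; set b := blaschke S z; set m := mob a z.
set sS := bsum S z; set sa := bterm a z.
set E := z * D' * cconj b - rc sS => KE.
have Em : z * (rc (1 - cabs a ^+ 2) / (1 - cconj a * z) ^+ 2) * cconj m =
    rc sa + rc sa * (rc (cabs z ^+ 2 - 1) / (1 - cconj a * z)).
  have -> : rc sa = rc (1 - cabs a ^+ 2) / ((1 - cconj a * z) * cconj (1 - cconj a * z)).
    by rewrite /sa /bterm rcM rcV cabs_sqrE.
  have -> : rc (cabs z ^+ 2 - 1) = z * cconj z - 1 by rewrite rcD cabs_sqrE rcN rc1.
  rewrite /m /mob cconjM cconjV !cconjB.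
  move: d0'; rewrite cconjB cconjM cconjK cconj1 => d0'.
  by field; rewrite d0 d0'.
rewrite blaschke_cons -/b -/m.
have -> : z * (rc (1 - cabs a ^+ 2) / (1 - cconj a * z) ^+ 2 * b + m * D') * cconj (m * b) -
    rc (sa + cabs m ^+ 2 * sS) =
    rc (cabs m ^+ 2) * E + rc (cabs b ^+ 2) * (rc sa * (rc (cabs z ^+ 2 - 1) / (1 - cconj a * z)))
      + rc sa * rc (cabs b ^+ 2 - 1).
  have -> : z * (rc (1 - cabs a ^+ 2) / (1 - cconj a * z) ^+ 2 * b + m * D') * cconj (m * b) =
     rc (cabs b ^+ 2) * (z * (rc (1 - cabs a ^+ 2) / (1 - cconj a * z) ^+ 2) * cconj m) +
     rc (cabs m ^+ 2) * (z * D' * cconj b).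
    by rewrite !cabs_sqrE cconjM; ring.
  by rewrite Em /E !rcD !rcM rcN rc1; ring.
have z2 : 0 <= 1 - cabs z ^+ 2 by rewrite ltW // -cabs_lt1_sqr.
have m1 : cabs m ^+ 2 <= 1 by rewrite expr_le1 ?cabs_ge0 // ltW // mob_lt1.
have b1 : cabs b ^+ 2 <= 1 by rewrite expr_le1 ?cabs_ge0 // blaschke_le1.
have sa0 : 0 <= sa by exact: bterm_ge0.
have saB : sa <= B by exact: pM.
have sSM : sS <= M by exact: HM.
have sS0 : 0 <= sS by exact: bsum_ge0.
apply: le_trans (cabsD _ _) _; rewrite mulrDl; apply: lerD.
  apply: le_trans (cabsD _ _) _; rewrite mulrDl; apply: lerD.
    rewrite cabsM cabs_rc ger0_norm ?sqr_ge0 //.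
    by apply: le_trans KE; rewrite ler_piMl // cabs_ge0.
  rewrite cabsM cabs_rc ger0_norm ?sqr_ge0 //.
  apply: (@le_trans _ _ (cabs (rc sa * (rc (cabs z ^+ 2 - 1) / (1 - cconj a * z))))).
    by rewrite ler_piMl // cabs_ge0.
  rewrite cabsM cabs_div !cabs_rc (ger0_norm sa0) distrC (ger0_norm z2) -mulrA.
  apply: ler_pM => //; first by rewrite divr_ge0 ?cabs_ge0.
  rewrite mulrC; apply: ler_wpM2r => //.
  rewrite lef_pV2 ?posrE ?cabs_gt0 //.
  exact: cabs_den_ge (ltW z1).
rewrite cabsM !cabs_rc (ger0_norm sa0) distrC.
have := bsumE S1' z1; rewrite -/b -/sS => ->.
rewrite ger0_norm; last by rewrite mulr_ge0.
rewrite -mulrA; apply: ler_pM => //; first by rewrite mulr_ge0.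
by rewrite mulrC; apply: ler_wpM2r.
Qed.

End Blaschke.
(** * Comparison of pulled back hyperbolic metrics *)

Section Rigidity.
Variable R : realType.
Local Notation C := (Cplx R).
Implicit Types (a z w c : C) (s r e t M : R) (f g k l h p q : C -> C) (n : nat) (S : seq C).

Definition disc_map f := hol 0 1 f /\ forall z, cabs z < 1 -> cabs (f z) < 1.

Lemma hol0_deriv f z : hol 0 1 f -> cabs z < 1 -> cderiv f z ('D_1 f z).
Proof. by move=> hf z1; apply: hol_deriv hf _; rewrite subr0. Qed.

Lemma hol0_cont f z : hol 0 1 f -> cabs z < 1 -> ccont f z.
Proof. by move=> hf z1; apply: hol_cont hf _; rewrite subr0. Qed.

Lemma one_sub_sqr_gt0 z : cabs z < 1 -> 0 < 1 - cabs z ^+ 2.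
Proof. by rewrite cabs_lt1_sqr. Qed.

(* The modulus of hyp f is the ratio of the hyperbolic metric pulled back by f
   to the hyperbolic metric. *)
Definition hyp f z : C := 'D_1 f z * rc (1 - cabs z ^+ 2) / rc (1 - cabs (f z) ^+ 2).

Lemma bdry1M f g : bdry1 f -> bdry1 g -> bdry1 (fun z => f z * g z).
Proof.
move=> bf bg e e0.
pose d := Num.min (1 / 2) (e / 4).
have d0 : 0 < d by rewrite /d lt_min !divr_gt0.
have d1 : d <= 1 / 2 by rewrite /d ge_min lexx.
have d2 : d <= e / 4 by rewrite /d ge_min lexx orbT.
have [r1 /andP[r10 r11] H1] := bf _ d0; have [r2 /andP[r20 r21] H2] := bg _ d0.
exists (Num.max r1 r2); first by rewrite le_max r10 gt_max r11.
move=> z /andP[]; rewrite gt_max => /andP[z1 z2] z3.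
have := H1 z; rewrite z1 z3 => /(_ isT); have := H2 z; rewrite z2 z3 => /(_ isT).
rewrite cabsM; set x := cabs (f z); set y := cabs (g z) => Hy Hx.
have -> : x * y - 1 = (x - 1) * (y - 1) + (x - 1) + (y - 1) by ring.
apply: le_lt_trans (ler_normD _ _) _.
have := ler_normD ((x - 1) * (y - 1)) (x - 1); rewrite normrM.
have : `|x - 1| * `|y - 1| <= `|x - 1| * 1 by apply: ler_wpM2l => //; lra.
by lra.
Qed.

Lemma bdry1_conj f : bdry1 f -> bdry1 (fun z => cconj (f z)).
Proof.
by move=> bf e /bf[r r01 Hr]; exists r => // z /Hr; rewrite cabs_conj.
Qed.

Lemma bdry1_id : bdry1 (id : C -> C).
Proof.
move=> e e0; exists (Num.max 0 (1 - e)); first by rewrite le_max lexx gt_max ltr01; lra.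
move=> z; rewrite gt_max => /andP[/andP[_ h1] h2].
by rewrite ltr_norml; apply/andP; split; lra.
Qed.

(** With f = u b, [bsumE] cancels the factor 1 - |z|^2, and z conj(b) [hyp f] becomes u z b' conj(b)
    / [bsum], whose modulus tends to 1; so does that of z conj(b). *)
Lemma bdry1_hyp f : disc_map f -> bdry1 f -> bdry1 (hyp f).
Proof.
move=> [hf f1] bf.
have [S [u [S1 u1 E]]] := blaschke_product hf bf.
(* An empty product would give |f 0| = 1. *)
have [a [S' SE]] : exists a S', S = a :: S'.
  case: S E {S1} => [|a S'] E; last by exists a, S'.
  have z0 : cabs (0 : C) < 1 by rewrite cabs0.
  by have := f1 0 z0; rewrite E // blaschke_nil mulr1 u1 ltxx.
have a1 : cabs a < 1 by apply: S1; rewrite SE mem_head.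
pose s0 := (1 - cabs a ^+ 2) / 4.
have s00 : 0 < s0 by rewrite divr_gt0 ?one_sub_sqr_gt0.
have sge z : cabs z < 1 -> s0 <= bsum S z.
  by move=> z1; rewrite SE; apply: bsum_ge => //; rewrite -SE.
have [K HK] := blaschke_boundary_derivative S1.
pose b := blaschke S.
have D z : cabs z < 1 -> 'D_1 f z = u * 'D_1 b z.
  move=> z1; have hb := hol0_deriv (hol_blaschke S1) z1.
  rewrite (derive_eq_on (f := fun z => u * b z) (c := 0) (r := 1)).
  - exact: cderiv_val (cderivZ u hb).
  - by move=> w; rewrite subr0 => /E.
  - by apply: holM; [exact: hol_cst | exact: hol_blaschke].
  - by rewrite subr0.
have Eb z : cabs z < 1 -> cabs (f z) = cabs (b z) by move=> /E ->; rewrite cabsM u1 mul1r.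
apply: (@bdry1_div R (fun z => u * (z * 'D_1 b z * cconj (b z)) / rc (bsum S z))
  (fun z => z * cconj (b z))).
- move=> e e0.
  pose L := 1 + `|K|.
  have L0 : 0 < L by rewrite ltr_wpDr.
  pose r := Num.max 0 (1 - e * s0 / (2 * L)).
  have q0 : 0 < e * s0 / (2 * L) by rewrite divr_gt0 // mulr_gt0.
  exists r; first by rewrite /r le_max lexx gt_max ltr01; lra.
  move=> z; rewrite /r gt_max => /andP[/andP[_ zr] z1].
  have := HK z z1; have := sge z z1; rewrite -/b.
  rewrite cabs_div cabsM u1 mul1r.
  set X := _ * cconj (b z); set s := bsum S z => ss KX.
  have sp : 0 < s by lra.
  rewrite cabs_rc (ger0_norm (ltW sp)).
  have -> : cabs X / s - 1 = (cabs X - s) / s by field; rewrite gt_eqF.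
  rewrite normrM normfV (ger0_norm (ltW sp)) ltr_pdivrMr //.
  have cs : cabs (rc s) = s by rewrite cabs_rc ger0_norm // ltW.
  have h1 := cabs_sub X (rc s); have h2 := cabs_sub (rc s) X.
  rewrite cabsC cs in h2; rewrite cs in h1.
  apply: (@le_lt_trans _ _ (K * (1 - cabs z ^+ 2))).
    by rewrite ler_norml; apply/andP; split; lra.
  have z2 := one_sub_sqr_gt0 z1.
  apply: (@le_lt_trans _ _ (L * (1 - cabs z ^+ 2))).
    apply: ler_wpM2r; first exact: ltW.
    by have := ler_norm K; rewrite /L; lra.
  apply: (@lt_le_trans _ _ (e * s0)); last by rewrite ler_pM2l.
  have : 1 - cabs z ^+ 2 < e * s0 / L.
    have : e * s0 / L = 2 * (e * s0 / (2 * L)) by field; rewrite gt_eqF.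
    by have := sqr_ge0 (1 - cabs z); lra.
  by rewrite ltr_pdivlMr // mulrC.
- apply: bdry1M bdry1_id _; apply: bdry1_conj.
  move=> e /bf[r r01 Hr]; exists r => // z zr; rewrite -Eb; first exact: Hr.
  by case/andP: zr.
- move=> z z1; rewrite /hyp D // Eb // /b bsumE // -/b.
  have z2 : rc (1 - cabs z ^+ 2) != 0 by rewrite rc_eq0 gt_eqF // one_sub_sqr_gt0.
  have s2 : rc (bsum S z) != 0 by rewrite rc_eq0 gt_eqF //; have := sge z z1; lra.
  rewrite rcM; move: z2 s2; generalize (rc (1 - cabs z ^+ 2)) (rc (bsum S z)) => A B A0 B0.
  by field; rewrite A0 B0.
Qed.

Lemma hyp_nonconstant f : bdry1 (hyp f) -> exists2 z, cabs z < 1 & 'D_1 f z != 0.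
Proof.
move=> /(_ (1 / 2))[]; first by rewrite divr_gt0.
move=> r /andP[r0 r1] Hr; pose z : C := rc ((1 + r) / 2).
have zE : cabs z = (1 + r) / 2 by rewrite cabs_rc ger0_norm //; lra.
exists z; first by rewrite zE; lra.
apply/eqP => D; have := Hr z; rewrite /hyp D zE !mul0r cabs0 sub0r normrN normr1.
have -> : r < (1 + r) / 2 < 1 by apply/andP; split; lra.
by move=> /(_ isT); lra.
Qed.

Lemma ccont_punctured_eq p q a t : 0 < t -> ccont p a -> ccont q a ->
  (forall z, z != a -> cabs (z - a) < t -> p z = q z) -> p a = q a.
Proof.
move=> t0 cp cq E; apply/eqP; rewrite -subr_eq0; apply/negPn/negP => pq.
have [t' t'0 Ht'] := ccont_neq0 (ccontB cp cq) pq.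
pose m := Num.min t t'.
have m0 : 0 < m by rewrite /m lt_min t0.
pose z := a + rc (m / 2).
have za : z - a = rc (m / 2) by rewrite /z addrAC subrr add0r.
have zm : cabs (z - a) = m / 2 by rewrite za cabs_rc ger0_norm //; lra.
have mt : m <= t by rewrite /m ge_min lexx.
have mt' : m <= t' by rewrite /m ge_min lexx orbT.
have zt' : cabs (z - a) < t' by lra.
have zt : cabs (z - a) < t by lra.
have zna : z != a by rewrite -subr_eq0 -cabs_gt0 zm; lra.
by have := Ht' z zt'; rewrite E // subrr eqxx.
Qed.

Lemma vanishing_le p q a t m n : 0 < t -> ccont p a -> ccont q a -> p a != 0 ->
  (forall z, z != a -> cabs (z - a) < t -> (z - a) ^+ m * p z = (z - a) ^+ n * q z) ->
  (n <= m)%N.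
Proof.
move=> t0 cp cq pa E; rewrite leqNgt; apply/negP => mn.
have cX : ccont (fun z => (z - a) ^+ (n - m) * q z) a.
  by apply: ccontM cq; apply: ccontX; apply: ccontB (ccont_id _) (ccont_cst _ _).
have := ccont_punctured_eq t0 cp cX.
rewrite subrr expr0n subn_eq0 leqNgt mn mul0r => H.
move: pa; rewrite H ?eqxx // => z za zt.
apply: (mulfI (_ : (z - a) ^+ m != 0)); first by rewrite expf_neq0 // subr_eq0.
by rewrite E // mulrA -exprD subnKC // ltnW.
Qed.

Lemma vanishing_eq p q a t m n : 0 < t -> ccont p a -> ccont q a ->
  p a != 0 -> q a != 0 ->
  (forall z, z != a -> cabs (z - a) < t -> (z - a) ^+ m * p z = (z - a) ^+ n * q z) ->
  m = n /\ p a = q a.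
Proof.
move=> t0 cp cq pa qa E.
have mn : m = n.
  apply/eqP; rewrite eqn_leq (vanishing_le t0 cp cq pa E) andbT.
  by apply: (vanishing_le t0 cq cp qa) => z za zt; rewrite E.
split=> //; apply: (ccont_punctured_eq t0 cp cq) => z za zt.
apply: (mulfI (_ : (z - a) ^+ m != 0)); first by rewrite expf_neq0 // subr_eq0.
by rewrite E // mn.
Qed.

Lemma derive_power f a l n : hol 0 1 l -> (forall z, cabs z < 1 -> f z = (z - a) ^+ n.+1 * l z) ->
  forall z, cabs z < 1 -> 'D_1 f z = (z - a) ^+ n * (n.+1%:R * l z + (z - a) * 'D_1 l z).
Proof.
move=> hl E z z1.
have hX : hol 0 1 (fun z => (z - a) ^+ n.+1 * l z).
  by apply: holM => //; apply: holX; apply: holB; [exact: hol_id | exact: hol_cst].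
rewrite (derive_eq_on (f := fun z => (z - a) ^+ n.+1 * l z) (c := 0) (r := 1)) ?subr0 //; last first.
  by move=> w; rewrite subr0 => /E.
have dz := cderivX n.+1 (cderivB (cderiv_id z) (cderiv_cst a z)).
rewrite (cderiv_val (cderivM dz (hol0_deriv hl z1))) /= exprS.
set X := (z - a) ^+ n; set D := 'D_1 l z.
by ring.
Qed.

Lemma derive_power_cont a l n : cabs a < 1 -> hol 0 1 l ->
  ccont (fun z => n.+1%:R * l z + (z - a) * 'D_1 l z) a.
Proof.
move=> a1 hl; apply: ccontD; apply: ccontM.
- exact: ccont_cst.
- exact: hol0_cont.
- by apply: ccontB (ccont_id _) (ccont_cst _ _).
- by apply: hol0_cont a1; exact: hol_derive.
Qed.

Lemma derive_power_at a l n : n.+1%:R * l a + (a - a) * 'D_1 l a = n.+1%:R * l a.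
Proof. by rewrite (subrr a) (mul0r ('D_1 l a)) addr0. Qed.

(** The orders of f and g at [a] exceed those of f' and g' by one, and the latter agree because h
    has no zeros. Comparing leading coefficients of f' = h g' gives l a = h a * k a. *)
Lemma vanishing_quotient f g h a : hol 0 1 f -> hol 0 1 g -> hol 0 1 h ->
  cabs a < 1 -> f a = 0 -> g a = 0 -> (forall z, cabs z < 1 -> h z != 0) ->
  (exists2 z, cabs z < 1 & 'D_1 g z != 0) ->
  (forall z, cabs z < 1 -> 'D_1 f z = h z * 'D_1 g z) ->
  exists n k l, [/\ hol 0 1 k, hol 0 1 l, k a != 0 & l a = h a * k a] /\
    forall z, cabs z < 1 -> f z = (z - a) ^+ n * l z /\ g z = (z - a) ^+ n * k z.
Proof.
move=> hf hg hh a1 fa ga h0 [z0 z01 g'z0] E.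
have ha := h0 a a1.
have vanish p : hol 0 1 p -> p a = 0 -> (exists2 z, cabs z < 1 & 'D_1 p z != 0) ->
    exists n l, [/\ hol 0 1 l, l a != 0 & forall z, cabs z < 1 -> p z = (z - a) ^+ n.+1 * l z].
  move=> hp pa [w w1 p'w]; have [p0|[n [l [hl la pE]]]] := zero_order hp a1.
    case/eqP: p'w; rewrite (derive_eq_on (f := fun=> 0) (c := 0) (r := 1)).
    - exact: cderiv_val (cderiv_cst 0 w).
    - by move=> x; rewrite subr0 => /p0.
    - exact: hol_cst.
    - by rewrite subr0.
  case: n pE => [|n] pE; last by exists n, l.
  by move: la; rewrite -[l a]mul1r -(expr0 (a - a)) -pE // pa eqxx.
have [n [k [hk ka gE]]] := vanish g hg ga (ex_intro2 _ _ z0 z01 g'z0).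
have [|m [l [hl la fE]]] := vanish f hf fa.
  by exists z0; rewrite ?E //; exact: (mulf_neq0 (h0 _ z01) g'z0).
have [||||||mn lk] := @vanishing_eq (fun z => m.+1%:R * l z + (z - a) * 'D_1 l z)
   (fun z => h z * (n.+1%:R * k z + (z - a) * 'D_1 k z)) a (1 - cabs a) m n.
- by rewrite subr_gt0.
- exact: derive_power_cont.
- by apply: ccontM; [exact: hol0_cont | exact: derive_power_cont].
- by rewrite derive_power_at mulf_neq0 // pnatr_eq0.
- by rewrite derive_power_at !mulf_neq0 // pnatr_eq0.
- move=> z za zt; have z1 : cabs z < 1 by have := cabs_sub z a; lra.
  by rewrite -(derive_power hl fE) // mulrCA -(derive_power hk gE) // E.
exists n.+1, k, l; split; last by move=> z z1; rewrite -mn fE // mn gE.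
split=> //; move: lk; rewrite !derive_power_at mn mulrCA.
by move=> /(mulfI _) -> //; rewrite pnatr_eq0.
Qed.

End Rigidity.

(** * The quotient of the derivatives and its rigidity *)

Section Uniqueness.
Variable R : realType.
Local Notation C := (Cplx R).
Implicit Types (a z w c : C) (s r e t M : R) (f g k l h p q : C -> C) (n : nat).

(** Near c, f' = (z - c)^m l and g' = (z - c)^m k with the same m, so l / k is a local quotient
    without zero at c. Local quotients agree wherever g' != 0, in particular on a punctured
    neighbourhood of each centre. *)
Lemma critical_quotient f g : hol 0 1 f -> hol 0 1 g ->
  (exists2 z, cabs z < 1 & 'D_1 g z != 0) ->
  same_critical_points (unit_disc R) f g ->
  exists h, [/\ hol 0 1 h, forall z, cabs z < 1 -> h z != 0 &
    forall z, cabs z < 1 -> 'D_1 f z = h z * 'D_1 g z].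
Proof.
move=> hf hg [z0 z01 g'z0] [crit mult].
have hf' := hol_derive hf; have hg' := hol_derive hg.
have loc c : exists q, cabs c < 1 -> q c != 0 /\ exists2 t, 0 < t &
    (forall z, cabs (z - c) < t -> exists d, cderiv q z d) /\
    (forall z, cabs (z - c) < t -> 'D_1 f z = q z * 'D_1 g z /\ (z != c -> 'D_1 g z != 0)).
  have [c1|c1] := ltP (cabs c) 1; last by exists id.
  have pc : 0 < 1 - cabs c by rewrite subr_gt0.
  have inD z : cabs (z - c) < 1 - cabs c -> cabs z < 1 by have := cabs_sub z c; lra.
  have [g'0|[m [k [hk kc gE]]]] := zero_order hg' c1.
    by move: g'z0; rewrite g'0 // eqxx.
  have [t1 t10 Ht1] := ccont_neq0 (hol0_cont hk c1) kc.
  have [l [t2 t20 [lc Hl El]]] : exists l, exists2 t, 0 < t & [/\ l c != 0,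
      (forall z, cabs (z - c) < t -> exists d, cderiv l z d) &
      (forall z, cabs (z - c) < t -> 'D_1 f z = (z - c) ^+ m * l z)].
    have cD : unit_disc R c by exact/unit_discE.
    (* Multiplicities are compared only at critical points; elsewhere m = 0, and f' itself serves as
       [l]. *)
    have [g'c|g'c] := eqVneq ('D_1 g c) 0.
      have f'c : critical_point f c by apply/(crit c cD).
      have : critical_multiplicity f c m.
        apply/(mult c cD f'c); exists k; split => //.
          apply/nearCP; exists (1 - cabs c) => // z /inD z1; apply/derivable_cderiv.
          by apply: hk; rewrite subr0.
        by apply/nearCP; exists (1 - cabs c) => // z /inD; exact: gE.
      move=> [l [/nearCP[e1 e10 H1] lc /nearCP[e2 e20 H2]]].
      exists l, (Num.min e1 e2); first by rewrite lt_min e10.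
      split=> // z; rewrite lt_min => /andP[ze1 ze2]; last exact: H2.
      exact/derivable_cderiv/H1.
    have m0 : m = 0%N.
      apply/eqP; rewrite -leqn0 leqNgt; apply/negP => m0.
      by move: g'c; rewrite gE // subrr expr0n gtn_eqF // mul0r eqxx.
    exists ('D_1 f), (1 - cabs c); first exact: pc.
    split.
    - have /eqP g'n := g'c; apply/eqP => f'c; apply: g'n.
      exact: (proj1 (crit c cD) f'c).
    - by move=> z /inD z1; apply: hf'; rewrite subr0.
    - by move=> z _; rewrite m0 expr0 mul1r.
  exists (fun z => l z / k z) => _; split.
    by rewrite mulf_neq0 // invr_neq0.
  exists (Num.min (1 - cabs c) (Num.min t1 t2)); first by rewrite !lt_min pc t10.
  split=> z; rewrite !lt_min => /and3P[/inD zc /Ht1 kz zt2].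
    have [d Hd] := Hl z zt2; have Hk := hol0_deriv hk zc.
    by eexists; exact: (@cderiv_div _ l k _ _ _ kz Hd Hk).
  rewrite (El z zt2) (gE z zc); split; first by field.
  by move=> zc'; rewrite mulf_neq0 // expf_neq0 // subr_eq0.
have [Q HQ] := choice loc.
(* Each local quotient is evaluated at its own centre; near c this coincides with [Q c], so [h]
   inherits the derivative of [Q c] at c. *)
pose h z := Q z z.
exists h; split.
- move=> c; rewrite subr0 => c1.
  have [_ [t t0 [dQ EQ]]] := HQ c c1.
  have [|d Hd] := dQ c; first by rewrite subrr cabs0.
  exists d; apply: (cderiv_near (e := Num.min t (1 - cabs c))) Hd.
    by rewrite lt_min t0 subr_gt0.
  move=> z; rewrite lt_min => /andP[zt zc].
  have z1 : cabs z < 1 by have := cabs_sub z c; lra.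
  have [->//|zc'] := eqVneq z c.
  have [Ec /(_ zc') g'z] := EQ z zt.
  have [_ [t' t'0 [_ EQ']]] := HQ z z1.
  have [|Ez _] := EQ' z; first by rewrite subrr cabs0.
  by apply: (mulIf g'z); rewrite -Ec -Ez.
- by move=> z z1; have [] := HQ z z1.
- move=> z z1; have [_ [t t0 [_ EQ]]] := HQ z z1.
  by have [|] := EQ z; first by rewrite subrr cabs0.
Qed.

Lemma cabs_hyp_quotient f g h z : disc_map f -> disc_map g ->
  cabs z < 1 -> 'D_1 f z = h z * 'D_1 g z ->
  hyp f z = hyp g z * (h z * rc (1 - cabs (g z) ^+ 2) / rc (1 - cabs (f z) ^+ 2)).
Proof.
move=> [hf f1] [hg g1] z1 E; rewrite /hyp E.
have A0 : rc (1 - cabs (f z) ^+ 2) != 0 by rewrite rc_eq0 gt_eqF // one_sub_sqr_gt0 ?f1.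
have B0 : rc (1 - cabs (g z) ^+ 2) != 0 by rewrite rc_eq0 gt_eqF // one_sub_sqr_gt0 ?g1.
move: A0 B0; generalize (rc (1 - cabs (f z) ^+ 2)) (rc (1 - cabs (g z) ^+ 2)) ('D_1 g z : C).
by move=> A B D A0 B0; field; rewrite A0 B0.
Qed.

(* Post-composing f and g by automorphisms moves their values at z0 to the
   origin, and leaves |h| (1 - |g|^2) / (1 - |f|^2) unchanged. *)
Lemma normalize f g h z0 : disc_map f -> disc_map g -> hol 0 1 h ->
  (forall z, cabs z < 1 -> h z != 0) ->
  (forall z, cabs z < 1 -> 'D_1 f z = h z * 'D_1 g z) -> cabs z0 < 1 ->
  exists h1, [/\ hol 0 1 h1, forall z, cabs z < 1 -> h1 z != 0,
   (forall z, cabs z < 1 -> 'D_1 (fun z => mob (f z0) (f z)) z =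
       h1 z * 'D_1 (fun z => mob (g z0) (g z)) z) &
   forall z, cabs z < 1 ->
     cabs (h1 z) * (1 - cabs (mob (g z0) (g z)) ^+ 2) / (1 - cabs (mob (f z0) (f z)) ^+ 2) =
     cabs (h z) * (1 - cabs (g z) ^+ 2) / (1 - cabs (f z) ^+ 2)].
Proof.
move=> [hf f1] [hg g1] hh h0 E z01.
pose A : C := rc (1 - cabs (f z0) ^+ 2); pose B : C := rc (1 - cabs (g z0) ^+ 2).
have a1 := f1 _ z01; have b1 := g1 _ z01.
have A0 : A != 0 by rewrite rc_eq0 gt_eqF // one_sub_sqr_gt0.
have B0 : B != 0 by rewrite rc_eq0 gt_eqF // one_sub_sqr_gt0.
pose u z := 1 - cconj (f z0) * f z; pose v z := 1 - cconj (g z0) * g z.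
have u0 z : cabs z < 1 -> u z != 0 by move=> z1; apply: mob_den => //; exact/ltW/f1.
have v0 z : cabs z < 1 -> v z != 0 by move=> z1; apply: mob_den => //; exact/ltW/g1.
have hu : hol 0 1 u by apply: holB; [exact: hol_cst | apply: holM => //; exact: hol_cst].
have hv : hol 0 1 v by apply: holB; [exact: hol_cst | apply: holM => //; exact: hol_cst].
(* The chain rule multiplies f' by A / u^2 and g' by B / v^2. *)
pose h1 z := h z * (A / B) * (v z ^+ 2 * (u z ^+ 2)^-1).
have dmob k a z : hol 0 1 k -> cabs z < 1 -> 1 - cconj a * k z != 0 ->
    'D_1 (fun z => mob a (k z)) z = rc (1 - cabs a ^+ 2) / (1 - cconj a * k z) ^+ 2 * 'D_1 k z.
  move=> hk z1 d0; apply: cderiv_val.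
  exact: cderiv_comp (hol0_deriv hk z1) (cderiv_mob d0).
exists h1; split.
- apply: holM; first by apply: holM => //; exact: hol_cst.
  apply: holM; first exact: holX.
  apply: holV; last exact: holX.
  by move=> z; rewrite subr0 => /u0; exact: expf_neq0.
- move=> z z1; have h0z := h0 z z1; have u0z := u0 z z1; have v0z := v0 z z1.
  by rewrite /h1 !mulf_neq0 ?invr_neq0 ?expf_neq0 ?mulf_neq0.
- move=> z z1; have u0z := u0 z z1; have v0z := v0 z z1.
  rewrite !dmob // E // -/A -/B -/(u z) -/(v z) /h1.
  move: A0 B0; generalize A B ('D_1 g z : C) => A' B' D A0' B0'.
  by field; rewrite u0z v0z B0'.
- move=> z z1; have u0z := u0 z z1; have v0z := v0 z z1.
  rewrite !mob_cabs_sqr // -/(u z) -/(v z) /h1 !cabsM cabsV cabsV !cabsX.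
  have An : cabs A = 1 - cabs (f z0) ^+ 2 by rewrite cabs_rc ger0_norm // ltW // one_sub_sqr_gt0.
  have Bn : cabs B = 1 - cabs (g z0) ^+ 2 by rewrite cabs_rc ger0_norm // ltW // one_sub_sqr_gt0.
  rewrite An Bn.
  have p1 : 1 - cabs (f z0) ^+ 2 != 0 by rewrite gt_eqF // one_sub_sqr_gt0.
  have p2 : 1 - cabs (g z0) ^+ 2 != 0 by rewrite gt_eqF // one_sub_sqr_gt0.
  have p3 : 1 - cabs (f z) ^+ 2 != 0 by rewrite gt_eqF // one_sub_sqr_gt0 // f1.
  have p4 : cabs (u z) != 0 by rewrite cabs_eq0.
  have p5 : cabs (v z) != 0 by rewrite cabs_eq0.
  by field; rewrite p1 p2 p3 p4 p5.
Qed.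

Lemma disc_map_mob f a : disc_map f -> cabs a < 1 -> disc_map (fun z => mob a (f z)).
Proof.
move=> [hf f1] a1; split; last by move=> z z1; apply: mob_lt1 => //; exact: f1.
move=> z; rewrite subr0 => z1; eexists.
apply: cderiv_comp (hol0_deriv hf z1) (cderiv_mob _).
by apply: mob_den => //; exact/ltW/f1.
Qed.

Lemma nonconstant_mob f a : disc_map f -> cabs a < 1 ->
  (exists2 z, cabs z < 1 & 'D_1 f z != 0) ->
  exists2 z, cabs z < 1 & 'D_1 (fun z => mob a (f z)) z != 0.
Proof.
move=> [hf f1] a1 [z z1 Dz]; exists z; first exact: z1.
have d0 : 1 - cconj a * f z != 0 by apply: mob_den => //; exact/ltW/f1.
rewrite (cderiv_val (cderiv_comp (hol0_deriv hf z1) (cderiv_mob d0))).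
apply: (mulf_neq0 _ Dz); apply: mulf_neq0; last by rewrite invr_neq0 // expf_neq0.
by rewrite rc_eq0 gt_eqF // one_sub_sqr_gt0.
Qed.

(* At a maximum z0 of |h| (1 - |g|^2) / (1 - |f|^2) with value above 1,
   normalize to f z0 = g z0 = 0: then f / g tends to h z0, so |f| >= |g| near z0
   and |h| has a strict local maximum at z0. *)
Lemma no_interior_maximum f g h z0 : disc_map f -> disc_map g -> hol 0 1 h ->
  (forall z, cabs z < 1 -> h z != 0) ->
  (forall z, cabs z < 1 -> 'D_1 f z = h z * 'D_1 g z) -> cabs z0 < 1 ->
  (exists2 z, cabs z < 1 & 'D_1 g z != 0) ->
  f z0 = 0 -> g z0 = 0 -> 1 < cabs (h z0) ->
  ~ (forall z, cabs z < 1 ->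
       cabs (h z) * (1 - cabs (g z) ^+ 2) / (1 - cabs (f z) ^+ 2) <= cabs (h z0)).
Proof.
move=> [hf f1] [hg g1] hh h0 E z01 ncg fz0 gz0 hz0 max.
have [n [k [l [[hk hl kz0 lz0] fg]]]] := vanishing_quotient hf hg hh z01 fz0 gz0 h0 ncg E.
have hz0' := h0 z0 z01.
(* At z0, |l| - |k| equals (|h z0| - 1) |k z0|; each of [k] and [l] may use up half of it. *)
have gap : 0 < (cabs (h z0) - 1) * cabs (k z0) / 2.
  by rewrite divr_gt0 // mulr_gt0 ?cabs_gt0 // subr_gt0.
have [t1 t10 H1] := hol0_cont hk z01 gap; have [t2 t20 H2] := hol0_cont hl z01 gap.
have strict z : cabs (z - z0) < Num.min (1 - cabs z0) (Num.min t1 t2) -> z != z0 ->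
    cabs (h z) < cabs (h z0).
  rewrite !lt_min => /and3P[zz0 /H1 kz /H2 lz] zn.
  have z1 : cabs z < 1 by have := cabs_sub z z0; lra.
  have kl : cabs (k z) < cabs (l z).
    have h3 := cabs_sub (k z) (k z0); have h4 := cabs_sub (l z0) (l z).
    rewrite cabsC in h4.
    have h5 : cabs (l z0) = cabs (h z0) * cabs (k z0) by rewrite lz0 cabsM.
    by lra.
  have [fE gE] := fg z z1.
  have zp : 0 < cabs ((z - z0) ^+ n) by rewrite cabs_gt0 expf_neq0 // subr_eq0.
  have gf : cabs (g z) < cabs (f z) by rewrite fE gE !cabsM ltr_pM2l.
  have q2 : cabs (g z) ^+ 2 < cabs (f z) ^+ 2.
    by rewrite ltr_pXn2r ?nnegrE ?cabs_ge0.
  have p1 := one_sub_sqr_gt0 (f1 z z1); have p2 := one_sub_sqr_gt0 (g1 z z1).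
  have := max z z1; rewrite ler_pdivrMr // => K.
  rewrite -(ltr_pM2r p2); apply: le_lt_trans K _.
  by rewrite ltr_pM2l; lra.
(* A constant h contradicts strictness; otherwise [power_direction] produces points near z0 with |h|
   > |h z0|. *)
have [hc|[m [q [hq qz0 qE]]]] := zero_order (holB hh (@hol_cst R 0 1 (h z0))) z01.
  have [|w wz wE] := @avoid_seq R [:: z0] z0 (Num.min (1 - cabs z0) (Num.min t1 t2)).
    by rewrite !lt_min subr_gt0 z01 t10.
  have w1 : cabs w < 1.
    by move: wz; rewrite lt_min => /andP[wz _]; have := cabs_sub w z0; lra.
  have := strict w wz; rewrite inE in wE; move/(_ wE).
  by have /eqP := hc w w1; rewrite subr_eq0 => /eqP ->; rewrite ltxx.
case: m qE => [|m] qE.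
  have := qE z0 z01; rewrite subrr expr0 mul1r => q0.
  by rewrite -q0 eqxx in qz0.
have [t t0 Ht] := power_direction (n := m.+1) isT (hol0_cont hq z01) qz0 hz0'.
pose T := Num.min t (Num.min (1 - cabs z0) (Num.min t1 t2)).
have T0 : 0 < T by rewrite /T !lt_min t0 subr_gt0 z01 t10.
have Tt : T <= t by rewrite /T ge_min lexx.
have [|z zr] := Ht (T / 2); first by apply/andP; split; lra.
have zT : cabs (z - z0) < Num.min (1 - cabs z0) (Num.min t1 t2).
  rewrite zr; apply: (@lt_le_trans _ _ T); first by lra.
  by rewrite /T ge_min lexx orbT.
have z1 : cabs z < 1.
  by move: zT; rewrite lt_min => /andP[wz _]; have := cabs_sub z z0; lra.
rewrite -qE // mulrBr cReB.
rewrite [cconj _ * h z0]mulrC mul_cconj cRe_rc => K.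
have := le_trans (ler_norm _) (cRe_le (cconj (h z0) * h z)); rewrite cabsM cabs_conj => K2.
have K3 : 0 < cabs (h z0) * (T / 2) ^+ m.+1 * cabs (q z0).
  by rewrite !mulr_gt0 ?exprn_gt0 ?cabs_gt0 ?divr_gt0.
have zn : z != z0 by rewrite -subr_eq0 -cabs_gt0 zr; lra.
have := strict z zT zn.
have hp : 0 < cabs (h z0) by rewrite cabs_gt0.
by rewrite -(ltr_pM2l hp); lra.
Qed.

Lemma hyp_quotient_le1 f g h : disc_map f -> disc_map g -> hol 0 1 h ->
  bdry1 (hyp f) -> bdry1 (hyp g) ->
  (forall z, cabs z < 1 -> h z != 0) ->
  (forall z, cabs z < 1 -> 'D_1 f z = h z * 'D_1 g z) ->
  forall z, cabs z < 1 -> cabs (h z) * (1 - cabs (g z) ^+ 2) <= 1 - cabs (f z) ^+ 2.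
Proof.
move=> df dg hh bf bg h0 E p p1.
have [hf f1] := df; have [hg g1] := dg.
pose u z := cabs (h z) * (1 - cabs (g z) ^+ 2) / (1 - cabs (f z) ^+ 2).
suff : u p <= 1 by rewrite /u ler_pdivrMr ?mul1r // one_sub_sqr_gt0 // f1.
rewrite leNgt; apply/negP => up.
have bu : bdry1 (fun z => h z * rc (1 - cabs (g z) ^+ 2) / rc (1 - cabs (f z) ^+ 2)).
  by apply: (bdry1_div bf bg) => z z1; apply: cabs_hyp_quotient => //; exact: E.
have uE z : cabs z < 1 -> cabs (h z * rc (1 - cabs (g z) ^+ 2) / rc (1 - cabs (f z) ^+ 2)) = u z.
  move=> z1; have p1' := one_sub_sqr_gt0 (f1 z z1); have p2 := one_sub_sqr_gt0 (g1 z z1).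
  by rewrite cabs_div cabsM !cabs_rc !ger0_norm // ltW.
have up0 : 0 < u p - 1 by rewrite subr_gt0.
(* With tolerance u p - 1, [u] stays below [u p] beyond radius r, so its maximum on |z| <= s is a
   maximum over the whole disc. *)
have [r /andP[r0 r1] Hr] := bu _ up0.
pose s := Num.max r (cabs p).
have s1 : s < 1 by rewrite /s gt_max r1.
have s0 : 0 <= s by rewrite /s le_max r0.
have cu z : cabs (z - 0) <= s -> rcont u z.
  rewrite subr0 => zs; have z1 : cabs z < 1 by lra.
  have p3 := one_sub_sqr_gt0 (f1 z z1).
  have cc k : disc_map k -> ccont (fun z => 1 - k z * cconj (k z)) z.
    move=> [hk _]; apply: ccontB (ccont_cst _ _) _; apply: ccontM; first exact: hol0_cont.
    move=> e e0; have [t t0 Ht] := hol0_cont hk z1 e0; exists t => // w wt.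
    by rewrite -cconjB cabs_conj; exact: Ht.
  have kE k w : rc (1 - cabs (k w) ^+ 2) = 1 - k w * cconj (k w).
    by rewrite rcD rcN cabs_sqrE rc1.
  have cU : ccont (fun z => h z * rc (1 - cabs (g z) ^+ 2) / rc (1 - cabs (f z) ^+ 2)) z.
    under eq_fun do rewrite (kE g) (kE f).
    apply: ccontM; first by apply: ccontM; [exact: hol0_cont | exact: cc].
    apply: ccontV; last exact: cc.
    by rewrite -kE rc_eq0 gt_eqF.
  move=> e e0; have [t t0 Ht] := rcont_cabs cU e0.
  exists (Num.min t (1 - cabs z)); first by rewrite lt_min t0 subr_gt0.
  move=> w; rewrite lt_min => /andP[/Ht + wz].
  by rewrite !uE //; have := cabs_sub w z; lra.
have [z0 z0s Hz0] := cdisc_max s0 cu.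
rewrite subr0 in z0s.
have z01 : cabs z0 < 1 by lra.
have ps : cabs (p - 0) <= s by rewrite subr0 /s le_max lexx orbT.
have uz0 : u p <= u z0 by exact: Hz0.
have umax z : cabs z < 1 -> u z <= u z0.
  move=> z1; have [zs|sz] := leP (cabs z) s; first by apply: Hz0; rewrite subr0.
  have rz : r < cabs z by apply: le_lt_trans sz; rewrite /s le_max lexx.
  have := Hr z; rewrite rz z1 => /(_ isT); rewrite uE // ltr_norml => /andP[_]; lra.
have [h1 [hh1 h10 E1 u1]] := normalize df dg hh h0 E z01.
have a1 := f1 z0 z01; have b1 := g1 z0 z01.
have hz0 : cabs (h1 z0) = u z0.
  by rewrite /u -u1 // !mob_self cabs0 expr0n subr0 mulr1 divr1.
have [w w1 g'w] := hyp_nonconstant bg.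
apply: (no_interior_maximum (disc_map_mob df a1) (disc_map_mob dg b1) hh1 h10 E1 z01).
- by apply: nonconstant_mob dg b1 _; exists w.
- exact: mob_self.
- exact: mob_self.
- by rewrite hz0; lra.
- by move=> z z1; rewrite u1 // hz0; exact: umax.
Qed.

(** Integration raises the order of vanishing by one. Only a lower bound on the order is claimed:
    [l 0] and [q 0] may be 0. *)
Lemma hol0_zero_factor f n l : hol 0 1 f -> f 0 = 0 -> hol 0 1 l ->
  (forall z, cabs z < 1 -> 'D_1 f z = z ^+ n * l z) ->
  exists2 q, ccont q 0 & forall z, cabs z < 1 -> f z = z ^+ n.+1 * q z.
Proof.
move=> hf f0 hl E; have z01 : cabs (0 : C) < 1 by rewrite cabs0.
have [fz|[m [q [hq q0 qE]]]] := zero_order_origin hf.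
  by exists (fun=> 0) => [|z z1]; [exact: ccont_cst | rewrite fz // mulr0].
case: m qE => [|m] qE.
  by have := qE 0 z01; rewrite f0 expr0 mul1r => q00; rewrite -q00 eqxx in q0.
have qE' z : cabs z < 1 -> f z = (z - 0) ^+ m.+1 * q z by rewrite subr0; exact: qE.
have nm : (n <= m)%N.
  apply: (@vanishing_le R _ l 0 1 m n ltr01 (derive_power_cont m z01 hq)).
  - exact: hol0_cont.
  - by rewrite derive_power_at mulf_neq0 // pnatr_eq0.
  - move=> z _ zt; have z1 : cabs z < 1 by rewrite -[z]subr0.
    by rewrite -(derive_power hq qE' z1) (subr0 z); exact: E.
exists (fun z => z ^+ (m - n) * q z).
  by apply: ccontM; [exact/ccontX/ccont_id | exact: hol0_cont].
by move=> z z1; rewrite qE // mulrA -exprD addSn subnKC.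
Qed.

(* With f 0 = g 0 = 0: if h = h 0 + z^n l with l 0 != 0 and n > 0, then
   f - h 0 g = O(z^(n+1)), hence |h| = 1 + O(|z|^(n+1)), whereas |h| - 1 is of
   order |z|^n in a suitable direction. *)
Lemma isometric_quotient_constant f g h : disc_map f -> disc_map g -> hol 0 1 h ->
  (forall z, cabs z < 1 -> 'D_1 f z = h z * 'D_1 g z) -> f 0 = 0 -> g 0 = 0 ->
  (forall z, cabs z < 1 -> cabs (h z) * (1 - cabs (g z) ^+ 2) = 1 - cabs (f z) ^+ 2) ->
  cabs (h 0) = 1 /\ forall z, cabs z < 1 -> f z = h 0 * g z.
Proof.
move=> [hf f1] [hg g1] hh E f0 g0 iso.
have z01 : cabs (0 : C) < 1 by rewrite cabs0.
have c1 : cabs (h 0) = 1.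
  by have := iso 0 z01; rewrite f0 g0 cabs0 expr0n subr0 mulr1.
have c0 : h 0 != 0 by rewrite -cabs_eq0 c1 oner_eq0.
have hd : hol 0 1 (fun z => f z - h 0 * g z).
  by apply: holB => //; apply: holM => //; exact: hol_cst.
have dE z : cabs z < 1 -> 'D_1 (fun z => f z - h 0 * g z) z = (h z - h 0) * 'D_1 g z.
  move=> z1; rewrite (cderiv_val (cderivB (hol0_deriv hf z1) (cderivZ (h 0) (hol0_deriv hg z1)))).
  by rewrite E // mulrBl.
split=> //.
have [hc|[n [l [hl l0 lE]]]] := zero_order_origin (holB hh (@hol_cst R 0 1 (h 0))).
  move=> z z1; apply/eqP; rewrite -subr_eq0; apply/eqP.
  have := constant_derivative hd _ z1; rewrite f0 g0 mulr0 subrr; apply => w w1.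
  by rewrite dE // hc // mul0r.
case: n lE => [|n] lE.
  by have := lE 0 z01; rewrite subrr expr0 mul1r => l00; rewrite -l00 eqxx in l0.
exfalso.
have [||||q cq qE] := @hol0_zero_factor (fun z => f z - h 0 * g z) n.+1 (fun z => l z * 'D_1 g z).
- exact: hd.
- by rewrite f0 g0 mulr0 subrr.
- by apply: holM => //; exact: hol_derive.
- by move=> z z1; rewrite dE // lE // mulrA.
have half : 0 < 1 / 2 :> R by rewrite divr_gt0.
have [t1 t10 H1] := cq _ ltr01.
have [t2 t20 H2] := hol0_cont hg z01 half.
have [t3 t30 H3] := power_direction (n := n.+1) isT (hol0_cont hl z01) l0 c0.
(* One factor 2 comes from |g|^2 - |f|^2 <= 2 (|g| - |f|)-type bounds, the other from 1 - |g|^2 >= 1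
   / 2; the 1 leaves room for |q z| near 0. *)
pose K := 4 * (1 + cabs (q 0)).
have K0 : 0 < K by rewrite /K mulr_gt0 // ltr_wpDr ?cabs_ge0.
have pl : 0 < cabs (l 0) by rewrite cabs_gt0.
pose T := Num.min (Num.min t1 t2) (Num.min t3 (Num.min 1 (cabs (l 0) / (2 * K)))).
have T0 : 0 < T by rewrite /T !lt_min t10 t20 t30 ltr01 divr_gt0 // mulr_gt0.
have [T1 T2 T3 [T4 T5]] : [/\ T <= t1, T <= t2, T <= t3 & T <= 1 /\ T <= cabs (l 0) / (2 * K)].
  by split; rewrite /T ?ge_min ?lexx ?orbT //; split; rewrite !ge_min lexx ?orbT.
pose r := T / 2.
have r0 : 0 < r by rewrite divr_gt0.
have [|z zr] := H3 r; first by apply/andP; split; rewrite /r; lra.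
have zr' : cabs z = r by rewrite -zr subr0.
have z1 : cabs z < 1 by rewrite zr' /r; lra.
rewrite subr0 -lE // mulrBr cReB [cconj _ * h 0]mulrC mul_cconj cRe_rc c1 expr1n mul1r => B1.
have := le_trans (ler_norm _) (cRe_le (cconj (h 0) * h z)).
rewrite cabsM cabs_conj c1 mul1r => B2.
have zt1 : cabs (z - 0) < t1 by rewrite zr /r; lra.
have zt2 : cabs (z - 0) < t2 by rewrite zr /r; lra.
have := H2 z zt2; rewrite g0 subr0 => gz.
have := H1 z zt1; have := cabs_sub (q z) (q 0) => qs qz.
have qK : cabs (q z) <= K / 4 by rewrite /K; lra.
have dz : cabs (f z - h 0 * g z) <= r ^+ n.+2 * (K / 4).
  rewrite qE // cabsM cabsX zr'; apply: ler_wpM2l => //.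
  by rewrite exprn_ge0 // ltW.
have fg : cabs (g z) - cabs (f z) <= r ^+ n.+2 * (K / 4).
  have := cabs_sub (h 0 * g z) (f z); rewrite cabsM c1 mul1r cabsC; lra.
have := iso z z1.
have gz0 := cabs_ge0 (g z); have fz0 := cabs_ge0 (f z); have fz1 := f1 z z1.
have g2 : cabs (g z) ^+ 2 <= 1 / 2.
  have : cabs (g z) * cabs (g z) <= 1 / 2 * 1 by apply: ler_pM => //; lra.
  by rewrite expr2; lra.
have L0 : 0 <= r ^+ n.+2 * (K / 4) by rewrite mulr_ge0 ?exprn_ge0 ?ltW ?divr_gt0.
move: fg L0; set L := r ^+ n.+2 * (K / 4) => fg L0.
have fg2 : cabs (g z) ^+ 2 - cabs (f z) ^+ 2 <= 2 * L.
  rewrite subr_sqr.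
  have : (cabs (g z) - cabs (f z)) * (cabs (g z) + cabs (f z)) <= L * (cabs (g z) + cabs (f z)).
    by apply: ler_wpM2r => //; exact: addr_ge0.
  have : L * (cabs (g z) + cabs (f z)) <= L * 2 by apply: ler_wpM2l => //; lra.
  by lra.
move=> isoz.
(* The isometry identity reads (|h| - 1) (1 - |g|^2) = |g|^2 - |f|^2. *)
have hz : cabs (h z) - 1 <= 4 * L.
  have [hz1|hz1] := leP (cabs (h z)) 1; first by lra.
  have : (cabs (h z) - 1) * (1 / 2) <= (cabs (h z) - 1) * (1 - cabs (g z) ^+ 2).
    by apply: ler_wpM2l; lra.
  by lra.
have rl : r * K < cabs (l 0) / 2.
  have : T * (2 * K) <= cabs (l 0) by rewrite -ler_pdivlMr // mulr_gt0.
  by have := mulr_gt0 T0 K0; rewrite /r; lra.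
have rn : 0 < r ^+ n.+1 by rewrite exprn_gt0.
have : r ^+ n.+1 * (r * K) < r ^+ n.+1 * (cabs (l 0) / 2) by rewrite ltr_pM2l.
have -> : r ^+ n.+1 * (r * K) = 4 * L by rewrite /L [r ^+ n.+2]exprS; field.
by lra.
Qed.

Lemma rotate_disc_map c f : cabs c = 1 -> disc_map f -> disc_map (fun z => c * f z).
Proof.
move=> c1 [hf f1]; split; last by move=> z z1; rewrite cabsM c1 mul1r f1.
by apply: holM => //; exact: hol_cst.
Qed.

Lemma disc_map_id : disc_map (id : C -> C).
Proof. by split; first exact: hol_id. Qed.

Lemma moebius_automorphism a b c : cabs a < 1 -> cabs b < 1 -> cabs c = 1 ->
  disc_automorphism (fun z => mob (- a) (c * mob b z)).
Proof.
move=> a1 b1 c1.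
have aN1 : cabs (- a) < 1 by rewrite cabsN.
have bN1 : cabs (- b) < 1 by rewrite cabsN.
have c0 : c != 0 by rewrite -cabs_eq0 c1 oner_eq0.
have cV1 : cabs c^-1 = 1 by rewrite cabsV c1 invr1.
have mk x y d : cabs x < 1 -> cabs y < 1 -> cabs d = 1 ->
    disc_map (fun z => mob x (d * mob y z)).
  move=> x1 y1 d1; apply: disc_map_mob => //; apply: rotate_disc_map => //.
  exact: disc_map_mob disc_map_id y1.
have [h1 m1] := mk _ _ _ aN1 b1 c1; have [h2 m2] := mk _ _ _ bN1 a1 cV1.
split; [by move=> z /unit_discE/m1/unit_discE | exact/holomorphic_onE |].
exists (fun w => mob (- b) (c^-1 * mob a w)); split.
- by move=> z /unit_discE/m2/unit_discE.
- exact/holomorphic_onE.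
- move=> z /unit_discE z1; rewrite mobNK //; last by rewrite cabsM c1 mul1r mob_lt1.
  by rewrite mulKf // mobK.
- move=> z /unit_discE z1; rewrite mobNK //; last by rewrite cabsM cV1 mul1r mob_lt1.
  by rewrite mulVKf // mobK.
Qed.

End Uniqueness.
(** * Conclusion *)

Section Conclusion.
Variable R : realType.
Local Notation C := (Cplx R).
Implicit Types (z w c : C) (f g q tau : C -> C).

Lemma proper_disc_map f : proper_holomorphic_self_map f -> disc_map f.
Proof.
move=> [fD /holomorphic_onE hf _]; split=> // z z1.
exact/unit_discE/fD/unit_discE.
Qed.

Lemma same_critical_points_moebius f g :
  proper_holomorphic_self_map f -> proper_holomorphic_self_map g ->
  same_critical_points (unit_disc R) f g ->
  exists2 tau, disc_automorphism tau & forall z, cabs z < 1 -> f z = tau (g z).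
Proof.
move=> pf pg same.
have df := proper_disc_map pf; have dg := proper_disc_map pg.
have bf := bdry1_hyp df (proper_bdry1 pf); have bg := bdry1_hyp dg (proper_bdry1 pg).
have [hf f1] := df; have [hg g1] := dg.
have [h [hh h0 E]] := critical_quotient hf hg (hyp_nonconstant bg) same.
have le_fg := hyp_quotient_le1 df dg hh bf bg h0 E.
(* The same inequality with f and g exchanged and 1 / h in place of h gives the reverse estimate. *)
have hV : hol 0 1 (fun z => (h z)^-1) by apply: holV hh => z; rewrite subr0; exact: h0.
have hV0 z : cabs z < 1 -> (h z)^-1 != 0 by move=> z1; rewrite invr_neq0 // h0.
have EV z : cabs z < 1 -> 'D_1 g z = (h z)^-1 * 'D_1 f z.
  by move=> z1; rewrite (E z z1) mulKf // h0.
have le_gf := hyp_quotient_le1 dg df hV bg bf hV0 EV.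
have z01 : cabs (0 : C) < 1 by rewrite cabs0.
have iso z : cabs z < 1 -> cabs (h z) * (1 - cabs (g z) ^+ 2) = 1 - cabs (f z) ^+ 2.
  move=> z1; apply/eqP; rewrite eq_le le_fg //=.
  by have := le_gf z z1; rewrite cabsV mulrC ler_pdivrMr ?cabs_gt0 ?h0 // mulrC.
have a1 := f1 0 z01; have b1 := g1 0 z01.
have [h1 [hh1 h10 E1 u1]] := normalize df dg hh h0 E z01.
have iso1 z : cabs z < 1 ->
    cabs (h1 z) * (1 - cabs (mob (g 0) (g z)) ^+ 2) = 1 - cabs (mob (f 0) (f z)) ^+ 2.
  move=> z1; have := u1 z z1; rewrite iso // divff; last first.
    by rewrite gt_eqF // one_sub_sqr_gt0 // f1.
  have p0 : 1 - cabs (mob (f 0) (f z)) ^+ 2 != 0.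
    by rewrite gt_eqF // one_sub_sqr_gt0 // mob_lt1 // f1.
  by move=> /(canRL (divfK p0)) ->; rewrite mul1r.
have [c1 fE] := isometric_quotient_constant (disc_map_mob df a1) (disc_map_mob dg b1)
  hh1 E1 (mob_self _) (mob_self _) iso1.
(* [fE] reads mob (f 0) (f z) = h1 0 * mob (g 0) (g z); this is its solution for f z. *)
exists (fun z => mob (- f 0) (h1 0 * mob (g 0) z)); first exact: moebius_automorphism.
by move=> z z1; rewrite -fE // mobK // f1.
Qed.

Lemma vanishing_order_mul q f g c : cabs c < 1 -> hol 0 1 q -> q c != 0 ->
  (forall z, cabs z < 1 -> f z = q z * g z) ->
  forall m, vanishing_order g c m -> vanishing_order f c m.
Proof.
move=> c1 hq qc E m [k [/nearCP[e1 e10 H1] kc /nearCP[e2 e20 H2]]].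
have p0 : 0 < 1 - cabs c by rewrite subr_gt0.
have inD z : cabs (z - c) < 1 - cabs c -> cabs z < 1 by have := cabs_sub z c; lra.
exists (fun z => q z * k z); split.
- apply/nearCP; exists (Num.min e1 (1 - cabs c)); first by rewrite lt_min e10.
  move=> z; rewrite lt_min => /andP[/H1/derivable_cderiv[d Hd] /inD z1].
  by apply/derivable_cderiv; eexists; exact: cderivM (hol0_deriv hq z1) Hd.
- by rewrite mulf_neq0.
- apply/nearCP; exists (Num.min e2 (1 - cabs c)); first by rewrite lt_min e20.
  move=> z; rewrite lt_min => /andP[/H2 gz /inD z1].
  by rewrite E // gz mulrCA.
Qed.

Lemma derivative_multiple_critical q f g : hol 0 1 q ->
  (forall z, cabs z < 1 -> q z != 0) ->
  (forall z, cabs z < 1 -> 'D_1 f z = q z * 'D_1 g z) ->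
  same_critical_points (unit_disc R) f g.
Proof.
move=> hq q0 E; have hV : hol 0 1 (fun z => (q z)^-1).
  by apply: holV hq => z; rewrite subr0; exact: q0.
have EV z : cabs z < 1 -> 'D_1 g z = (q z)^-1 * 'D_1 f z.
  by move=> z1; rewrite (E z z1) mulKf // q0.
split=> c /unit_discE c1.
  rewrite /critical_point; split=> D.
    by rewrite (EV c c1) D mulr0.
  by rewrite (E c c1) D mulr0.
move=> _ m; split.
  by apply: (vanishing_order_mul c1 hV _ EV); rewrite invr_neq0 // q0.
by apply: (vanishing_order_mul c1 hq _ E); exact: q0.
Qed.

Lemma automorphism_derivative tau : disc_automorphism tau ->
  forall z, cabs z < 1 -> 'D_1 tau z != 0.
Proof.
move=> [tauD /holomorphic_onE ht [s [sD /holomorphic_onE hs sK _]]] z z1.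
have t1 : cabs (tau z) < 1 by apply/unit_discE/tauD/unit_discE.
have D := cderiv_comp (hol0_deriv ht z1) (hol0_deriv hs t1).
have pz : 0 < 1 - cabs z by rewrite subr_gt0.
have Did : cderiv (fun w => s (tau w)) z 1.
  apply: (cderiv_near pz) (cderiv_id z) => w wz.
  by rewrite sK //; apply/unit_discE; have := cabs_sub w z; lra.
have := cderiv_unique D Did => D1.
apply/eqP => t0; have /eqP := D1.
by rewrite t0 mulr0 eq_sym oner_eq0.
Qed.

(** By the chain rule f' = tau'(g) g', and tau' has no zeros because tau has a holomorphic
    inverse. *)
Lemma automorphism_same_critical_points f g tau : disc_map g -> disc_automorphism tau ->
  (forall z, cabs z < 1 -> f z = tau (g z)) ->
  same_critical_points (unit_disc R) f g.
Proof.
move=> [hg g1] at_ E; have [_ /holomorphic_onE ht _] := at_.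
have hcomp p : hol 0 1 p -> hol 0 1 (fun z => p (g z)).
  move=> hp z; rewrite subr0 => z1; eexists.
  exact: cderiv_comp (hol0_deriv hg z1) (hol0_deriv hp (g1 z z1)).
apply: (@derivative_multiple_critical (fun z => 'D_1 tau (g z))).
- exact: (hcomp _ (hol_derive ht)).
- by move=> z z1; apply: automorphism_derivative at_ _ _; exact: g1.
- move=> z z1; rewrite (derive_eq_on (f := fun z => tau (g z)) (c := 0) (r := 1)).
  + exact: cderiv_val (cderiv_comp (hol0_deriv hg z1) (hol0_deriv ht (g1 z z1))).
  + by move=> w; rewrite subr0 => /E.
  + exact: hcomp.
  + by rewrite subr0.
Qed.

End Conclusion.

Theorem corollary1 (R : realType) (f g : Cplx R -> Cplx R)
    (hf : proper_holomorphic_self_map f)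
    (hg : proper_holomorphic_self_map g) :
  same_critical_points (unit_disc R) f g <->
  exists tau : Cplx R -> Cplx R,
    disc_automorphism tau /\
    (forall z, unit_disc R z -> f z = tau (g z)).
Proof.
split.
  move=> /(same_critical_points_moebius hf hg)[tau at_ E].
  by exists tau; split=> // z /unit_discE; exact: E.
move=> [tau [at_ E]]; apply: (automorphism_same_critical_points (proper_disc_map hg) at_).
by move=> z /unit_discE; exact: E.
Qed.
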